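(* Let $\mathcal{M}$ be a family of axisymmetric metrics with nonnegative scalar curvature which is uniformly asymptotically flat outside of radius $R_0$. Let $\rho_0>0$ and suppose also that $\mathcal{M}$ is radially monotone at $\rho_0$. Additionally, assume that $A=B=0$ in the coordinate representations of the metrics in $\mathcal{M}$. Let $\rho_1>\max\{\rho_0,R_0\}$, $\epsilon>0$ and $\sigma>0$ be given, and let $x$ and $y$ be points such that the Euclidean line segment connecting them lies in $\tilde{\Omega}^{\rho_1}_{\rho_0}(\sigma)$. Then there exists a constant $\delta>0$ (which may depend on $x$ and $y$) such that if $g\in\mathcal{M}$ and $m(g)\le\delta$, then $$d_g(x,y)\le d(x,y)+\epsilon,$$ where $d_g$ is the Riemannian distance of $g$ and $d$ is the Euclidean distance in the cylindrical coordinates.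
   Context: Axisymmetric metrics: smooth, asymptotically flat Riemannian metrics $g$ given in global cylindrical coordinates $(\rho,z,\phi)$ on $\mathbb{R}^3$ by $g=e^{2\alpha-2u}(d\rho^2+dz^2)+\rho^2e^{-2u}(d\phi+B\,d\rho+A\,dz)^2$, where $\alpha,u,A,B$ depend only on $(\rho,z)$. The Killing field is $\eta=\partial/\partial\phi$. The ADM mass is $m(g)=\lim_{R\to\infty}\frac{1}{16\pi}\int_{S_R}(g_{ij,j}-g_{jj,i})\nu^i$; as a standing fact, $m(g)=\frac1{16\pi}\int_{\mathbb{R}^3}\Big[e^{-2(u-\alpha)}\big(R_g+\tfrac{\rho^2e^{-4\alpha+2u}}{2}(\partial_zB-\partial_\rho A)^2\big)+2|\nabla u|^2\Big]\rho\,d\rho\,dz\,d\phi$, with $R_g$ the scalar curvature and $|\nabla u|$ Euclidean. Uniformly asymptotically flat outside of radius $R_0$: there is a constant $C$ such that for every $g\in\mathcal{M}$ and all $r=\sqrt{\rho^2+z^2}\ge R_0$, $|\partial^I u|,|\partial^I\alpha|,|\partial^I A|,|\partial^I B|\le C/r^{1+|I|}$ for multi-indices $|I|\le 2$. Radially monotone at $\rho_0$: for each $g\in\mathcal{M}$, $\frac{\partial}{\partial\rho}\Big(\frac1\rho\frac{|\eta|_g}{|\nabla\rho|_g}\Big)\le0$ on $\{\rho=\rho_0\}$; equivalently $\partial_\rho(\alpha-2u)(\rho_0,z)\le 0$ for all $z$. Region: $\tilde\Omega^{\rho_1}_{\rho_0}(\sigma)=\{\rho_0+\sigma\le\rho\le\rho_1,\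 |z|\le\rho_1/2\}\times[0,2\pi)$. *)

(* Defs.v *)
From HB Require Import structures.
From mathcomp Require Import all_boot all_order all_algebra.
From mathcomp Require Import all_classical all_reals all_analysis.

Set Implicit Arguments.
Unset Strict Implicit.
Unset Printing Implicit Defensive.

Import Order.TTheory GRing.Theory Num.Theory.
Import numFieldNormedType.Exports.

Local Open Scope classical_set_scope.
Local Open Scope ring_scope.

Section Calculus.
Context {R : realType} {n : nat}.
Implicit Types (f : 'rV[R]_n -> R) (p : 'rV[R]_n).

Definition pd (i : 'I_n) f : 'rV[R]_n -> R := fun p => 'D_(delta_mx 0 i) f p.

(* A multi-index is the list of the variables of differentiation; its order
   is its size. *)
Definition pds (I : seq 'I_n) f : 'rV[R]_n -> R := foldr pd f I.

(* Only meaningful for open D. *)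
Definition smooth_on (D : set 'rV[R]_n) f : Prop :=
  forall (I : seq 'I_n) p, D p ->
    {for p, continuous (pds I f)} /\
    forall i : 'I_n, derivable (pds I f) p (delta_mx 0 i).

(* The topology of 'rV[R]_n comes with the sup norm, hence this one. *)
Definition enorm p : R := Num.sqrt (\sum_i p 0 i ^+ 2).

Definition differential f p : 'rV[R]_n := \row_i pd i f p.

End Calculus.

Section Riemannian.
Context {R : realType}.
Implicit Types (g : 'rV[R]_3 -> 'M[R]_3) (p v w x y : 'rV[R]_3).

Definition riemannian g : Prop :=
  [/\ forall i j, smooth_on setT (fun p => g p i j),
      forall p, (g p)^T = g p &
      forall p v, v != 0 -> 0 < (v *m g p *m v^T) 0 0].

Definition gnorm g p v : R := Num.sqrt ((v *m g p *m v^T) 0 0).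

Definition gradient g (f : 'rV[R]_3 -> R) p : 'rV[R]_3 :=
  differential f p *m invmx (g p).

(* christoffel g k i j is the symbol of the second kind, with k the upper
   index. *)
Definition christoffel g (k i j : 'I_3) p : R :=
  2^-1 * \sum_l invmx (g p) k l *
    (pd i (fun q => g q j l) p + pd j (fun q => g q i l) p
     - pd l (fun q => g q i j) p).

(* Sign convention: round spheres have positive curvature. *)
Definition ricci g (j k : 'I_3) p : R :=
  \sum_i (pd i (christoffel g i j k) p - pd k (christoffel g i i j) p
    + \sum_l (christoffel g i i l p * christoffel g l j k p
              - christoffel g i k l p * christoffel g l i j p)).

Definition scalar_curvature g p : R :=
  \sum_j \sum_k invmx (g p) j k * ricci g j k p.

Definition asymptotically_flat g : Prop :=
  exists tau C R1 : R, [/\ 2^-1 < tau, 0 < R1 &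
    forall p (i j : 'I_3) (I : seq 'I_3), R1 <= enorm p -> (size I <= 2)%N ->
      `|pds I (fun q => g q i j - (i == j)%:R) p|
        <= C * enorm p `^ (- (tau + (size I)%:R))].

Definition sphere_normal (theta phi : R) : 'rV[R]_3 :=
  \row_(i < 3) [:: sin theta * cos phi; sin theta * sin phi; cos theta]`_i.

(* The integral of (g_ij,j - g_jj,i) nu^i over the coordinate sphere of radius
   r, with area element r^2 sin(theta) d(theta) d(phi). *)
Definition adm_flux g (r : R) : R :=
  \int[lebesgue_measure]_(theta in `[0, pi])
    \int[lebesgue_measure]_(phi in `[0, pi *+ 2])
      ((\sum_i \sum_j
         (pd j (fun q => g q i j) (r *: sphere_normal theta phi)
          - pd i (fun q => g q j j) (r *: sphere_normal theta phi))
         * sphere_normal theta phi 0 i) * (r ^+ 2 * sin theta)).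

Definition adm_mass g : R := lim (((16 * pi)^-1 * adm_flux g r) @[r --> +oo]).

Definition C1_on (a b : R) (c : R -> 'rV[R]_3) : Prop :=
  {within `[a, b], continuous c} /\
  exists2 c' : R -> 'rV[R]_3, {within `[a, b], continuous c'} &
    forall t, a < t < b -> is_derive t 1 c (c' t).

(* The list s holds the points t_1 < ... < t_m = 1 of a subdivision starting
   at t_0 = 0. *)
Definition piecewise_C1 (c : R -> 'rV[R]_3) : Prop :=
  exists s : seq R, [/\ path <%R 0 s, last 0 s = 1 &
    forall k, (k < size s)%N -> C1_on (nth 0 (0 :: s) k) (nth 0 s k) c].

(* At the finitely many corners the value of derive1 c is irrelevant. *)
Definition curve_length g (c : R -> 'rV[R]_3) : R :=
  \int[lebesgue_measure]_(t in `[0, 1]) gnorm g (c t) (derive1 c t).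

Definition riemannian_dist g x y : R :=
  inf [set curve_length g c |
        c in [set c | [/\ piecewise_C1 c, c 0 = x & c 1 = y]]].

End Riemannian.

Section Axisymmetric.
Context {R : realType}.
Implicit Types (p : 'rV[R]_3) (q : 'rV[R]_2).

Definition xco p : R := p 0 (inord 0).
Definition yco p : R := p 0 (inord 1).
Definition zco p : R := p 0 (inord 2).
Definition rho p : R := Num.sqrt (xco p ^+ 2 + yco p ^+ 2).

(* The orbit space is the half-plane of the rows (rho, z) with 0 < rho. *)
Definition rz p : 'rV[R]_2 := \row_(i < 2) [:: rho p; zco p]`_i.
Definition half_plane : set 'rV[R]_2 := [set q | 0 < q 0 0].

(* The coordinate covectors off the axis, in the basis dx, dy, dz. *)
Definition drho p : 'rV[R]_3 :=
  \row_(i < 3) [:: xco p / rho p; yco p / rho p; 0]`_i.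
Definition dz : 'rV[R]_3 := \row_(i < 3) [:: 0; 0; 1]`_i.
Definition dphi p : 'rV[R]_3 :=
  \row_(i < 3) [:: - yco p / rho p ^+ 2; xco p / rho p ^+ 2; 0]`_i.

(* The coordinate vectors off the axis, in the Cartesian basis. *)
Definition partial_rho p : 'rV[R]_3 :=
  \row_(i < 3) [:: xco p / rho p; yco p / rho p; 0]`_i.
Definition eta p : 'rV[R]_3 := \row_(i < 3) [:: - yco p; xco p; 0]`_i.

Definition sqform (w : 'rV[R]_3) : 'M[R]_3 := w^T *m w.

Definition cylindrical_form (alpha u A B : 'rV[R]_2 -> R) p : 'M[R]_3 :=
  let q := rz p in
  expR (2 * alpha q - 2 * u q) *: (sqform (drho p) + sqform dz)
  + (rho p ^+ 2 * expR (- 2 * u q)) *: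
      sqform (dphi p + B q *: drho p + A q *: dz).

End Axisymmetric.

(* The metric is given by its Cartesian components on all of R^3, so that its
   smoothness includes smoothness across the axis, where the cylindrical
   coordinates degenerate.  The values of the coefficient functions outside
   the half-plane are irrelevant. *)
Record axisym_metric (R : realType) := AxisymMetric {
  metric :> 'rV[R]_3 -> 'M[R]_3;
  coef_alpha : 'rV[R]_2 -> R;
  coef_u : 'rV[R]_2 -> R;
  coef_A : 'rV[R]_2 -> R;
  coef_B : 'rV[R]_2 -> R;
  metric_riemannian : riemannian metric;
  metric_flat_at_infinity : asymptotically_flat metric;
  coef_smooth : [/\ smooth_on half_plane coef_alpha,
                    smooth_on half_plane coef_u,
                    smooth_on half_plane coef_A &
                    smooth_on half_plane coef_B];
  metric_cylindrical : forall p, 0 < rho p ->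
    metric p = cylindrical_form coef_alpha coef_u coef_A coef_B p }.

Section Families.
Context {R : realType}.
Implicit Types (M : set (axisym_metric R)).

Definition nonneg_scalar_curvature M : Prop :=
  forall g, M g -> forall p, 0 <= scalar_curvature g p.

Definition uniformly_asymptotically_flat M (R0 : R) : Prop :=
  exists C : R, forall g, M g ->
    forall (q : 'rV[R]_2) (I : seq 'I_2),
      half_plane q -> R0 <= enorm q -> (size I <= 2)%N ->
      [/\ `|pds I (coef_u g) q| <= C / enorm q ^+ (1 + size I),
          `|pds I (coef_alpha g) q| <= C / enorm q ^+ (1 + size I),
          `|pds I (coef_A g) q| <= C / enorm q ^+ (1 + size I) &
          `|pds I (coef_B g) q| <= C / enorm q ^+ (1 + size I)].

Definition radially_monotone M (rho0 : R) : Prop :=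
  forall g, M g -> forall p, rho p = rho0 ->
    'D_(partial_rho p)
      (fun q => (rho q)^-1 * (gnorm g q (eta q) / gnorm g q (gradient g rho q)))
      p <= 0.

Definition vanishing_AB M : Prop :=
  forall g, M g -> forall q, half_plane q -> coef_A g q = 0 /\ coef_B g q = 0.

Definition tube (rho0 rho1 sigma : R) : set 'rV[R]_3 :=
  [set p | rho0 + sigma <= rho p <= rho1 /\ `|zco p| <= rho1 / 2].

Definition segment_in (x y : 'rV[R]_3) (D : set 'rV[R]_3) : Prop :=
  forall t : R, 0 <= t <= 1 -> D ((1 - t) *: x + t *: y).

End Families.

(* Main.v *)
(* Write l = alpha - u and w = alpha - 2 u, so that lengths are at most
   max(e^l, e^(-u)) times the Euclidean ones, and l = w + u.

   Mass controls energy: nonnegative scalar curvature says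
   w_xx + w_zz <= 2 u_x / x - |grad u|^2 (x is the distance to the axis), hence
   a vector field built from alpha and w has divergence at least 2 x |grad u|^2,
   and its flux through the half-circles of the half-plane is nondecreasing in
   the radius and asymptotic to that of the ADM mass.  So the energy of u on
   {x >= rho0} is O(m).  Testing the inequality for w against truncations of w
   on {x >= rho0}, where the boundary term has the sign given by radial
   monotonicity, bounds the truncated energies of w as well.

   Energy controls traces: on a large box f (one of w, u, -u) is small on the
   outer sides.  Cutting its range in layers of width e, small layer energies
   make the areas of the superlevel sets decay geometrically as fast as we like
   (isoperimetry by slicing, in the plane), so that e^(2 f) has a small excess
   on every graph over the z axis, not only on average.

   Since the graph must not be horizontal, the segment is replaced by a broken
   line with a slight vertical deviation; its g-length bounds the distance. *)

Require Import Defs.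
From mathcomp Require Import all_boot all_order all_algebra.
From mathcomp Require Import all_classical all_reals all_analysis.
From mathcomp Require Import measurable_realfun ring lra.
Import Order.TTheory GRing.Theory Num.Theory.
Import numFieldNormedType.Exports.
Local Open Scope classical_set_scope.
Local Open Scope ring_scope.
Set Implicit Arguments.
Unset Strict Implicit.
Unset Printing Implicit Defensive.

(** * Continuity and derivation rules *)

(** Since [w] satisfies only an inequality, a test function costs its supremum: bounded truncations
    give one bound [kappa] for the energy of every layer, the same at all heights, and no bound for
    the full Dirichlet energy of [w]. The layers cannot simply be summed, so the decay has to come
    from the areas: a layer has slope only where the previous one equals 1, and a small [kappa]
    shrinks the area by a fixed factor per layer. Since [e^l = e^w e^u] is estimated by squares,
    integrals of [e^(2 f)] are required, whose weights grow by [e^(2 e)] per layer; the rate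
    [q = tau e^(-2 e)] beats this growth and leaves the factor [tau] to spare.

    This chains the constants. The trace bound is proportional to the box size [L], so [tau] is
    chosen after [L], and [kappa] after [tau]. But the flux of [grad w] through the outer sides must
    be small against [kappa]. Hence a second, larger box of size [L'], on which the untested
    inequality is integrated, and only then [delta]. The decay constant [C] is common to the family,
    so [delta] does not depend on the metric. *)

Section ContinuityRules.
Context {R : realType} {T : topologicalType}.
Implicit Types (f g : T -> R).

Lemma ctD f g : continuous f -> continuous g -> continuous (fun x => f x + g x).
Proof. by move=> cf cg x; apply: cvgD; [exact: cf|exact: cg]. Qed.

Lemma ctN f : continuous f -> continuous (fun x => - f x).
Proof. by move=> cf x; apply: cvgN; exact: cf. Qed.

Lemma ctM f g : continuous f -> continuous g -> continuous (fun x => f x * g x).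
Proof. by move=> cf cg x; apply: cvgM; [exact: cf|exact: cg]. Qed.

Lemma ctX f n : continuous f -> continuous (fun x => f x ^+ n).
Proof.
move=> cf; elim: n => [|n IH].
  have -> : (fun x => f x ^+ 0) = cst 1 by apply/funext => x; rewrite expr0.
  exact: cst_continuous.
have -> : (fun x => f x ^+ n.+1) = (fun x => f x * f x ^+ n).
  by apply/funext => x; rewrite exprS.
exact: ctM.
Qed.

Lemma ct_cst (k : R) : continuous (fun _ : T => k).
Proof. by move=> x; exact: cst_continuous. Qed.

Lemma ct_comp (h : R -> R) f : continuous h -> continuous f ->
  continuous (fun x => h (f x)).
Proof. by move=> ch cf x; apply: continuous_comp; [exact: cf|exact: ch]. Qed.

Lemma ctV f : (forall x, f x != 0) -> continuous f -> continuous (fun x => (f x)^-1).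
Proof. by move=> f0 cf x; apply: cvgV; [exact: f0|exact: cf]. Qed.

Lemma ct_norm f : continuous f -> continuous (fun x => `|f x|).
Proof. by move=> cf x; apply: cvg_norm; exact: cf. Qed.

Lemma ct_max f g : continuous f -> continuous g ->
  continuous (fun x => Num.max (f x) (g x)).
Proof.
move=> cf cg.
have -> : (fun x => Num.max (f x) (g x)) = (fun x => (f x + g x + `|f x - g x|) / 2).
  by apply/funext => x; exact: maxr_absE.
by apply: ctM; [apply: ctD; [exact: ctD|apply: ct_norm; apply: ctD => //; exact: ctN]|exact: ct_cst].
Qed.

Lemma ct_comp2 (h : R -> R -> R) f g :
  continuous (fun p : R * R => h p.1 p.2) -> continuous f -> continuous g ->
  continuous (fun x => h (f x) (g x)).
Proof.
move=> ch cf cg x; apply: (@continuous2_cvg _ _ _ _ (nbhs x) _ f g h).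
- exact: (ch (f x, g x)).
- exact: cf.
- exact: cg.
Qed.

End ContinuityRules.

Lemma ct_id {R : realType} : continuous (fun x : R => x).
Proof. by move=> x; exact: cvg_id. Qed.

Lemma ct_fst {R : realType} : continuous (fun p : R * R => p.1).
Proof. by move=> x; exact: cvg_fst. Qed.

Lemma ct_snd {R : realType} : continuous (fun p : R * R => p.2).
Proof. by move=> x; exact: cvg_snd. Qed.

Lemma ct_sqrt {R : realType} : continuous (@Num.sqrt R).
Proof. exact: sqrt_continuous. Qed.

Lemma ct_sin {R : realType} : continuous (@sin R).
Proof. exact: continuous_sin. Qed.

Lemma ct_cos {R : realType} : continuous (@cos R).
Proof. exact: continuous_cos. Qed.

Lemma ct_exp {R : realType} : continuous (@expR R).
Proof. exact: continuous_expR. Qed.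

(** Curried joint continuity on the whole plane; with globally continuous integrands the integrals
    below need no regularity conditions on their domains. *)
Definition continuous2 {R : realType} (f : R -> R -> R) : Prop :=
  continuous (fun p : R * R => f p.1 p.2).

Ltac cts_step := lazymatch goal with
  | |- continuous (fun p => p) => exact: ct_id
  | |- continuous (@sin _) => exact: ct_sin
  | |- continuous (@cos _) => exact: ct_cos
  | |- continuous (@expR _) => exact: ct_exp
  | |- continuous (@Num.sqrt _) => exact: ct_sqrt
  | |- continuous Num.norm => exact: (ct_norm ct_id)
  | |- continuous -%R => exact: (ctN ct_id)
  | |- continuous fst => exact: ct_fst
  | |- continuous snd => exact: ct_snd
  | |- continuous (fun p => p.1) => exact: ct_fst
  | |- continuous (fun p => p.2) => exact: ct_snd
  | |- continuous (fun p => _ + _) => apply: ctD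
  | |- continuous (fun p => - _) => apply: ctN
  | |- continuous (fun p => _ * _) => apply: ctM
  | |- continuous (fun p => _ ^+ _) => apply: ctX
  | |- continuous (fun p => `|_|) => apply: ct_norm
  | |- continuous (fun p => Num.max _ _) => apply: ct_max
  | |- continuous (fun p => Num.sqrt _) => apply: (ct_comp ct_sqrt)
  | |- continuous (fun p => sin _) => apply: (ct_comp ct_sin)
  | |- continuous (fun p => cos _) => apply: (ct_comp ct_cos)
  | |- continuous (fun p => expR _) => apply: (ct_comp ct_exp)
  | H : continuous2 ?h |- continuous (fun p => ?h _ _) => apply: (ct_comp2 H)
  | H : continuous ?h |- continuous (fun p => ?h _) => apply: (ct_comp H)
  | |- _ => first [exact: ct_cst | exact: ct_id | eassumption]
  end.
Ltac cts := rewrite /continuous2 /=; repeat first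
  [match goal with H : continuous ?f |- continuous ?g => constr_eq f g; exact: H end
  | cts_step].

Section DerivativeRules.
Context {R : realType}.
Implicit Types (f g : R -> R) (x df dg : R).

Lemma isd_mul f g x df dg : is_derive x 1 f df -> is_derive x 1 g dg ->
  is_derive x 1 (fun x => f x * g x) (df * g x + f x * dg).
Proof.
move=> hf hg; apply: is_derive_eq (is_deriveM hf hg) _.
by rewrite /GRing.scale /= addrC [g x * _]mulrC.
Qed.

Lemma isd_add f g x df dg : is_derive x 1 f df -> is_derive x 1 g dg ->
  is_derive x 1 (fun x => f x + g x) (df + dg).
Proof. by move=> hf hg; exact: is_deriveD. Qed.

Lemma isd_opp f x df : is_derive x 1 f df -> is_derive x 1 (fun x => - f x) (- df).
Proof. by move=> hf; exact: is_deriveN. Qed.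

Lemma isd_cst x (k : R) : is_derive x 1 (fun _ : R => k) 0.
Proof. exact: is_derive_cst. Qed.

Lemma isd_id x : is_derive x 1 (fun x : R => x) 1.
Proof. exact: is_derive_id. Qed.

Lemma isd_comp f g x df dg : is_derive (g x) 1 f df -> is_derive x 1 g dg ->
  is_derive x 1 (fun x => f (g x)) (df * dg).
Proof.
by move=> hf hg; apply: is_derive_eq (is_derive1_comp hf hg) _.
Qed.

Lemma isd_inv f x df : f x != 0 -> is_derive x 1 f df ->
  is_derive x 1 (fun x => (f x)^-1) (- df / f x ^+ 2).
Proof.
move=> fx0 [hf <-]; apply: DeriveDef; first exact: derivableV.
by rewrite deriveV // /GRing.scale /= mulrC mulrN mulNr.
Qed.

Lemma isd_eq f x df dg : is_derive x 1 f df -> df = dg -> is_derive x 1 f dg.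
Proof. by move=> h <-. Qed.

Lemma isd_ext f g x df : (\near x, f x = g x) -> is_derive x 1 f df ->
  is_derive x 1 g df.
Proof. exact: near_eq_is_derive. Qed.

End DerivativeRules.

(** * Integrals over intervals, half-discs and boxes *)

Section PlaneMeasurability.
Context {R : realType}.

(** The plane carries the product sigma-algebra; an open set is the union of the rational boxes
    inside it, and these are countably many. *)
Lemma open_measurable_plane (O : set (R * R)) : open O -> measurable O.
Proof.
move=> oO.
pose box (q : (rat * rat) * (rat * rat)) : set (R * R) :=
  `]ratr q.1.1, ratr q.1.2[ `*` `]ratr q.2.1, ratr q.2.2[.
pose F q := if `[< box q `<=` O >] then box q else set0.
have ratin (a b : R) : a < b -> exists q : rat, a < ratr q < b.
  by move=> /rat_in_itvoo[q]; rewrite in_itv /=; exists q.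
have -> : O = \bigcup_q F q.
  apply/seteqP; split => [[x y] Oxy|p [q _]]; last first.
    by rewrite /F; case: asboolP => // qO /qO.
  have /nbhs_ballP[e /= e0 eO] : nbhs (x, y) O by exact: open_nbhs_nbhs.
  have [|a /andP[a1 a2]] := ratin (x - e) x; first by lra.
  have [|b /andP[b1 b2]] := ratin x (x + e); first by lra.
  have [|c /andP[c1 c2]] := ratin (y - e) y; first by lra.
  have [|d /andP[d1 d2]] := ratin y (y + e); first by lra.
  have boxO : box ((a, b), (c, d)) `<=` O.
    move=> [x' y'] [] /=; rewrite !in_itv /= => /andP[x1 x2] /andP[y1 y2].
    by apply: eO; split; rewrite /ball /= ltr_norml; apply/andP; split; lra.
  exists ((a, b), (c, d)) => //; rewrite /F asboolT //.
  by split; rewrite /= in_itv /=; apply/andP.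
apply: countable_bigcupT_measurable => [|q]; first exact: countableP.
rewrite /F; case: asboolP => // _.
by apply: measurableX; exact: measurable_itv.
Qed.

Lemma continuous_measurable_plane (f : R * R -> R) :
  continuous f -> measurable_fun setT f.
Proof.
move=> /continuousP cf.
apply: (measurability _ (RGenOpens.measurableE R)).
move=> _ [_ [a [b ->] <-]]; rewrite setTI; apply: open_measurable_plane.
exact/cf/interval_open.
Qed.

End PlaneMeasurability.

(** Reversed bounds give 0, the interval being empty, and not the opposite of the integral. *)
Definition int1 {R : realType} (a b : R) (f : R -> R) : R :=
  \int[lebesgue_measure]_(x in `[a, b]) f x.

Section Integrals.
Context {R : realType}.
Implicit Types (a b c d k x y z : R) (f g F : R -> R) (h : R -> R -> R).

Lemma int1_integrable a b f : continuous f ->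
  lebesgue_measure.-integrable `[a, b] (EFin \o f).
Proof.
move=> cf; apply: continuous_compact_integrable; first exact: segment_compact.
exact: continuous_subspaceT.
Qed.

Lemma eq_int1 a b f g : (forall x, a <= x <= b -> f x = g x) ->
  int1 a b f = int1 a b g.
Proof.
move=> fg; apply: eq_Rintegral => x; rewrite inE /= in_itv /=; exact: fg.
Qed.

Lemma le_int1 a b f g : continuous f -> continuous g ->
  (forall x, a <= x <= b -> f x <= g x) -> int1 a b f <= int1 a b g.
Proof.
move=> cf cg fg; apply: le_Rintegral => [|||x /=].
- exact: measurable_itv.
- exact: int1_integrable.
- exact: int1_integrable.
- by rewrite in_itv /=; exact: fg.
Qed.

Lemma int1D a b f g : continuous f -> continuous g ->
  int1 a b (fun x => f x + g x) = int1 a b f + int1 a b g.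
Proof. by move=> cf cg; apply: RintegralD => //; exact: int1_integrable. Qed.

Lemma int1B a b f g : continuous f -> continuous g ->
  int1 a b (fun x => f x - g x) = int1 a b f - int1 a b g.
Proof. by move=> cf cg; apply: RintegralB => //; exact: int1_integrable. Qed.

Lemma int1Zl a b f k : continuous f ->
  int1 a b (fun x => k * f x) = k * int1 a b f.
Proof. by move=> cf; apply: RintegralZl => //; exact: int1_integrable. Qed.

Lemma int1_cst a b k : a <= b -> int1 a b (fun=> k) = k * (b - a).
Proof.
move=> ab; rewrite /int1 Rintegral_cst //; congr (k * _).
have := congr1 fine (@lebesgue_measure_itv R `[a, b]).
move=> /= ->; rewrite lte_fin.
case: (ltP a b) => //= ba; lra.
Qed.

Lemma int1_ge0 a b f : (forall x, a <= x <= b -> 0 <= f x) -> 0 <= int1 a b f.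
Proof. by move=> f0; apply: Rintegral_ge0 => x /=; rewrite in_itv /=; exact: f0. Qed.

Lemma int1_split a b c f : continuous f -> a <= c -> c <= b ->
  int1 a b f = int1 a c f + int1 c b f.
Proof.
move=> cf ac cb.
have := @Rintegral_itvB R f (BLeft a) (BRight b) c (int1_integrable a b cf).
rewrite !bnd_simp => /(_ ac cb) h.
rewrite -[int1 a b f](subrK (int1 a c f)) addrC; congr (_ + _).
rewrite {1}/int1 h Rintegral_itv_obnd_cbnd //.
by apply: integrableS (int1_integrable c b cf) => //; exact: subset_itv_oc_cc.
Qed.

Lemma int1_subset a b a' b' f : continuous f -> a <= a' -> b' <= b ->
  (forall x, a <= x <= b -> 0 <= f x) -> int1 a' b' f <= int1 a b f.
Proof.
move=> cf aa bb f0; have [ab|ab] := leP a' b'; last first.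
  rewrite {1}/int1 set_itv_ge ?bnd_simp -?ltNge // Rintegral_set0.
  exact: int1_ge0.
rewrite (int1_split cf aa) ?(le_trans ab) // (int1_split cf ab bb).
rewrite addrCA lerDl addr_ge0 //; apply: int1_ge0 => x xab; apply: f0; lra.
Qed.

(** Turns variable bounds into an indicator, so that integrals over a disc become integrals over a
    fixed box. *)
Lemma int1_indic a b a' b' f : a <= a' -> b' <= b ->
  int1 a b (fun x => f x * \1_(`[a', b']%classic : set R) x) = int1 a' b' f.
Proof.
move=> aa bb; rewrite /int1.
rewrite [in RHS](_ : `[a', b']%classic = `[a, b]%classic `&` `[a', b']%classic); last first.
  apply/esym/setIidPr => x /=; rewrite !in_itv /=; lra.
rewrite [RHS]Rintegral_mkcondr; apply: eq_Rintegral => x xab.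
by rewrite patchE indicE; case: ifPn; rewrite ?mulr1 ?mulr0.
Qed.

Lemma int1_FTC a b f F : a <= b -> continuous f ->
  (forall x, is_derive x 1 F (f x)) -> int1 a b f = F b - F a.
Proof.
rewrite le_eqVlt => /predU1P[<-|ab] cf dF.
  by rewrite /int1 set_itv1 Rintegral_set1 subrr.
have cF x : {for x, continuous F}.
  apply: differentiable_continuous; apply/derivable1_diffP.
  by have [] := dF x.
rewrite /int1 /Rintegral (continuous_FTC2 (F := F) ab) //.
- exact: continuous_subspaceT.
- split => [x _||]; first by have [] := dF x.
    by apply: cvg_at_right_filter; exact: cF.
  by apply: cvg_at_left_filter; exact: cF.
- by move=> x _; rewrite derive1E; exact: derive_val.
Qed.

Lemma continuous2_bounded a b c d h : continuous2 h -> exists M, forall x y,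
  a <= x <= b -> c <= y <= d -> `|h x y| <= M.
Proof.
move=> ch.
have cK : compact (`[a, b] `*` `[c, d] : set (R * R)).
  by apply: compact_setX; exact: segment_compact.
have := continuous_compact (continuous_subspaceT ch) cK.
move=> /compact_bounded [M [_ hM]]; exists (M + 1) => x y xab ycd.
apply: (hM (M + 1)); first by rewrite ltrDl.
by exists (x, y) => //; split; rewrite /= in_itv.
Qed.

Lemma continuous2_l h y : continuous2 h -> continuous (h ^~ y).
Proof.
move=> ch x; apply: (@continuous2_cvg _ _ _ _ (nbhs x) _ id (cst y) h x y).
- exact: (ch (x, y)).
- exact: cvg_id.
- exact: cvg_cst.
Qed.

Lemma continuous2_r h x : continuous2 h -> continuous (h x).
Proof.
move=> ch y; apply: (@continuous2_cvg _ _ _ _ (nbhs y) _ (cst x) id h x y).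
- exact: (ch (x, y)).
- exact: cvg_cst.
- exact: cvg_id.
Qed.

Lemma continuous_int1 a b h : continuous2 h ->
  continuous (fun y => int1 a b (h ^~ y)).
Proof.
move=> ch y.
have [M hM] := continuous2_bounded a b (y - 1) (y + 1) ch.
apply: (@continuity_under_integral _ _ _ lebesgue_measure (fun y x => h x y)
   `[a, b] _ (y - 1) (y + 1) _ _ (fun=> M)) => //.
- by move=> z _; apply: int1_integrable; exact: continuous2_l.
- by apply: aeW => x _ z _; exact: continuous2_r.
- by apply: int1_integrable => x; exact: cst_continuous.
- move=> z /=; rewrite in_itv /= => zy; apply: aeW => x /=; rewrite in_itv /= => xab.
  by apply: hM => //; case/andP: zy => *; apply/andP; split; exact: ltW.
- by rewrite inE /= in_itv /=; lra.
Qed.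

(** The form to which Fubini's theorem applies. The hypothesis makes the inner integral finite, so
    that [fine] can be undone. *)
Lemma int1_iterated a b c d (G : R -> R -> R) :
  (forall x, lebesgue_measure.-integrable `[c, d] (EFin \o G x)) ->
  int1 a b (fun x => int1 c d (G x)) =
  fine (\int[lebesgue_measure]_x \int[lebesgue_measure]_y
    (G x y * (\1_(`[a, b]%classic : set R) x * \1_(`[c, d]%classic : set R) y))%:E)%E.
Proof.
move=> iG; rewrite /int1 /Rintegral; congr fine.
rewrite [LHS]integral_mkcond; apply: eq_integral => x _; rewrite patchE /=.
rewrite [\1_(`[a, b]%classic : set R) x]indicE; case: ifPn => xab /=; last first.
  by rewrite integral0_eq // => y _; rewrite mul0r mulr0.
rewrite fineK; last by apply: integrable_fin_num; [exact: measurable_itv|exact: iG].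
rewrite [LHS]integral_mkcond.
apply: eq_integral => y _; rewrite patchE mul1r [\1_(`[c, d]%classic : set R) y]indicE /=.
by case: ifPn; rewrite ?mulr1 ?mulr0.
Qed.

(** The set [D] carries the shape of the domain: a disc in [half_disc_swap], the whole plane in
    [int2_swap]. *)
Lemma int1_swap_indic a b c d h (D : set (R * R)) : continuous2 h ->
  measurable D ->
  int1 a b (fun x => int1 c d (fun y => h x y * \1_D (x, y))) =
  int1 c d (fun y => int1 a b (fun x => h x y * \1_D (x, y))).
Proof.
move=> ch mD.
have [M hM] := continuous2_bounded a b c d ch.
pose B : set (R * R) := `[a, b] `*` `[c, d].
have mB : measurable B by apply: measurableX; exact: measurable_itv.
pose H (p : R * R) : R := h p.1 p.2 * \1_D p * \1_B p.
have fB : ((lebesgue_measure \x lebesgue_measure)%E B < +oo)%E.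
  rewrite /B product_measure1E //; do 2?exact: measurable_itv.
  have fin (s t : R) : lebesgue_measure (`[s, t]%classic : set R) \is a fin_num.
    rewrite (@lebesgue_measure_itv R `[s, t]) /=; case: ifP => //.
  by rewrite ltey_eq fin_numM //; exact: fin.
have iH : (lebesgue_measure \x lebesgue_measure)%E.-integrable setT (EFin \o H).
  have -> : EFin \o H = (fun p => (h p.1 p.2 * \1_D p)%:E) \_ B.
    apply/funext => p; rewrite /H patchE /= indicE [X in _ * X]indicE.
    by case: ifPn; rewrite ?mulr1 ?mulr0.
  rewrite -integrable_mkcond //.
  apply: measurable_bounded_integrable => //.
    apply: measurable_funTS; apply: measurable_funM; last exact: measurable_indic.
    exact: continuous_measurable_plane.
  exists M; split; first exact: num_real.
  move=> M' MM' [x y] [/=]; rewrite !in_itv /= => xab ycd.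
  rewrite normrM; apply: le_trans (ltW MM'); apply: le_trans (hM x y xab ycd).
  by rewrite ler_piMr // indicE; case: (_ \in _); rewrite ?normr1 ?normr0.
have iD1 x : lebesgue_measure.-integrable `[c, d] (EFin \o (fun y => h x y * \1_D (x, y))).
  have [M' hM'] := continuous2_bounded x x c d ch.
  apply: measurable_bounded_integrable => //.
  - by apply: compact_finite_measure; exact: segment_compact.
  - apply: measurable_funTS; apply: measurable_funM.
      by apply: continuous_measurable_fun; exact: continuous2_r.
    by apply: measurableT_comp; [exact: measurable_indic|exact: pair1_measurable].
  - exists M'; split; first exact: num_real.
    move=> N MN y /=; rewrite in_itv /= => ycd; rewrite normrM.
    apply: le_trans (ltW MN); apply: le_trans (hM' x y _ ycd); last by rewrite lexx.
    by rewrite ler_piMr // indicE; case: (_ \in _); rewrite ?normr1 ?normr0.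
have iD2 y : lebesgue_measure.-integrable `[a, b] (EFin \o (fun x => h x y * \1_D (x, y))).
  have [M' hM'] := continuous2_bounded a b y y ch.
  apply: measurable_bounded_integrable => //.
  - by apply: compact_finite_measure; exact: segment_compact.
  - apply: measurable_funTS; apply: measurable_funM.
      by apply: continuous_measurable_fun; exact: continuous2_l.
    by apply: measurableT_comp; [exact: measurable_indic|exact: pair2_measurable].
  - exists M'; split; first exact: num_real.
    move=> N MN x /=; rewrite in_itv /= => xab; rewrite normrM.
    apply: le_trans (ltW MN); apply: le_trans (hM' x y xab _); last by rewrite lexx.
    by rewrite ler_piMr // indicE; case: (_ \in _); rewrite ?normr1 ?normr0.
rewrite (int1_iterated _ _ iD1) (int1_iterated (G := fun y x => h x y * \1_D (x, y)) _ _ iD2).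
apply: (congr1 fine); transitivity (\int[lebesgue_measure]_x \int[lebesgue_measure]_y (EFin \o H) (x, y))%E.
  apply: eq_integral => x _; apply: eq_integral => y _.
  by rewrite /H /B /= !indicE in_setX -mulnb natrM.
rewrite (Fubini iH).
apply: eq_integral => y _; apply: eq_integral => x _.
by rewrite /H /B /= !indicE in_setX -mulnb natrM; congr (_ %:E); ring.
Qed.

End Integrals.

Section Substitution.
Context {R : realType}.
Implicit Types (a b c d k r x y z : R) (f g F : R -> R) (h : R -> R -> R).

Lemma int1_point a f : int1 a a f = 0.
Proof. by rewrite /int1 set_itv1 Rintegral_set1. Qed.

Lemma int1_gt a b f : b < a -> int1 a b f = 0.
Proof. by move=> ba; rewrite /int1 set_itv_ge ?Rintegral_set0 // bnd_simp -ltNge. Qed.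

Lemma antiderivative f : continuous f ->
  exists F, forall x, is_derive x 1 F (f x).
Proof.
(* As reversed bounds give 0, at most one term is nonzero: this is the signed integral from 0 to
   [x]. *)
move=> cf; pose F x := int1 0 x f - int1 x 0 f.
exists F => x.
(* A base point below both 0 and [x]: near [x], [F] differs by a constant from an integral with
   fixed lower bound. *)
pose n := Num.min 0 x - 1; have [n0 nx] : n < 0 /\ n < x.
  by rewrite /n /Num.min; case: ifPn => h; split; lra.
have Fn y : n < y -> int1 n y f - int1 n 0 f = F y.
  move=> ny; rewrite /F; have [y0|y0] := leP 0 y.
    rewrite (@int1_split _ n y 0) // ?ltW //.
    have -> : int1 y 0 f = 0 by move: y0; rewrite le_eqVlt => /predU1P[<-|/int1_gt ->//]; exact: int1_point.
    ring.
  rewrite (@int1_split _ n 0 y) // ?ltW // (int1_gt f y0); ring.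
have [dF F'] := @continuous_FTC1_closed R f n x (x + 1) (ltr_pwDr ltr01 (lexx x))
   (int1_integrable n (x + 1) cf) nx (cf x).
have D : is_derive x 1 (fun y => int1 n y f) (f x).
  by split; [exact: dF|rewrite -derive1E; exact: F'].
have D' : is_derive x 1 (fun y => int1 n y f - int1 n 0 f) (f x).
  rewrite -[f x]subr0; exact: is_deriveB.
apply: near_eq_is_derive D'.
near=> y; apply: Fn; near: y; exact: lt_nbhsr.
Unshelve. all: by end_near. Qed.

(** Both sides are differences of one antiderivative of [f]; the order of [phi a] and [phi b] enters
    only because [int1] is not oriented. *)
Lemma int1_subst a b f (phi dphi : R -> R) : a <= b -> phi a <= phi b ->
  continuous f -> continuous dphi ->
  (forall x, is_derive x 1 phi (dphi x)) ->
  int1 a b (fun t => f (phi t) * dphi t) = int1 (phi a) (phi b) f.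
Proof.
move=> ab pab cf cdphi dphiP; have [F dF] := antiderivative cf.
have cphi : continuous phi.
  move=> x; apply: differentiable_continuous; apply/derivable1_diffP.
  by have [] := dphiP x.
rewrite (int1_FTC pab cf dF) (@int1_FTC _ _ _ _ (F \o phi)) //; by cts.
Qed.

Lemma int1_substN a b f (phi dphi : R -> R) : a <= b -> phi b <= phi a ->
  continuous f -> continuous dphi ->
  (forall x, is_derive x 1 phi (dphi x)) ->
  int1 a b (fun t => f (phi t) * dphi t) = - int1 (phi b) (phi a) f.
Proof.
move=> ab pab cf cdphi dphiP; have [F dF] := antiderivative cf.
have cphi : continuous phi.
  move=> x; apply: differentiable_continuous; apply/derivable1_diffP.
  by have [] := dphiP x.
rewrite (int1_FTC pab cf dF) (@int1_FTC _ _ _ _ (F \o phi)) ?opprB //; by cts.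
Qed.

Lemma continuous_int1_ubound h (g : R -> R) : continuous2 h -> continuous g ->
  (forall y, 0 <= g y) -> continuous (fun y => int1 0 (g y) (h ^~ y)).
Proof.
move=> ch cg g0.
(* The substitution [x = g y * s] moves the variable bound into the integrand. *)
have -> : (fun y => int1 0 (g y) (h ^~ y)) =
    (fun y => int1 0 1 (fun s => h (g y * s) y * g y)).
  apply/funext => y.
  have dg (s : R) : is_derive s 1 (fun s => g y * s) (g y).
    by apply: is_derive_eq; rewrite -[LHS]/(g y * 1) mulr1.
  have := int1_subst (f := h ^~ y) ler01 _ _ _ dg.
  rewrite mulr0 mulr1 => -> //; last exact: ct_cst.
  exact: continuous2_l.
have ch' : continuous2 (fun s y => h (g y * s) y * g y) by cts.
exact: continuous_int1 ch'.
Qed.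

End Substitution.

Section HalfDisc.
Context {R : realType}.
Implicit Types (r x y z : R).

Definition half_disc_integral (h : R -> R -> R) r : R :=
  int1 (- r) r (fun z => int1 0 (Num.sqrt (r ^+ 2 - z ^+ 2)) (h ^~ z)).

Lemma half_disc_swap (b : R -> R -> R) r : continuous2 b -> 0 <= r ->
  int1 0 r (fun x => int1 (- Num.sqrt (r ^+ 2 - x ^+ 2)) (Num.sqrt (r ^+ 2 - x ^+ 2)) (b x)) =
  half_disc_integral b r.
Proof.
move=> cb r0.
pose D : set (R * R) := [set p | p.1 ^+ 2 + p.2 ^+ 2 <= r ^+ 2].
have mD : measurable D.
  rewrite -[D]setTI.
  have -> : D = (fun p : R * R => p.1 ^+ 2 + p.2 ^+ 2) @^-1` `]-oo, r ^+ 2].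
    by apply/seteqP; split => p /=; rewrite in_itv.
  apply: continuous_measurable_plane => //; cts.
have := int1_swap_indic 0 r (- r) r cb mD.
rewrite (@eq_int1 _ _ _ _ (fun x => int1 (- Num.sqrt (r ^+ 2 - x ^+ 2)) (Num.sqrt (r ^+ 2 - x ^+ 2)) (b x))).
  move=> ->; apply: eq_int1 => z zr.
  have s0 := sqrtr_ge0 (r ^+ 2 - z ^+ 2).
  have sr : Num.sqrt (r ^+ 2 - z ^+ 2) <= r by rewrite -[leRHS](ger0_norm r0) -sqrtr_sqr ler_wsqrtr //; nra.
  rewrite -(@int1_indic _ 0 r 0 _ _ (lexx 0) sr).
  apply: eq_int1 => x xr; congr (_ * _); rewrite !indicE; congr (_ %:R); congr nat_of_bool.
  apply/idP/idP; rewrite !inE /= in_itv /D /= => h.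
    apply/andP; split; first by lra.
    have h0 : 0 <= r ^+ 2 - z ^+ 2 by nra.
    by have := sqr_sqrtr h0; nra.
  have h0 : 0 <= r ^+ 2 - z ^+ 2 by nra.
  by have := sqr_sqrtr h0; nra.
move=> x xr.
have s0 := sqrtr_ge0 (r ^+ 2 - x ^+ 2).
have sr : Num.sqrt (r ^+ 2 - x ^+ 2) <= r by rewrite -[leRHS](ger0_norm r0) -sqrtr_sqr ler_wsqrtr //; nra.
rewrite -(@int1_indic _ (- r) r _ _ _ _ sr) ?lerN2 //.
apply: eq_int1 => z zr; congr (_ * _); rewrite !indicE; congr (_ %:R); congr nat_of_bool.
have h0 : 0 <= r ^+ 2 - x ^+ 2 by nra.
have e := sqr_sqrtr h0.
apply/idP/idP; rewrite !inE /= in_itv /D /= => h; last by nra.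
by apply/andP; split; nra.
Qed.
(** Gauss's theorem, with [t] the angle from the z axis. The straight side lies on the axis, where
    [F] vanishes, and contributes nothing. The [F] part is integrated in [x] first, the [G] part in
    [z] first, whence [half_disc_swap]. *)
Lemma half_disc_divergence (F G a b : R -> R -> R) r :
  continuous2 F -> continuous2 G -> continuous2 a -> continuous2 b ->
  (forall x z, is_derive x 1 (F ^~ z) (a x z)) ->
  (forall x z, is_derive z 1 (G x) (b x z)) ->
  (forall z, F 0 z = 0) -> 0 <= r ->
  int1 0 pi (fun t => (F (r * sin t) (r * cos t) * sin t
                       + G (r * sin t) (r * cos t) * cos t) * r) =
  half_disc_integral (fun x z => a x z + b x z) r.
Proof.
move=> cF cG ca cb dF dG F0 r0.
have dcos (t : R) : is_derive t 1 (fun t : R => r * cos t) (- (r * sin t)).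
  by apply: is_derive_eq; rewrite -[LHS]/(r * - sin t) mulrN.
have dsin (t : R) : is_derive t 1 (fun t : R => r * sin t) (r * cos t).
  exact: is_derive_eq.
have pi0 : 0 < pi :> R := pi_gt0 R.
pose s x : R := Num.sqrt (r ^+ 2 - x ^+ 2).
have cs : continuous s by rewrite /s; cts.
have s0 x : 0 <= s x := sqrtr_ge0 _.
have sinE t : 0 <= sin t -> r * sin t = s (r * cos t).
  move=> st; rewrite /s -[LHS]ger0_norm ?mulr_ge0 // -sqrtr_sqr; congr Num.sqrt.
  by have := cos2Dsin2 t; rewrite !exprMn; nra.
have cosE t : 0 <= cos t -> r * cos t = s (r * sin t).
  move=> st; rewrite /s -[LHS]ger0_norm ?mulr_ge0 // -sqrtr_sqr; congr Num.sqrt.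
  by have := cos2Dsin2 t; rewrite !exprMn; nra.
have cosNE t : cos t <= 0 -> r * cos t = - s (r * sin t).
  move=> st; rewrite /s; apply/eqP; rewrite -eqr_oppLR -mulrN; apply/eqP.
  rewrite -[LHS]ger0_norm ?mulr_ge0 ?oppr_ge0 // -sqrtr_sqr; congr Num.sqrt.
  by have := cos2Dsin2 t; rewrite !exprMn sqrrN; nra.
have cF1 : continuous (fun t => F (r * sin t) (r * cos t) * (r * sin t)) by cts.
have cG1 : continuous (fun t => G (r * sin t) (r * cos t) * (r * cos t)) by cts.
transitivity (int1 0 pi (fun t => F (r * sin t) (r * cos t) * (r * sin t)) +
              int1 0 pi (fun t => G (r * sin t) (r * cos t) * (r * cos t))).
  rewrite -int1D //; apply: eq_int1 => t _; ring.
have -> : int1 0 pi (fun t => F (r * sin t) (r * cos t) * (r * sin t)) =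
    half_disc_integral a r.
  transitivity (- int1 0 pi (fun t => F (s (r * cos t)) (r * cos t) * - (r * sin t))).
    rewrite -[RHS]mulN1r -int1Zl; last by cts.
    apply: eq_int1 => t t0; rewrite -sinE; last exact: sin_ge0_pi.
    ring.
  have cFs : continuous (fun z => F (s z) z) by cts.
  rewrite (@int1_substN _ 0 pi (fun z => F (s z) z) (fun t => r * cos t) (fun t => - (r * sin t))) //.
  - rewrite cos0 cospi mulr1 mulrN1 opprK; apply: eq_int1 => z _.
    rewrite (int1_FTC (s0 z) _ (fun x => dF x z)) ?F0 ?subr0 //; exact: continuous2_l.
  - exact: ltW.
  - by rewrite cos0 cospi; lra.
  - cts.
have -> : int1 0 pi (fun t => G (r * sin t) (r * cos t) * (r * cos t)) =
    half_disc_integral b r.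
  (* [r * sin t] rises up to [pi / 2] and falls afterwards: the two halves parametrise the upper arc
     [z = s x] and the lower arc [z = - s x]. *)
  rewrite -half_disc_swap // (@int1_split _ _ _ (pi / 2)) //; [|by lra|by lra].
  transitivity (int1 0 (pi / 2) (fun t => G (r * sin t) (s (r * sin t)) * (r * cos t)) +
    int1 (pi / 2) pi (fun t => G (r * sin t) (- s (r * sin t)) * (r * cos t))).
    congr (_ + _); apply: eq_int1 => t t0.
      by rewrite -cosE // cos_ge0_pihalf //; lra.
    rewrite -cosNE //; have := sinBpihalf t.
    have : 0 <= sin (t - pi / 2) by apply: sin_ge0_pi; lra.
    by move=> h1 h2; move: h1; rewrite h2; lra.
  have cGs : continuous (fun z => G z (s z)) by cts.
  have cGs' : continuous (fun z => G z (- s z)) by cts.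
  rewrite (@int1_subst _ 0 (pi/2) (fun z => G z (s z)) (fun t => r * sin t) (fun t => (r * cos t))) //.
  rewrite (@int1_substN _ (pi/2) pi (fun z => G z (- s z)) (fun t => r * sin t) (fun t => (r * cos t))) //.
  - rewrite sin0 sin_pihalf sinpi mulr1 mulr0 -int1B //; apply: eq_int1 => x _.
    rewrite (int1_FTC _ _ (dG x)) //; first by rewrite -/(s x); have := s0 x; lra.
    exact: continuous2_r.
  - lra.
  - by rewrite sinpi sin_pihalf; lra.
  - cts.
  - lra.
  - by rewrite sin0 sin_pihalf; lra.
  - cts.
rewrite /half_disc_integral -int1D; try by apply: continuous_int1_ubound => //; cts.
apply: eq_int1 => z _; rewrite int1D //; exact: continuous2_l.
Qed.

Lemma half_disc_integral_mono h r r' : continuous2 h ->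
  (forall x z, 0 <= x -> 0 <= h x z) -> 0 <= r -> r <= r' ->
  half_disc_integral h r <= half_disc_integral h r'.
Proof.
move=> ch h0 r0 rr.
have cont t : continuous (fun z => int1 0 (Num.sqrt (t ^+ 2 - z ^+ 2)) (h ^~ z)).
  by apply: continuous_int1_ubound => //; cts.
apply: (@le_trans _ _ (int1 (- r) r
   (fun z => int1 0 (Num.sqrt (r' ^+ 2 - z ^+ 2)) (h ^~ z)))).
  apply: le_int1 => // z _; apply: int1_subset => //.
  - exact: continuous2_l.
  - by rewrite ler_wsqrtr //; nra.
  - by move=> x /andP[x0 _]; exact: h0.
apply: int1_subset => //; first by lra.
by move=> z _; apply: int1_ge0 => x /andP[x0 _]; exact: h0.
Qed.

Lemma box_le_half_disc h r x0 L : continuous2 h ->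
  (forall x z, 0 <= x -> 0 <= h x z) -> 0 <= r -> 0 <= x0 -> 0 <= L ->
  L ^+ 2 + L ^+ 2 <= r ^+ 2 ->
  int1 (- L) L (fun z => int1 x0 L (h ^~ z)) <= half_disc_integral h r.
Proof.
move=> ch h0 r0 x0_ge0 L0 Lr.
have cont : continuous (fun z => int1 0 (Num.sqrt (r ^+ 2 - z ^+ 2)) (h ^~ z)).
  by apply: continuous_int1_ubound => //; cts.
apply: (@le_trans _ _ (int1 (- L) L
   (fun z => int1 0 (Num.sqrt (r ^+ 2 - z ^+ 2)) (h ^~ z)))).
  apply: le_int1 => //; first exact: continuous_int1.
  move=> z zL; apply: int1_subset => //.
  - exact: continuous2_l.
  - by rewrite -[leLHS](ger0_norm L0) -sqrtr_sqr ler_wsqrtr //; nra.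
  - by move=> x /andP[x0' _]; exact: h0.
have Lr' : L <= r by nra.
apply: int1_subset => //; first by lra.
by move=> z _; apply: int1_ge0 => x /andP[x0' _]; exact: h0.
Qed.

End HalfDisc.

Definition int2 {R : realType} (a b c d : R) (h : R -> R -> R) : R :=
  int1 c d (fun y => int1 a b (h ^~ y)).

Section DoubleIntegral.
Context {R : realType}.
Implicit Types (a b c d k x y : R) (h g : R -> R -> R).

Lemma le_int2 a b c d h g : continuous2 h -> continuous2 g ->
  (forall x y, a <= x <= b -> c <= y <= d -> h x y <= g x y) ->
  int2 a b c d h <= int2 a b c d g.
Proof.
move=> ch cg hg; apply: le_int1; try exact: continuous_int1.
by move=> y ycd; apply: le_int1; try exact: continuous2_l; move=> x xab; exact: hg.
Qed.

Lemma int2D a b c d h g : continuous2 h -> continuous2 g ->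
  int2 a b c d (fun x y => h x y + g x y) = int2 a b c d h + int2 a b c d g.
Proof.
move=> ch cg; rewrite /int2 -int1D; try exact: continuous_int1.
by apply: eq_int1 => y _; apply: int1D; exact: continuous2_l.
Qed.

Lemma int2Zl a b c d k h : continuous2 h ->
  int2 a b c d (fun x y => k * h x y) = k * int2 a b c d h.
Proof.
move=> ch; rewrite /int2 -int1Zl; try exact: continuous_int1.
by apply: eq_int1 => y _; apply: int1Zl; exact: continuous2_l.
Qed.

Lemma int2B a b c d h g : continuous2 h -> continuous2 g ->
  int2 a b c d (fun x y => h x y - g x y) = int2 a b c d h - int2 a b c d g.
Proof.
move=> ch cg; rewrite /int2 -int1B; try exact: continuous_int1.
by apply: eq_int1 => y _; apply: int1B; exact: continuous2_l.
Qed.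

Lemma int2_cst a b c d k : a <= b -> c <= d ->
  int2 a b c d (fun _ _ => k) = k * (b - a) * (d - c).
Proof. by move=> ab cd; rewrite /int2 !int1_cst. Qed.

Lemma eq_int2 a b c d h g :
  (forall x y, a <= x <= b -> c <= y <= d -> h x y = g x y) ->
  int2 a b c d h = int2 a b c d g.
Proof. by move=> hg; apply: eq_int1 => y yc; apply: eq_int1 => x xa; exact: hg. Qed.

Lemma int2_subset a b c d a' b' c' d' h : continuous2 h ->
  a <= a' -> b' <= b -> c <= c' -> d' <= d ->
  (forall x y, a <= x <= b -> c <= y <= d -> 0 <= h x y) ->
  int2 a' b' c' d' h <= int2 a b c d h.
Proof.
move=> ch aa bb cc dd h0.
apply: (@le_trans _ _ (int1 c' d' (fun y => int1 a b (h ^~ y)))).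
  apply: le_int1; try exact: continuous_int1.
  move=> y /andP[y1 y2]; apply: int1_subset => //; first exact: continuous2_l.
  by move=> x xab; apply: h0 => //; lra.
apply: int1_subset => //; first exact: continuous_int1.
by move=> y ycd; apply: int1_ge0 => x xab; exact: h0.
Qed.

Lemma int2_swap a b c d h : continuous2 h ->
  int2 a b c d h = int1 a b (fun x => int1 c d (h x)).
Proof.
move=> ch; have := int1_swap_indic a b c d ch measurableT.
have E x y : h x y * \1_[set: R * R] (x, y) = h x y by rewrite indicT mulr1.
have -> : (fun x => int1 c d (fun y => h x y * \1_[set: R * R] (x, y))) =
          (fun x => int1 c d (h x)).
  by apply/funext => x; apply: eq_int1 => y _; exact: E.
by move=> ->; apply: eq_int1 => y _; apply: eq_int1 => x _; rewrite E.
Qed.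

Lemma continuous_int1_r a b h : continuous2 h ->
  continuous (fun x => int1 a b (h x)).
Proof.
move=> ch; have ch' : continuous2 (fun y x => h x y) by cts.
exact: continuous_int1 ch'.
Qed.

End DoubleIntegral.

(** * Traces of functions with small layer energies *)

Section SmoothStep.
Context {R : realType}.
Implicit Types (s t : R).

Definition clamp s : R := (1 + `|s| - `|s - 1|) / 2.

(** The factor 6 gives total integral 1, so [smoothstep] is [3 s^2 - 2 s^3] on [[0, 1]] and constant
    outside: a C^1 step, regular enough for the divergence theorem. *)
Definition dsmoothstep s : R := 6 * (clamp s * (1 - clamp s)).

Definition smoothstep s : R := int1 0 s dsmoothstep.

Lemma clamp_itv s : 0 <= clamp s <= 1.
Proof.
by rewrite /clamp; case: (ger0P s) => ?; case: (ger0P (s - 1)) => ?;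
  apply/andP; split; lra.
Qed.

Lemma clamp_id s : 0 <= s <= 1 -> clamp s = s.
Proof.
by rewrite /clamp; case: (ger0P s) => ?; case: (ger0P (s - 1)) => ? ?; lra.
Qed.

Lemma clamp_le0 s : s <= 0 -> clamp s = 0.
Proof.
by rewrite /clamp; case: (ger0P s) => ?; case: (ger0P (s - 1)) => ? ?; lra.
Qed.

Lemma clamp_ge1 s : 1 <= s -> clamp s = 1.
Proof.
by rewrite /clamp; case: (ger0P s) => ?; case: (ger0P (s - 1)) => ? ?; lra.
Qed.

Lemma continuous_dsmoothstep : continuous dsmoothstep.
Proof. rewrite /dsmoothstep /clamp; cts. Qed.

Lemma dsmoothstep_itv s : 0 <= dsmoothstep s <= 2.
Proof.
rewrite /dsmoothstep; have := clamp_itv s; set c := clamp s => c01.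
by apply/andP; split; have := sqr_ge0 (c - 2^-1); nra.
Qed.

Lemma dsmoothstep_le0 s : s <= 0 -> dsmoothstep s = 0.
Proof. by move=> /clamp_le0; rewrite /dsmoothstep => ->; ring. Qed.

Lemma dsmoothstep_ge1 s : 1 <= s -> dsmoothstep s = 0.
Proof. by move=> /clamp_ge1; rewrite /dsmoothstep => ->; ring. Qed.

Lemma smoothstep_le0 s : s <= 0 -> smoothstep s = 0.
Proof.
by rewrite le_eqVlt => /predU1P[->|]; [exact: int1_point|exact: int1_gt].
Qed.

Lemma is_derive_smoothstep s : is_derive s 1 smoothstep (dsmoothstep s).
Proof.
have [F dF] := antiderivative continuous_dsmoothstep.
suff -> : smoothstep = (fun s => F s - F 0).
  by rewrite -[dsmoothstep s]subr0; exact: is_deriveB.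
apply/funext => t; have [t0|/ltW t0] := leP 0 t.
  by rewrite /smoothstep (int1_FTC t0 continuous_dsmoothstep dF).
rewrite smoothstep_le0 //; apply/eqP; rewrite eq_sym -oppr_eq0 opprB; apply/eqP.
rewrite -(int1_FTC t0 continuous_dsmoothstep dF) (@eq_int1 _ _ _ _ (fun=> 0)) ?int1_cst ?mul0r //.
by move=> x /andP[_ x0]; exact: dsmoothstep_le0.
Qed.

Lemma continuous_smoothstep : continuous smoothstep.
Proof.
move=> s; apply: differentiable_continuous; apply/derivable1_diffP.
by have [] := is_derive_smoothstep s.
Qed.

Lemma smoothstep_ge1 s : 1 <= s -> smoothstep s = 1.
Proof.
move=> s1; rewrite /smoothstep (int1_split continuous_dsmoothstep ler01 s1).
rewrite (@eq_int1 _ 1 s _ (fun=> 0)); last by move=> x /andP[x1 _]; exact: dsmoothstep_ge1.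
rewrite int1_cst // mul0r addr0.
rewrite (@eq_int1 _ _ _ _ (fun x => 6 * (x * (1 - x)))); last first.
  by move=> x x01; rewrite /dsmoothstep clamp_id.
have d (x : R) : is_derive x 1 (fun x => 3 * x ^+ 2 - 2 * x ^+ 3) (6 * (x * (1 - x))).
  by apply: is_derive_eq; rewrite /GRing.scale /=; ring.
rewrite (int1_FTC ler01 _ d); first by ring.
cts.
Qed.

Lemma smoothstep_itv s : 0 <= smoothstep s <= 1.
Proof.
have [s0|/ltW s0] := leP 0 s; last by rewrite smoothstep_le0 // lexx ler01.
apply/andP; split; first by apply: int1_ge0 => x _; have /andP[] := dsmoothstep_itv x.
have [s1|s1] := leP s 1; last by rewrite smoothstep_ge1 // ltW.
rewrite -(smoothstep_ge1 (lexx 1)); apply: int1_subset => //.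
  exact: continuous_dsmoothstep.
by move=> x _; have /andP[] := dsmoothstep_itv x.
Qed.

(** Rises from 0 at height [j e] to 1 at height [(j + 1) e]. *)
Definition layer (e : R) (j : nat) s : R := smoothstep (s / e - j%:R).
Definition dlayer (e : R) (j : nat) s : R := dsmoothstep (s / e - j%:R) / e.

Lemma continuous_layer e j : continuous (layer e j).
Proof. have := continuous_smoothstep => cS; rewrite /layer; cts. Qed.

Lemma continuous_dlayer e j : continuous (dlayer e j).
Proof. have := continuous_dsmoothstep => cS; rewrite /dlayer; cts. Qed.

Lemma is_derive_layer e j s : is_derive s 1 (layer e j) (dlayer e j s).
Proof.
have d : is_derive s 1 (fun s => s / e - j%:R) e^-1.
  by apply: is_derive_eq; rewrite /GRing.scale /=; ring.
have := is_derive_smoothstep (s / e - j%:R).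
by move=> d'; apply: is_derive1_comp.
Qed.

Lemma layer_itv e j s : 0 <= layer e j s <= 1.
Proof. exact: smoothstep_itv. Qed.

Lemma dlayer_ge0 e j s : 0 < e -> 0 <= dlayer e j s.
Proof.
move=> e0; rewrite divr_ge0 ?(ltW e0) //.
by have /andP[] := dsmoothstep_itv (s / e - j%:R).
Qed.

Lemma layer_eq0 e j s : 0 < e -> s <= j%:R * e -> layer e j s = 0.
Proof. by move=> e0 sj; apply: smoothstep_le0; rewrite subr_le0 ler_pdivrMr. Qed.

Lemma layer_eq1 e j s : 0 < e -> j.+1%:R * e <= s -> layer e j s = 1.
Proof.
by move=> e0 sj; apply: smoothstep_ge1; rewrite lerBrDr nat1r ler_pdivlMr.
Qed.

(** Layer [j.+1] starts to rise where layer [j] has reached 1, so any power of layer [j] could stand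
    here; the square matches [layer_mass]. *)
Lemma dlayer_le e j s : 0 < e -> dlayer e j.+1 s <= 2 / e * layer e j s ^+ 2.
Proof.
move=> e0; have [sj|/ltW sj] := leP s (j.+1%:R * e).
  rewrite /dlayer dsmoothstep_le0 ?mul0r; last by rewrite subr_le0 ler_pdivrMr.
  by rewrite mulr_ge0 ?sqr_ge0 // divr_ge0 // ltW.
rewrite layer_eq1 // expr1n mulr1 ler_pM2r ?invr_gt0 //.
by have /andP[] := dsmoothstep_itv (s / e - j.+1%:R).
Qed.

Lemma dlayer_le_cst e j s : 0 < e -> dlayer e j s <= 2 / e.
Proof.
move=> e0; rewrite /dlayer ler_pM2r ?invr_gt0 //.
by have /andP[] := dsmoothstep_itv (s / e - j%:R).
Qed.

End SmoothStep.

Section Layers.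
Context {R : realType}.
Context (f fx fz : R -> R -> R) (a L e : R).
Context (cf : continuous2 f) (cfx : continuous2 fx) (cfz : continuous2 fz).
Context (dfx : forall x z : R, is_derive x 1 (f ^~ z) (fx x z)).
Context (dfz : forall x z : R, is_derive z 1 (f x) (fz x z)).
Context (aL : a <= L) (L0 : 0 <= L) (e0 : 0 < e).
Context (f_right : forall z : R, - L <= z <= L -> f L z <= e).
Context (f_top : forall x, a <= x <= L -> f x L <= e).

Definition layer_slope_x (j : nat) (x z : R) := dlayer e j (f x z) * `|fx x z|.
Definition layer_slope_z (j : nat) (x z : R) := dlayer e j (f x z) * `|fz x z|.
(** The weight [dlayer] has exponent 1, as it arises when an equation is tested against the layer;
    this is not the Dirichlet energy of the layer. *)
Definition layer_energy (j : nat) :=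
  int2 a L (- L) L (fun x z : R => dlayer e j (f x z) * (fx x z ^+ 2 + fz x z ^+ 2)).

Let cl j : continuous (layer e j) := @continuous_layer R e j.
Let cdl j : continuous (dlayer e j) := @continuous_dlayer R e j.

Lemma continuous2_slope_x j : continuous2 (layer_slope_x j).
Proof. have := @cdl j; rewrite /layer_slope_x => c; cts. Qed.

Lemma continuous2_slope_z j : continuous2 (layer_slope_z j).
Proof. have := @cdl j; rewrite /layer_slope_z => c; cts. Qed.

(** Integrate from the right side, where [f <= e] makes all layers from 1 on vanish; layer 0 may be
    nonzero there. *)
Lemma layer_le_slope_x j (x z : R) : a <= x <= L -> - L <= z <= L ->
  layer e j.+1 (f x z) <= int1 a L ((layer_slope_x j.+1) ^~ z).
Proof.
move=> /andP[ax xL] zL.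
have c := @continuous2_l _ _ z (@continuous2_slope_x j.+1).
have cc := @continuous2_l _ _ z cf; have ccx := @continuous2_l _ _ z cfx.
have cdj := @cdl j.+1.
have cd : continuous (fun x => dlayer e j.+1 (f x z) * fx x z) by cts.
have d (x' : R) : is_derive x' 1 (fun x => layer e j.+1 (f x z)) (dlayer e j.+1 (f x' z) * fx x' z).
  have := is_derive_layer e j.+1 (f x' z) => d1; have := dfx x' z => d2.
  exact: is_derive1_comp.
have := int1_FTC xL cd d; rewrite [X in X - _]layer_eq0 //; last first.
  by rewrite (le_trans (f_right zL)) // ler_peMl ?(ltW e0) // ler1n.
rewrite sub0r => h; rewrite -[leLHS]opprK -h -[leLHS]mulN1r -int1Zl //.
apply: (@le_trans _ _ (int1 x L ((layer_slope_x j.+1) ^~ z))).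
  apply: le_int1 => //; first by cts.
  move=> t _; rewrite /layer_slope_x mulrCA ler_wpM2l ?dlayer_ge0 //.
  by rewrite mulN1r -normrN ler_norm.
apply: int1_subset => // t _; by rewrite mulr_ge0 // dlayer_ge0.
Qed.

Lemma layer_le_slope_z j (x z : R) : a <= x <= L -> - L <= z <= L ->
  layer e j.+1 (f x z) <= int1 (- L) L (layer_slope_z j.+1 x).
Proof.
move=> xL /andP[az zL].
have c := @continuous2_r _ _ x (@continuous2_slope_z j.+1).
have cc := @continuous2_r _ _ x cf; have ccx := @continuous2_r _ _ x cfz.
have cdj := @cdl j.+1.
have cd : continuous (fun z => dlayer e j.+1 (f x z) * fz x z) by cts.
have d (z' : R) : is_derive z' 1 (fun z => layer e j.+1 (f x z)) (dlayer e j.+1 (f x z') * fz x z').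
  have := is_derive_layer e j.+1 (f x z') => d1; have := dfz x z' => d2.
  exact: is_derive1_comp.
have := int1_FTC zL cd d; rewrite [X in X - _]layer_eq0 //; last first.
  by rewrite (le_trans (f_top xL)) // ler_peMl ?(ltW e0) // ler1n.
rewrite sub0r => h; rewrite -[leLHS]opprK -h -[leLHS]mulN1r -int1Zl //.
apply: (@le_trans _ _ (int1 z L (layer_slope_z j.+1 x))).
  apply: le_int1 => //; first by cts.
  move=> t _; rewrite /layer_slope_z mulrCA ler_wpM2l ?dlayer_ge0 //.
  by rewrite mulN1r -normrN ler_norm.
apply: int1_subset => // t _; by rewrite mulr_ge0 // dlayer_ge0.
Qed.

Context (q kappa B : R).
Context (q0 : 0 < q) (B0 : 0 < B).
Context (area : (L - a) * (L - - L) <= B ^+ 2).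
Context (kappa_le : kappa <= e / 2 * q ^+ 2).
Context (energy : forall j, layer_energy j.+1 <= kappa).

(** Lies between the areas of the sets where [f] is at least [(j + 1) e] and where [f] exceeds
    [j e]. *)
Definition layer_mass (j : nat) := int2 a L (- L) L (fun x z => layer e j (f x z) ^+ 2).

(* AM-GM with weight [t], tuned so that the mass term and the energy term
   decay at the same rate. *)
Lemma layer_slope_bound j (g : R -> R -> R) : continuous2 g ->
  (forall x z, g x z ^+ 2 <= fx x z ^+ 2 + fz x z ^+ 2) ->
  layer_mass j <= B ^+ 2 * (q ^+ j) ^+ 2 ->
  int2 a L (- L) L (fun x z : R => dlayer e j.+1 (f x z) * `|g x z|) <= B * q ^+ j.+1.
Proof.
move=> cg gle mj.
have cd := @cdl j.+1; have cS := @cl j.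
pose t := e / (2 * B) * q / q ^+ j.
have qj0 : 0 < q ^+ j by rewrite exprn_gt0.
have t0 : 0 < t by rewrite /t !(mulr_gt0, divr_gt0, invr_gt0).
have e_neq0 : e != 0 by rewrite gt_eqF.
have B_neq0 : B != 0 by rewrite gt_eqF.
have q_neq0 : q != 0 by rewrite gt_eqF.
have qj_neq0 : q ^+ j != 0 by rewrite gt_eqF.
apply: (@le_trans _ _ (t / e * layer_mass j + (2 * t)^-1 * layer_energy j.+1)).
  rewrite /layer_mass /layer_energy -!int2Zl; try by cts.
  rewrite -int2D; try by cts.
  apply: le_int2; try by cts.
  move=> x z _ _; set d := dlayer e j.+1 (f x z); set s := layer e j (f x z).
  have d0 : 0 <= d by exact: dlayer_ge0.
  have ds : d <= 2 / e * s ^+ 2 by exact: dlayer_le.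
  (* In the first of the resulting terms [d] is traded for the previous layer by [ds]; in the second
     it stays as the weight of the energy. *)
  have amgm : `|g x z| <= t / 2 + (2 * t)^-1 * g x z ^+ 2.
    rewrite -(real_normK (num_real (g x z))); set G := `|g x z|.
    have -> : t / 2 + (2 * t)^-1 * G ^+ 2 = G + (G - t) ^+ 2 / (2 * t).
      by field; rewrite gt_eqF.
    by rewrite lerDl divr_ge0 ?sqr_ge0 // mulr_ge0 // ltW.
  apply: (@le_trans _ _ (d * (t / 2 + (2 * t)^-1 * (fx x z ^+ 2 + fz x z ^+ 2)))).
    rewrite ler_wpM2l //; apply: le_trans amgm _; rewrite lerD2l ler_wpM2l ?gle //.
    by rewrite invr_ge0 mulr_ge0 // ltW.
  rewrite mulrDr [d * ((2 * t)^-1 * _)]mulrCA lerD2r.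
  have -> : t / e * s ^+ 2 = 2 / e * s ^+ 2 * (t / 2) by field.
  by rewrite ler_wpM2r // divr_ge0 // ltW.
have h1 : t / e * layer_mass j <= B * q ^+ j.+1 / 2.
  apply: (@le_trans _ _ (t / e * (B ^+ 2 * (q ^+ j) ^+ 2))).
    by rewrite ler_wpM2l // divr_ge0 // ltW.
  rewrite (exprS q j) /t; set Q := q ^+ j in qj_neq0 *.
  rewrite le_eqVlt; apply/orP; left; apply/eqP.
  by field; rewrite e_neq0 B_neq0 qj_neq0.
have h2 : (2 * t)^-1 * layer_energy j.+1 <= B * q ^+ j.+1 / 2.
  apply: (@le_trans _ _ ((2 * t)^-1 * (e / 2 * q ^+ 2))).
    apply: ler_wpM2l; last exact: le_trans (energy j) kappa_le.
    by rewrite invr_ge0 ltW // mulr_gt0.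
  rewrite (exprS q j) /t; set Q := q ^+ j in qj_neq0 *.
  rewrite le_eqVlt; apply/orP; left; apply/eqP.
  by field; rewrite e_neq0 B_neq0 qj_neq0 q_neq0.
by apply: le_trans (lerD h1 h2) _; rewrite -splitr.
Qed.

(** Isoperimetry by slicing: the layer is at most its variation [N z] along the horizontal slice and
    at most its variation [K x] along the vertical one. Its square is at most [N z * K x], whose
    integral is a product of two total slopes, each at most [B * q ^+ j.+1]. *)
Lemma layer_mass_le j : layer_mass j <= B ^+ 2 * (q ^+ j) ^+ 2.
Proof.
elim: j => [|j IH].
  rewrite expr0 expr1n mulr1; apply: le_trans area.
  have c0 := @cl 0; have -> : (L - a) * (L - - L) = int2 a L (- L) L (fun _ _ => 1).
    by rewrite int2_cst ?mul1r //; apply: le_trans L0; rewrite oppr_le0.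
  apply: le_int2; [by cts|by cts|move=> x z _ _].
  by have := layer_itv e 0 (f x z); nra.
have hx := layer_slope_bound cfx (fun x z => _) IH.
have {}hx := hx ltac:(by move=> x z; rewrite lerDl sqr_ge0).
have hz := layer_slope_bound cfz (fun x z => _) IH.
have {}hz := hz ltac:(by move=> x z; rewrite lerDr sqr_ge0).
have csx := @continuous2_slope_x j.+1; have csz := @continuous2_slope_z j.+1.
pose N z := int1 a L ((layer_slope_x j.+1) ^~ z).
pose K x := int1 (- L) L (layer_slope_z j.+1 x).
have cN : continuous N by exact: continuous_int1.
have cK : continuous K by exact: continuous_int1_r.
have cS := @cl j.+1.
have N0 z : 0 <= N z by apply: int1_ge0 => t _; rewrite mulr_ge0 // dlayer_ge0.
apply: (@le_trans _ _ (int2 a L (- L) L (fun x z => N z * K x))).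
  apply: le_int2; [by cts|by cts|move=> x z xL zL].
  rewrite expr2; have /andP[s0 _] := layer_itv e j.+1 (f x z).
  by apply: ler_pM => //; [exact: layer_le_slope_x|exact: layer_le_slope_z].
have -> : int2 a L (- L) L (fun x z => N z * K x) = int1 (- L) L N * int1 a L K.
  rewrite mulrC /int2 -int1Zl //; apply: eq_int1 => z _.
  by rewrite int1Zl // mulrC.
rewrite -exprMn [leRHS]expr2.
have iK0 : 0 <= int1 a L K.
  by apply: int1_ge0 => x _; apply: int1_ge0 => t _; rewrite mulr_ge0 // dlayer_ge0.
have iN0 : 0 <= int1 (- L) L N by apply: int1_ge0.
have hz' : int1 a L K <= B * q ^+ j.+1 by move: hz; rewrite (int2_swap _ _ _ _ csz).
exact: (ler_pM iN0 iK0 hx hz').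
Qed.

(** One full layer pays alone: if [s] lies between [(j + 2) e] and [(j + 3) e], layer [j.+1] equals
    1 and its weight is at least [e^(2 s)]. Up to [2 e] the excess is 0, so the sum can start with
    layer 1. *)
Lemma exp_excess_le (s : R) J : s <= J.+2%:R * e ->
  Num.max 0 (expR (2 * s) - expR (4 * e)) <=
  \sum_(j < J) expR (2 * e * j.+3%:R) * layer e j.+1 s.
Proof.
have nneg K : 0 <= \sum_(j < K) expR (2 * e * j.+3%:R) * layer e j.+1 s.
  apply: sumr_ge0 => j _; rewrite mulr_ge0 ?expR_ge0 //.
  by have /andP[] := layer_itv e j.+1 s.
elim: J => [|J IH] sJ.
  rewrite big_ord0 ge_max lexx subr_le0 ler_expR; lra.
rewrite big_ord_recr /=; have [sJ'|/ltW sJ'] := leP s (J.+2%:R * e).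
  apply: le_trans (IH sJ') _; rewrite lerDl mulr_ge0 ?expR_ge0 //.
  by have /andP[] := layer_itv e J.+1 s.
rewrite (layer_eq1 e0 sJ') mulr1; apply: (@le_trans _ _ (expR (2 * e * J.+3%:R))).
  rewrite ge_max expR_ge0 lerBlDr (@le_trans _ _ (expR (2 * e * J.+3%:R))) //.
    by rewrite ler_expR -mulrA ler_pM2l // mulrC.
  by rewrite lerDl expR_ge0.
by rewrite lerDr; exact: nneg.
Qed.

Lemma geometric_sum_le (t : R) J : 0 <= t <= 2^-1 ->
  \sum_(j < J) t ^+ j.+1 <= 2 * t.
Proof.
(* With the remainder added the induction closes, because [2 t <= 1]. *)
move=> t01; suff : \sum_(j < J) t ^+ j.+1 + 2 * t ^+ J.+1 <= 2 * t.
  have : 0 <= t ^+ J.+1 by apply: exprn_ge0; lra.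
  lra.
elim: J => [|J IH]; first by rewrite big_ord0 expr1 add0r.
rewrite big_ord_recr /= (exprS _ J.+1).
have : 0 <= t ^+ J.+1 by apply: exprn_ge0; lra.
set T := t ^+ J.+1 in IH * => T0; nra.
Qed.

(** At each point of the graph a layer is at most the slope integral over the whole horizontal
    slice, so the bound is the same for all graphs. The factor [expR (- (2 * e))] in [q] cancels the
    growth of the weights. *)
Lemma exp_trace_le tau (rho : R -> R) z1 z2 : continuous rho ->
  q = tau * expR (- (2 * e)) -> 0 < tau <= 2^-1 ->
  - L <= z1 -> z2 <= L -> (forall z, z1 <= z <= z2 -> a <= rho z <= L) ->
  int1 z1 z2 (fun z => Num.max 0 (expR (2 * f (rho z) z) - expR (4 * e))) <=
  expR (4 * e) * (2 * B * tau).
Proof.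
move=> crho qE tau01 z1L z2L rhoL.
have [M hM] := continuous2_bounded a L (- L) L cf.
(* [f] is bounded on the box, so finitely many layers suffice; their number does not enter the final
   bound. *)
have [J MJ] : exists J : nat, M <= J.+2%:R * e.
  exists (Num.bound (`|M| / e)); rewrite -ler_pdivrMr //.
  apply: (@le_trans _ _ (`|M| / e)); first by rewrite ler_pM2r ?invr_gt0 // ler_norm.
  apply: (@le_trans _ _ (Num.bound (`|M| / e))%:R); last by rewrite ler_nat; exact: leqW (leqnSn _).
  by apply: ltW; apply: archi_boundP; rewrite divr_ge0 // ltW.
pose c j := expR (2 * e * j.+3%:R) : R.
pose T j z := c j * layer e j.+1 (f (rho z) z).
have cT j : continuous (T j) by have := @cl j.+1; rewrite /T => ?; cts.
have csum K : continuous (fun z => \sum_(j < K) T j z).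
  elim: K => [|K IH].
    have -> : (fun z => \sum_(j < 0) T j z) = cst 0.
      by apply/funext => z; rewrite big_ord0.
    exact: cst_continuous.
  have -> : (fun z => \sum_(j < K.+1) T j z) = (fun z => \sum_(j < K) T j z + T K z).
    by apply/funext => z; rewrite big_ord_recr.
  exact: ctD.
have box z : z1 <= z <= z2 -> - L <= z <= L by move=> /andP[]; lra.
have intT j : int1 z1 z2 (T j) <= expR (4 * e) * B * tau ^+ j.+1.
  have cx := @continuous2_slope_x j.+1.
  rewrite /T int1Zl; last by have := @cl j.+1 => ?; cts.
  apply: (@le_trans _ _ (c j * (B * q ^+ j.+1))); last first.
    (* [2 e (j + 3) - 2 e (j + 1) = 4 e]: every weight leaves the same factor. *)
    rewrite qE exprMn -expRM_natl /c.
    rewrite [leLHS](_ : _ = expR (2 * e * j.+3%:R) * expR (j.+1%:R * - (2 * e)) * B * tau ^+ j.+1); last ring.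
    by rewrite -expRD (_ : _ + _ = 4 * e) // -!natr1; ring.
  rewrite ler_wpM2l ?expR_ge0 //.
  apply: le_trans (layer_slope_bound (j := j) cfx _ (layer_mass_le j)); last first.
    by move=> x z; rewrite lerDl sqr_ge0.
  have cN : continuous (fun z => int1 a L ((layer_slope_x j.+1) ^~ z)) by exact: continuous_int1.
  apply: (@le_trans _ _ (int1 z1 z2 (fun z => int1 a L ((layer_slope_x j.+1) ^~ z)))).
    apply: le_int1 => //; first by have := @cl j.+1 => ?; cts.
    by move=> z zI; apply: layer_le_slope_x; [exact: rhoL|exact: box].
  apply: int1_subset => // z _.
  by apply: int1_ge0 => t _; rewrite mulr_ge0 // dlayer_ge0.
apply: (@le_trans _ _ (int1 z1 z2 (fun z => \sum_(j < J) T j z))).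
  apply: le_int1 => //; first by cts.
  move=> z zI; apply: exp_excess_le; apply: le_trans MJ.
  by apply: le_trans (ler_norm _) (hM _ _ _ _); [exact: rhoL|exact: box].
apply: (@le_trans _ _ (\sum_(j < J) expR (4 * e) * B * tau ^+ j.+1)).
  elim: J {MJ} => [|K IH].
    rewrite big_ord0 (@eq_int1 _ _ _ _ (fun=> 0)); last by move=> z _; rewrite big_ord0.
    by have [zz|/int1_gt ->//] := leP z1 z2; rewrite int1_cst // mul0r.
  rewrite (@eq_int1 _ _ _ _ (fun z => \sum_(j < K) T j z + T K z)); last first.
    by move=> z _; rewrite big_ord_recr.
  by rewrite int1D // big_ord_recr /= lerD.
rewrite -mulr_sumr [leRHS](_ : _ = expR (4 * e) * B * (2 * tau)); last ring.
apply: ler_wpM2l; first by rewrite mulr_ge0 ?expR_ge0 ?(ltW B0).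
apply: geometric_sum_le; lra.
Qed.

End Layers.

(** [k] is 1 or -1, which covers [u] and [-u] at once. *)
Lemma layer_energy_le_energy {R : realType} (f ux uz : R -> R -> R) (k a L e : R) j :
  0 < e -> k ^+ 2 = 1 -> continuous2 f -> continuous2 ux -> continuous2 uz ->
  layer_energy f (fun x z => k * ux x z) (fun x z => k * uz x z) a L e j <=
  2 / e * int2 a L (- L) L (fun x z => ux x z ^+ 2 + uz x z ^+ 2).
Proof.
move=> e0 k1 cf cx cz; have cd := @continuous_dlayer R e j.
rewrite /layer_energy -int2Zl; last by cts.
apply: le_int2; [by cts|by cts|move=> x z _ _].
rewrite !exprMn k1 !mul1r ler_wpM2r ?addr_ge0 ?sqr_ge0 //.
exact: dlayer_le_cst.
Qed.

(** * Layer energies of superharmonic functions *)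

Section Divergence.
Context {R : realType}.

Lemma box_divergence (F G Fx Gz : R -> R -> R) (a b c d : R) :
  a <= b -> c <= d -> continuous2 F -> continuous2 G ->
  continuous2 Fx -> continuous2 Gz ->
  (forall x z : R, is_derive x 1 (F ^~ z) (Fx x z)) ->
  (forall x z : R, is_derive z 1 (G x) (Gz x z)) ->
  int2 a b c d (fun x z => Fx x z + Gz x z) =
  int1 c d (fun z => F b z - F a z) + int1 a b (fun x => G x d - G x c).
Proof.
move=> ab cd cF cG cFx cGz dF dG; rewrite int2D // (int2_swap _ _ _ _ cGz).
congr (_ + _); apply: eq_int1 => t _.
  by rewrite (int1_FTC ab _ (fun x => dF x t)) //; exact: continuous2_l.
by rewrite (int1_FTC cd _ (dG t)) //; exact: continuous2_r.
Qed.

End Divergence.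

Section SuperharmonicEnergy.
Context {R : realType}.
Context (w wx wz wxx wzz ux uz : R -> R -> R).
Context (cw : continuous2 w) (cwx : continuous2 wx) (cwz : continuous2 wz).
Context (cwxx : continuous2 wxx) (cwzz : continuous2 wzz).
Context (cux : continuous2 ux) (cuz : continuous2 uz).
Context (dwx : forall x z : R, is_derive x 1 (w ^~ z) (wx x z)).
Context (dwz : forall x z : R, is_derive z 1 (w x) (wz x z)).
Context (dwxx : forall x z : R, is_derive x 1 (wx ^~ z) (wxx x z)).
Context (dwzz : forall x z : R, is_derive z 1 (wz x) (wzz x z)).
Context (a : R) (a0 : 0 < a).
Context (pde : forall x z : R, a <= x ->
  wxx x z + wzz x z <= 2 * ux x z / x - (ux x z ^+ 2 + uz x z ^+ 2)).
Context (monotone : forall z : R, wx a z <= 0).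
Context (L' C D s : R) (aL' : a <= L') (s0 : 0 < s).
Context (C0 : 0 <= C).
Context (out_x : forall z : R, - L' <= z <= L' -> `|wx L' z| <= C / L' ^+ 2).
Context (out_z : forall x : R, a <= x <= L' -> `|wz x L'| <= C / L' ^+ 2).
Context (out_zN : forall x : R, a <= x <= L' -> `|wz x (- L')| <= C / L' ^+ 2).
Context (energy_u : int2 a L' (- L') L' (fun x z => ux x z ^+ 2 + uz x z ^+ 2) <= D).

(** Equal to [x^-1] where [a <= x], and continuous everywhere. *)
Let inv x := (Num.max x a)^-1.
(** [h] is nonnegative where [a <= x], by the differential inequality; [p] dominates the first-order
    term [2 u_x / x], which has no sign. *)
Let h x z := 2 * ux x z * inv x - (wxx x z + wzz x z).
Let p x z := 2 / a * `|ux x z|.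

Let invE x : a <= x -> inv x = x^-1.
Proof. by move=> ax; rewrite /inv max_l. Qed.

Let cinv : continuous inv.
Proof.
have pos (x : R) : Num.max x a != 0 by rewrite gt_eqF // lt_max a0 orbT.
rewrite /inv; apply: (ctV pos); cts.
Qed.

Let ch : continuous2 h. Proof. rewrite /h; cts. Qed.
Let cp : continuous2 p. Proof. rewrite /p; cts. Qed.

Let h_ge0 x z : a <= x -> 0 <= h x z.
Proof.
move=> ax; have := pde z ax; rewrite /h invE //.
by have := sqr_ge0 (ux x z); have := sqr_ge0 (uz x z); lra.
Qed.

Let p_ge x z : a <= x -> `|2 * ux x z * inv x| <= p x z.
Proof.
move=> ax; have x0 := lt_le_trans a0 ax.
rewrite invE // !normrM (gtr0_norm (_ : 0 < 2)) // /p mulrAC (ger0_norm (_ : 0 <= x^-1)) ?invr_ge0 ?(ltW x0) //.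
by rewrite ler_wpM2r // ler_wpM2l // lef_pV2 // ?posrE.
Qed.

Let L'0 : 0 < L'. Proof. exact: lt_le_trans a0 aL'. Qed.
Let LL' : - L' <= L'. Proof. by move: L'0 => ?; lra. Qed.

(** [2 |u_x| <= s + u_x^2 / s]; the free weight [s] balances the area of the box against the
    energy. *)
Let int_p : int2 a L' (- L') L' p <= (2 * s * L' ^+ 2 + D / s) / a.
Proof.
have c1 : continuous2 (fun x z => s / a + (a * s)^-1 * (ux x z ^+ 2 + uz x z ^+ 2)) by cts.
apply: le_trans (le_int2 (a := a) (b := L') (c := - L') (d := L') cp c1 _) _.
  move=> x z _ _; have -> : s / a + (a * s)^-1 * (ux x z ^+ 2 + uz x z ^+ 2) =
      a^-1 * (s + (ux x z ^+ 2 + uz x z ^+ 2) / s) by field; rewrite !gt_eqF.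
  rewrite /p mulrAC [leLHS]mulrC ler_wpM2l ?invr_ge0 ?(ltW a0) //.
  rewrite -(real_normK (num_real (ux x z))); set G := `|ux x z|.
  have -> : s + (G ^+ 2 + uz x z ^+ 2) / s = 2 * G + ((G - s) ^+ 2 + uz x z ^+ 2) / s.
    by field; rewrite gt_eqF.
  by rewrite lerDl divr_ge0 ?addr_ge0 ?sqr_ge0 // ltW.
rewrite int2D; [|by cts|by cts]; rewrite int2_cst // int2Zl; last by cts.
have -> : (2 * s * L' ^+ 2 + D / s) / a = s / a * L' * (L' - - L') + (a * s)^-1 * D.
  by field; rewrite !gt_eqF.
apply: lerD; last by rewrite ler_wpM2l // invr_ge0 mulr_ge0 // ltW.
rewrite ler_wpM2r ?ler_wpM2l ?divr_ge0 ?(ltW s0) ?(ltW a0) //; first by move: L'0 => ?; lra.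
by rewrite gerBl ltW.
Qed.

Let boundary := int1 (- L') L' (fun z => - wx a z).

(** The inequality integrated against the constant 1. Both terms on the left are nonnegative,
    [boundary] by monotonicity, so the integral of [h] and the inner flux are controlled at once.
    The outer sides have total length below [4 L'], whence [4 C / L']. *)
Let total : int2 a L' (- L') L' h + boundary <=
  (2 * s * L' ^+ 2 + D / s) / a + 4 * C / L'.
Proof.
have c1 : continuous2 (fun x z => 2 * ux x z * inv x) by cts.
have c2 : continuous2 (fun x z => wxx x z + wzz x z) by cts.
rewrite /h int2B // (box_divergence aL' LL' cwx cwz cwxx cwzz dwxx dwzz).
have cx t : continuous (wx t) by exact: continuous2_r.
have cz t : continuous (wz ^~ t) by exact: continuous2_l.
have cxa := cx a; have cxL := cx L'; have czL := cz L'; have czN := cz (- L').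
have -> : int1 (- L') L' (fun z => wx L' z - wx a z) =
    int1 (- L') L' (wx L') + boundary by rewrite /boundary -int1D //; cts.
have b1 : - int1 (- L') L' (wx L') <= C / L' ^+ 2 * (L' - - L').
  rewrite -int1_cst // -mulN1r -int1Zl //.
  apply: le_int1; [by cts|by cts|move=> z zL; rewrite mulN1r].
  by apply: le_trans (out_x zL); rewrite -normrN ler_norm.
have b2 : - int1 a L' (fun x => wz x L' - wz x (- L')) <= 2 * (C / L' ^+ 2) * (L' - a).
  rewrite -int1_cst // -mulN1r -int1Zl; last by cts.
  apply: le_int1; [by cts|by cts|move=> x xL; rewrite mulN1r opprB].
  have := ler_norm (wz x (- L')); have := ler_norm (- wz x L'); rewrite normrN.
  have := out_z xL; have := out_zN xL; lra.
have b3 : int2 a L' (- L') L' (fun x z => 2 * ux x z * inv x) <= int2 a L' (- L') L' p.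
  apply: le_int2 => // x z /andP[ax _] _; exact: le_trans (ler_norm _) (p_ge z ax).
have b4 : C / L' ^+ 2 * (L' - - L') + 2 * (C / L' ^+ 2) * (L' - a) <= 4 * C / L'.
  have -> : 4 * C / L' = C / L' ^+ 2 * (4 * L') by field; rewrite gt_eqF.
  have k0 : 0 <= C / L' ^+ 2 by rewrite divr_ge0 // sqr_ge0.
  rewrite -subr_ge0 [X in 0 <= X](_ : _ = 2 * (C / L' ^+ 2 * a)); last by ring.
  by rewrite mulr_ge0 // mulr_ge0 // ltW.
move: int_p b1 b2 b3 b4; lra.
Qed.

Context (L e : R) (aL : a <= L) (LL : L <= L') (e0 : 0 < e).
Context (w_right : forall z : R, - L <= z <= L -> w L z <= e).
Context (w_top : forall x : R, a <= x <= L -> w x L <= e).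
Context (w_bottom : forall x : R, a <= x <= L -> w x (- L) <= e).

(* Testing the equation for [w] against [layer e j.+1 w], which vanishes on the
   outer sides of the box, while on the inner side the boundary term has a sign. *)
Lemma superharmonic_layer_energy j :
  layer_energy w wx wz a L e j.+1 <=
  2 * ((2 * s * L' ^+ 2 + D / s) / a) + 4 * C / L'.
Proof.
pose S := layer e j.+1; pose dS := dlayer e j.+1.
have cS : continuous S := @continuous_layer R e j.+1.
have cdS : continuous dS := @continuous_dlayer R e j.+1.
have L0 : 0 < L := lt_le_trans a0 aL.
have LLN : - L <= L by move: L0 => ?; lra.
have dSx (x z : R) : is_derive x 1 (fun x => S (w x z) * wx x z)
    (dS (w x z) * wx x z ^+ 2 + S (w x z) * wxx x z).
  have d1 : is_derive x 1 (fun x => S (w x z)) (dS (w x z) * wx x z).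
    have := is_derive_layer e j.+1 (w x z) => d1; have := dwx x z => d2.
    exact: is_derive1_comp.
  have d2 := dwxx x z.
  by apply: isd_eq (isd_mul d1 d2) _; rewrite /GRing.scale /=; ring.
have dSz (x z : R) : is_derive z 1 (fun z => S (w x z) * wz x z)
    (dS (w x z) * wz x z ^+ 2 + S (w x z) * wzz x z).
  have d1 : is_derive z 1 (fun z => S (w x z)) (dS (w x z) * wz x z).
    have := is_derive_layer e j.+1 (w x z) => d1; have := dwz x z => d2.
    exact: is_derive1_comp.
  have d2 := dwzz x z.
  by apply: isd_eq (isd_mul d1 d2) _; rewrite /GRing.scale /=; ring.
have lev x z : w x z <= e -> S (w x z) = 0.
  by move=> we; apply: layer_eq0 => //; rewrite (le_trans we) // ler_peMl ?(ltW e0) // ler1n.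
have := @box_divergence R (fun x z => S (w x z) * wx x z) (fun x z => S (w x z) * wz x z)
  (fun x z => dS (w x z) * wx x z ^+ 2 + S (w x z) * wxx x z)
  (fun x z => dS (w x z) * wz x z ^+ 2 + S (w x z) * wzz x z) a L (- L) L aL LLN.
move=> /(_ ltac:(by cts) ltac:(by cts) ltac:(by cts) ltac:(by cts) dSx dSz).
rewrite [X in _ + X](@eq_int1 _ _ _ _ (fun=> 0)); last first.
  by move=> x xL; rewrite !lev ?mul0r ?subrr //; [exact: w_bottom|exact: w_top].
rewrite int1_cst // mul0r addr0.
rewrite (@eq_int1 _ _ _ _ (fun z => S (w a z) * - wx a z)); last first.
  by move=> z zL; rewrite (lev L z (w_right zL)) mul0r sub0r mulrN.
move=> identity.
have bdry : int1 (- L) L (fun z => S (w a z) * - wx a z) <= boundary.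
  have cxa : continuous (wx a) by exact: continuous2_r.
  have cwa : continuous (w a) by exact: continuous2_r.
  apply: (@le_trans _ _ (int1 (- L) L (fun z => - wx a z))).
    apply: le_int1; [by cts|by cts|move=> z _].
    have := layer_itv e j.+1 (w a z); rewrite -/S; have := monotone z; nra.
  apply: int1_subset; [by cts|by rewrite lerN2|by []|].
  by move=> z _; rewrite oppr_ge0.
have -> : layer_energy w wx wz a L e j.+1 = int2 a L (- L) L (fun x z =>
    (dS (w x z) * wx x z ^+ 2 + S (w x z) * wxx x z) +
    (dS (w x z) * wz x z ^+ 2 + S (w x z) * wzz x z)) +
    int2 a L (- L) L (fun x z => S (w x z) * (- (wxx x z + wzz x z))).
  rewrite -int2D; [|by cts|by cts]; apply: eq_int2 => x z _ _; rewrite -/dS; ring.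
rewrite identity.
(* Minus the Laplacian is [h] minus the first-order term, hence at most [h + p]; the layer is at
   most 1, and the nonnegative integrand allows passing to the larger box. *)
have hp : int2 a L (- L) L (fun x z => S (w x z) * (- (wxx x z + wzz x z))) <=
    int2 a L' (- L') L' h + int2 a L' (- L') L' p.
  apply: (@le_trans _ _ (int2 a L (- L) L (fun x z => h x z + p x z))).
    apply: le_int2; [by cts|by cts|move=> x z /andP[ax _] _].
    have /andP[S0 S1] := layer_itv e j.+1 (w x z).
    have p0 : 0 <= p x z by rewrite mulr_ge0 // divr_ge0 // ltW.
    have -> : - (wxx x z + wzz x z) = h x z + - (2 * ux x z * inv x) by rewrite /h; ring.
    apply: (@le_trans _ _ (S (w x z) * (h x z + p x z))).
      rewrite ler_wpM2l // lerD2l; apply: le_trans (p_ge z ax).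
      by rewrite -normrN ler_norm.
    by rewrite ler_piMl // addr_ge0 // h_ge0.
  rewrite -(int2D _ _ _ _ ch cp); apply: int2_subset; [by cts|by []|by []|by rewrite lerN2|by []|].
  move=> x z /andP[ax _] _; rewrite addr_ge0 ?h_ge0 //.
  by rewrite mulr_ge0 // divr_ge0 // ltW.
(* [boundary] and [h] together are bounded by [total]; the remaining [p] accounts for the factor
   2. *)
apply: le_trans (lerD bdry hp) _; rewrite addrA [boundary + _]addrC.
by apply: le_trans (lerD total int_p) _; set X := (_ + D / s) / a; set Y := 4 * C / L'; rewrite addrAC mulr_natl mulr2n.
Qed.

End SuperharmonicEnergy.

(** * Rotationally symmetric metrics and their scalar curvature *)

Section SpacePoints.
Context {R : realType}.
Implicit Types (x y z t : R) (f : 'rV[R]_3 -> R).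

Definition o0 : 'I_3 := @Ordinal 3 0 isT.
Definition o1 : 'I_3 := @Ordinal 3 1 isT.
Definition o2 : 'I_3 := @Ordinal 3 2 isT.

Definition pt x y z : 'rV[R]_3 := \row_(i < 3) [:: x; y; z]`_i.

Lemma inord_o0 : inord 0 = o0. Proof. by apply: val_inj; rewrite /= inordK. Qed.
Lemma inord_o1 : inord 1 = o1. Proof. by apply: val_inj; rewrite /= inordK. Qed.
Lemma inord_o2 : inord 2 = o2. Proof. by apply: val_inj; rewrite /= inordK. Qed.

Lemma ord3P (Q : 'I_3 -> Prop) : Q o0 -> Q o1 -> Q o2 -> forall i, Q i.
Proof.
move=> q0 q1 q2 [[|[|[|//]]] h].
- by have -> : Ordinal h = o0 by apply: val_inj.
- by have -> : Ordinal h = o1 by apply: val_inj.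
- by have -> : Ordinal h = o2 by apply: val_inj.
Qed.

Lemma sum3 (V : nmodType) (F : 'I_3 -> V) : \sum_i F i = F o0 + F o1 + F o2.
Proof.
rewrite !big_ord_recl big_ord0 addr0 addrA; congr (F _ + F _ + F _); exact: val_inj.
Qed.

Lemma ptE (p : 'rV[R]_3) : p = pt (p 0 o0) (p 0 o1) (p 0 o2).
Proof. by apply/rowP; elim/ord3P; rewrite mxE. Qed.

Lemma xco_pt x y z : xco (pt x y z) = x.
Proof. by rewrite /xco inord_o0 mxE. Qed.
Lemma yco_pt x y z : yco (pt x y z) = y.
Proof. by rewrite /yco inord_o1 mxE. Qed.
Lemma zco_pt x y z : zco (pt x y z) = z.
Proof. by rewrite /zco inord_o2 mxE. Qed.
Lemma rho_pt x y z : rho (pt x y z) = Num.sqrt (x ^+ 2 + y ^+ 2).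
Proof. by rewrite /rho xco_pt yco_pt. Qed.

Lemma pt_shift0 x y z t : t *: delta_mx 0 o0 + pt x y z = pt (t *: 1 + x) y z.
Proof. by apply/rowP; elim/ord3P; rewrite !mxE /= ?mulr0 ?add0r. Qed.
Lemma pt_shift1 x y z t : t *: delta_mx 0 o1 + pt x y z = pt x (t *: 1 + y) z.
Proof. by apply/rowP; elim/ord3P; rewrite !mxE /= ?mulr0 ?add0r. Qed.
Lemma pt_shift2 x y z t : t *: delta_mx 0 o2 + pt x y z = pt x y (t *: 1 + z).
Proof. by apply/rowP; elim/ord3P; rewrite !mxE /= ?mulr0 ?add0r. Qed.

(** The two difference quotients are the same function, so partial derivatives in space obey the
    one-variable rules. *)
Lemma is_derive_line0 f x y z d :
  is_derive (pt x y z) (delta_mx 0 o0) f d <-> is_derive x 1 (fun t => f (pt t y z)) d.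
Proof.
have E : (fun h : R => h^-1 *: ((f \o shift (pt x y z)) (h *: delta_mx 0 o0) - f (pt x y z))) =
    (fun h => h^-1 *: (((fun t => f (pt t y z)) \o shift x) (h *: 1) - f (pt x y z))).
  by apply/funext => h; rewrite /= pt_shift0.
split=> -[dv <-]; apply: DeriveDef.
- by rewrite /derivable /= -E.
- by rewrite /derive /= -E.
- by rewrite /derivable /= E.
- by rewrite /derive /= E.
Qed.

Lemma is_derive_line1 f x y z d :
  is_derive (pt x y z) (delta_mx 0 o1) f d <-> is_derive y 1 (fun t => f (pt x t z)) d.
Proof.
have E : (fun h : R => h^-1 *: ((f \o shift (pt x y z)) (h *: delta_mx 0 o1) - f (pt x y z))) =
    (fun h => h^-1 *: (((fun t => f (pt x t z)) \o shift y) (h *: 1) - f (pt x y z))).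
  by apply/funext => h; rewrite /= pt_shift1.
split=> -[dv <-]; apply: DeriveDef.
- by rewrite /derivable /= -E.
- by rewrite /derive /= -E.
- by rewrite /derivable /= E.
- by rewrite /derive /= E.
Qed.

Lemma is_derive_line2 f x y z d :
  is_derive (pt x y z) (delta_mx 0 o2) f d <-> is_derive z 1 (fun t => f (pt x y t)) d.
Proof.
have E : (fun h : R => h^-1 *: ((f \o shift (pt x y z)) (h *: delta_mx 0 o2) - f (pt x y z))) =
    (fun h => h^-1 *: (((fun t => f (pt x y t)) \o shift z) (h *: 1) - f (pt x y z))).
  by apply/funext => h; rewrite /= pt_shift2.
split=> -[dv <-]; apply: DeriveDef.
- by rewrite /derivable /= -E.
- by rewrite /derive /= -E.
- by rewrite /derivable /= E.
- by rewrite /derive /= E.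
Qed.

Lemma pd0E f x y z d : is_derive x 1 (fun t => f (pt t y z)) d ->
  pd o0 f (pt x y z) = d.
Proof. by move=> /is_derive_line0 [_ <-]. Qed.
Lemma pd1E f x y z d : is_derive y 1 (fun t => f (pt x t z)) d ->
  pd o1 f (pt x y z) = d.
Proof. by move=> /is_derive_line1 [_ <-]. Qed.
Lemma pd2E f x y z d : is_derive z 1 (fun t => f (pt x y t)) d ->
  pd o2 f (pt x y z) = d.
Proof. by move=> /is_derive_line2 [_ <-]. Qed.

Lemma continuous_pt (T : topologicalType) (f1 f2 f3 : T -> R) :
  continuous f1 -> continuous f2 -> continuous f3 ->
  continuous (fun s => pt (f1 s) (f2 s) (f3 s)).
Proof.
move=> c1 c2 c3.
have -> : (fun s => pt (f1 s) (f2 s) (f3 s)) = (fun s => f1 s *: delta_mx 0 o0 +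
    f2 s *: delta_mx 0 o1 + f3 s *: delta_mx 0 o2).
  apply/funext => s; apply/rowP; elim/ord3P; rewrite !mxE /= !(mulr0, mulr1, addr0, add0r) //.
move=> s; apply: cvgD; first apply: cvgD.
- by apply: cvgZr_tmp; exact: c1.
- by apply: cvgZr_tmp; exact: c2.
- by apply: cvgZr_tmp; exact: c3.
Qed.

Lemma smooth_line (F : 'rV[R]_3 -> R) (I : seq 'I_3) : smooth_on setT F ->
  [/\ forall x y z : R, is_derive x 1 (fun t => pds I F (pt t y z)) (pds (o0 :: I) F (pt x y z)),
      forall x y z : R, is_derive y 1 (fun t => pds I F (pt x t z)) (pds (o1 :: I) F (pt x y z)) &
      forall x y z : R, is_derive z 1 (fun t => pds I F (pt x y t)) (pds (o2 :: I) F (pt x y z))].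
Proof.
move=> sF; split=> x y z; have [_ d] := sF I (pt x y z) Logic.I.
- by apply/is_derive_line0; apply: DeriveDef => //; exact: d.
- by apply/is_derive_line1; apply: DeriveDef => //; exact: d.
- by apply/is_derive_line2; apply: DeriveDef => //; exact: d.
Qed.

Lemma smooth_continuous (F : 'rV[R]_3 -> R) (I : seq 'I_3) : smooth_on setT F ->
  continuous (pds I F).
Proof. by move=> sF p; have [] := sF I p Logic.I. Qed.

End SpacePoints.

Section Profiles.
Context {R : realType}.
Implicit Types (g : axisym_metric R) (x y z t : R).

Definition rzq x z : 'rV[R]_2 := \row_(i < 2) [:: x; z]`_i.

(* The values of [expR (- 2 u)] and [expR (2 (alpha - u))], read off from the
   Cartesian components on two half-planes; unlike [coef_u] and [coef_alpha],
   they are smooth across the axis. *)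
Definition prof_E g x z : R := metric g (pt 0 x z) o0 o0.
Definition prof_P g x z : R := metric g (pt x 0 z) o2 o2.

(** Off the axis [rho^2 dphi^2 = dx^2 + dy^2 - drho^2], so this is the matrix of [E (dx^2 + dy^2) +
    (P - E) drho^2 + P dz^2], where [drho = (x dx + y dy) / rho]. *)
Definition gform (P E x y : R) (i j : 'I_3) : R :=
  let V := (P - E) / (x ^+ 2 + y ^+ 2) in
  match nat_of_ord i, nat_of_ord j with
  | 0%N, 0%N => E + V * x ^+ 2
  | 0%N, 1%N => V * (x * y)
  | 1%N, 0%N => V * (x * y)
  | 1%N, 1%N => E + V * y ^+ 2
  | 2%N, 2%N => P
  | _, _ => 0
  end.

Lemma rz_pt x y z : rz (pt x y z) = rzq (Num.sqrt (x ^+ 2 + y ^+ 2)) z.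
Proof. by rewrite /rz /rzq rho_pt zco_pt. Qed.

Context (g : axisym_metric R).
Context (AB : forall q, half_plane q -> coef_A g q = 0 /\ coef_B g q = 0).

Lemma metric_gform x y z : 0 < x ^+ 2 + y ^+ 2 ->
  let q := rzq (Num.sqrt (x ^+ 2 + y ^+ 2)) z in
  forall i j, metric g (pt x y z) i j =
    gform (expR (2 * coef_alpha g q - 2 * coef_u g q)) (expR (- 2 * coef_u g q)) x y i j.
Proof.
move=> s0 q; set s := x ^+ 2 + y ^+ 2 in s0 q *.
have rho0 : 0 < rho (pt x y z) by rewrite rho_pt sqrtr_gt0.
have rr : Num.sqrt s ^+ 2 = s by rewrite sqr_sqrtr // ltW.
have qh : half_plane q by rewrite /half_plane /= mxE /= sqrtr_gt0.
have [A0 B0] := AB qh.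
rewrite (@metric_cylindrical _ g _ rho0) /cylindrical_form rz_pt -/s -/q A0 B0 !scale0r !addr0.
set P := expR _; set E := expR _.
have sn0 : Num.sqrt s != 0 by rewrite gt_eqF // sqrtr_gt0.
have s_neq0 : s != 0 by rewrite gt_eqF.
have D : drho (pt x y z) = \row_(i < 3) [:: x / Num.sqrt s; y / Num.sqrt s; 0]`_i.
  by rewrite /drho xco_pt yco_pt rho_pt.
have F : dphi (pt x y z) = \row_(i < 3) [:: - y / s; x / s; 0]`_i.
  by rewrite /dphi xco_pt yco_pt rho_pt -/s rr.
have rE : (Num.sqrt s)^-1 * (Num.sqrt s)^-1 = s^-1 by rewrite -invfM -expr2 rr.
have dd a b : a / Num.sqrt s * (b / Num.sqrt s) = a * b / s by rewrite mulrACA rE.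
(* A null term carrying the relation [x^2 + y^2 = s], which [ring] does not see; [comb] adds it to
   the two diagonal entries that need it. *)
have hy : E * (y * y / s + x * x / s - 1) = 0.
  by rewrite -mulrDl -!expr2 [y ^+ 2 + _]addrC -/s divff // subrr mulr0.
have ee a b : s * E * (a / s * (b / s)) = E * (a * b / s) by field.
have comb (a b : R) : a = b + E * (y * y / s + x * x / s - 1) -> a = b.
  by rewrite hy addr0.
rewrite rho_pt -/s rr D F; apply: ord3P; apply: ord3P;
  rewrite /sqform /dz !mxE !big_ord_recl !big_ord0 !mxE /= /gform /= -/s
    !(mulr0, mul0r, addr0, add0r, mulr1) ?dd ?ee //; try ring.
- by apply: comb; ring.
- by apply: comb; ring.
Qed.

Lemma prof_E_coef x z : 0 < x ->
  prof_E g x z = expR (- 2 * coef_u g (rzq x z)).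
Proof.
move=> x0; rewrite /prof_E metric_gform; last by rewrite expr0n add0r exprn_gt0.
by rewrite /gform /= expr0n /= mulr0 addr0 add0r sqrtr_sqr ger0_norm // ltW.
Qed.

Lemma prof_P_coef x z : 0 < x ->
  prof_P g x z = expR (2 * coef_alpha g (rzq x z) - 2 * coef_u g (rzq x z)).
Proof.
move=> x0; rewrite /prof_P metric_gform; last by rewrite expr0n addr0 exprn_gt0.
by rewrite /gform /= expr0n /= addr0 sqrtr_sqr ger0_norm // ltW.
Qed.

Lemma metric_prof x y z : 0 < x ^+ 2 + y ^+ 2 ->
  let r := Num.sqrt (x ^+ 2 + y ^+ 2) in
  forall i j, metric g (pt x y z) i j = gform (prof_P g r z) (prof_E g r z) x y i j.
Proof.
move=> s0 r i j; rewrite metric_gform // prof_E_coef ?sqrtr_gt0 //.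
by rewrite prof_P_coef ?sqrtr_gt0.
Qed.

End Profiles.

Section ProfileRegularity.
Context {R : realType} (g : axisym_metric R).
Implicit Types (x y z t : R).

Let sm i j : smooth_on setT (fun p => metric g p i j).
Proof. by have [s _ _] := metric_riemannian g. Qed.

Lemma metric_diag_gt0 p i : 0 < metric g p i i.
Proof.
have [_ _ pos] := metric_riemannian g.
have := pos p (delta_mx 0 i); rewrite -rowE => /(_ _).
have d0 : (delta_mx 0 i : 'rV[R]_3) != 0.
  by apply/eqP => /matrixP /(_ 0 i) /eqP; rewrite !mxE !eqxx oner_eq0.
move=> /(_ d0); rewrite trmx_delta -colE !mxE //.
Qed.

Lemma prof_E_gt0 x z : 0 < prof_E g x z. Proof. exact: metric_diag_gt0. Qed.
Lemma prof_P_gt0 x z : 0 < prof_P g x z. Proof. exact: metric_diag_gt0. Qed.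

End ProfileRegularity.

(** Explicit derivatives on the whole plane, axis included, as the divergence theorem and the
    Laplacian call for them. *)
Record plane_C2 {R : realType} (f fx fz fxx fzz : R -> R -> R) : Prop := PlaneC2 {
  c2_0 : continuous2 f;
  c2_x : continuous2 fx;
  c2_z : continuous2 fz;
  c2_xx : continuous2 fxx;
  c2_zz : continuous2 fzz;
  c2_dx : forall x z : R, is_derive x 1 (f ^~ z) (fx x z);
  c2_dz : forall x z : R, is_derive z 1 (f x) (fz x z);
  c2_dxx : forall x z : R, is_derive x 1 (fx ^~ z) (fxx x z);
  c2_dzz : forall x z : R, is_derive z 1 (fz x) (fzz x z) }.

Section PlaneC2.
Context {R : realType}.

Lemma plane_C2B (f fx fz fxx fzz h hx hz hxx hzz : R -> R -> R) :
  plane_C2 f fx fz fxx fzz -> plane_C2 h hx hz hxx hzz ->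
  plane_C2 (fun x z => f x z - h x z)
    (fun x z => fx x z - hx x z) (fun x z => fz x z - hz x z)
    (fun x z => fxx x z - hxx x z) (fun x z => fzz x z - hzz x z).
Proof.
case=> cf cfx cfz cfxx cfzz dx dz dxx dzz.
case=> ch chx chz chxx chzz ex ez exx ezz.
split; try by cts.
- by move=> x z; apply: isd_add (dx x z) (isd_opp (ex x z)).
- by move=> x z; apply: isd_add (dz x z) (isd_opp (ez x z)).
- by move=> x z; apply: isd_add (dxx x z) (isd_opp (exx x z)).
- by move=> x z; apply: isd_add (dzz x z) (isd_opp (ezz x z)).
Qed.

Lemma plane_C2_ln (h hx hz hxx hzz : R -> R -> R) (k : R) :
  (forall x z, 0 < h x z) -> plane_C2 h hx hz hxx hzz ->
  plane_C2 (fun x z => k * ln (h x z))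
    (fun x z => k * (hx x z / h x z)) (fun x z => k * (hz x z / h x z))
    (fun x z => k * (hxx x z / h x z - (hx x z / h x z) ^+ 2))
    (fun x z => k * (hzz x z / h x z - (hz x z / h x z) ^+ 2)).
Proof.
move=> h0 [ch chx chz chxx chzz ex ez exx ezz].
have hN0 x z : h x z != 0 by rewrite gt_eqF.
have sc (F : R -> R) (x df : R) : is_derive x 1 F df -> is_derive x 1 (fun x => k * F x) (k * df).
  by move=> dF; apply: isd_eq (isd_mul (isd_cst x k) dF) _; rewrite mul0r add0r.
have cV : continuous2 (fun x z => (h x z)^-1).
  by rewrite /continuous2; apply: ctV => // p; exact: hN0.
have cln : continuous2 (fun x z => ln (h x z)).
  move=> p; apply: continuous_comp; first exact: (ch p).
  exact: continuous_ln.
have qd (F G : R -> R) (x df dg : R) : G x != 0 -> is_derive x 1 F df -> is_derive x 1 G dg ->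
    is_derive x 1 (fun x => F x / G x) (df / G x - (F x / G x) * (dg / G x)).
  move=> G0 dF dG; apply: isd_eq (isd_mul dF (isd_inv G0 dG)) _.
  by field.
split.
- by rewrite /continuous2; apply: ctM; [exact: ct_cst|exact: cln].
- by rewrite /continuous2; apply: ctM; [exact: ct_cst|apply: ctM].
- by rewrite /continuous2; apply: ctM; [exact: ct_cst|apply: ctM].
- rewrite /continuous2; apply: ctM; [exact: ct_cst|apply: ctD; first exact: ctM].
  by apply: ctN; apply: ctX; exact: ctM.
- rewrite /continuous2; apply: ctM; [exact: ct_cst|apply: ctD; first exact: ctM].
  by apply: ctN; apply: ctX; exact: ctM.
- move=> x z; apply: sc; have d := is_derive1_ln (h0 x z).
  by apply: isd_eq (isd_comp d (ex x z)) _; rewrite mulrC.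
- move=> x z; apply: sc; have d := is_derive1_ln (h0 x z).
  by apply: isd_eq (isd_comp d (ez x z)) _; rewrite mulrC.
- by move=> x z; apply: sc; apply: isd_eq (qd _ _ _ _ _ (hN0 x z) (exx x z) (ex x z)) _; rewrite expr2.
- by move=> x z; apply: sc; apply: isd_eq (qd _ _ _ _ _ (hN0 x z) (ezz x z) (ez x z)) _; rewrite expr2.
Qed.

End PlaneC2.

Section RotationalForm.
Context {R : realType}.
Implicit Types (x y z t : R).

(* The derivative of [gform] in the direction [k], given the first jets
   [(e, ex, ez)] and [(p, px, pz)] of the profiles at [(r, z)]. *)
Definition dgform (k : 'I_3) (e ex ez p px pz r x y : R) (i j : 'I_3) : R :=
  let s := x ^+ 2 + y ^+ 2 in
  let V := (p - e) / s in
  let Vr := (px - ex) / r / s - 2 * (p - e) / s ^+ 2 in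
  let Vz := (pz - ez) / s in
  match nat_of_ord k, nat_of_ord i, nat_of_ord j with
  | 0%N, 0%N, 0%N => x * (ex / r + Vr * x ^+ 2 + 2 * V)
  | 0%N, 0%N, 1%N | 0%N, 1%N, 0%N => y * (Vr * x ^+ 2 + V)
  | 0%N, 1%N, 1%N => x * (ex / r + Vr * y ^+ 2)
  | 0%N, 2%N, 2%N => x * (px / r)
  | 1%N, 0%N, 0%N => y * (ex / r + Vr * x ^+ 2)
  | 1%N, 0%N, 1%N | 1%N, 1%N, 0%N => x * (Vr * y ^+ 2 + V)
  | 1%N, 1%N, 1%N => y * (ex / r + Vr * y ^+ 2 + 2 * V)
  | 1%N, 2%N, 2%N => y * (px / r)
  | 2%N, 0%N, 0%N => ez + Vz * x ^+ 2
  | 2%N, 0%N, 1%N | 2%N, 1%N, 0%N => Vz * (x * y)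
  | 2%N, 1%N, 1%N => ez + Vz * y ^+ 2
  | 2%N, 2%N, 2%N => pz
  | _, _, _ => 0
  end.

Definition dist_axis x y : R := Num.sqrt (x ^+ 2 + y ^+ 2).

Lemma dist_axisC x y : dist_axis x y = dist_axis y x.
Proof. by rewrite /dist_axis addrC. Qed.

Lemma is_derive_dist_axis x y : 0 < x ^+ 2 + y ^+ 2 ->
  is_derive x 1 (dist_axis ^~ y) (x / dist_axis x y).
Proof.
move=> s0; have d := is_derive1_sqrt s0.
have d2 : is_derive x 1 (fun t => t ^+ 2 + y ^+ 2) (2 * x).
  apply: isd_eq (isd_add (isd_mul (isd_id x) (isd_id x)) (isd_cst x (y ^+ 2))) _.
  ring.
rewrite /dist_axis.
apply: isd_eq (@isd_comp _ Num.sqrt (fun t => t ^+ 2 + y ^+ 2) _ _ _ d d2) _.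
by field; rewrite gt_eqF // sqrtr_gt0.
Qed.

Context (E Ex Ez P Px Pz : R -> R -> R).
Context (dEx : forall x z : R, 0 < x -> is_derive x 1 (E ^~ z) (Ex x z)).
Context (dEz : forall x z : R, 0 < x -> is_derive z 1 (E x) (Ez x z)).
Context (dPx : forall x z : R, 0 < x -> is_derive x 1 (P ^~ z) (Px x z)).
Context (dPz : forall x z : R, 0 < x -> is_derive z 1 (P x) (Pz x z)).

Definition gform_at x y z i j :=
  gform (P (dist_axis x y) z) (E (dist_axis x y) z) x y i j.
Definition dgform_at k x y z i j := let r := dist_axis x y in
  dgform k (E r z) (Ex r z) (Ez r z) (P r z) (Px r z) (Pz r z) r x y i j.

Definition swap01 (i : 'I_3) : 'I_3 :=
  match nat_of_ord i with 0%N => o1 | 1%N => o0 | _ => o2 end.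

(** Exchanging [x] and [y] is a symmetry of the form; it reduces the derivatives in [y] to those in
    [x]. *)
Lemma gformC x y z i j : gform_at x y z i j = gform_at y x z (swap01 i) (swap01 j).
Proof.
rewrite /gform_at (dist_axisC y x) /gform (addrC (y ^+ 2)) (mulrC y).
by move: i j; apply: ord3P; apply: ord3P.
Qed.

Lemma dgformC x y z i j :
  dgform_at o1 x y z i j = dgform_at o0 y x z (swap01 i) (swap01 j).
Proof.
rewrite /dgform_at (dist_axisC y x) /dgform (addrC (y ^+ 2)).
by move: i j; apply: ord3P; apply: ord3P.
Qed.

Lemma is_derive_gform0 x y z i j : 0 < x ^+ 2 + y ^+ 2 ->
  is_derive x 1 (fun t => gform_at t y z i j) (dgform_at o0 x y z i j).
Proof.
move=> s0; have r0 : 0 < dist_axis x y by rewrite sqrtr_gt0.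
have rr : dist_axis x y ^+ 2 = x ^+ 2 + y ^+ 2 by rewrite sqr_sqrtr // ltW.
have dr := is_derive_dist_axis s0.
have de := @isd_comp _ (E ^~ z) (dist_axis ^~ y) _ _ _ (dEx z r0) dr.
have dp := @isd_comp _ (P ^~ z) (dist_axis ^~ y) _ _ _ (dPx z r0) dr.
have ds : is_derive x 1 (fun t => t ^+ 2 + y ^+ 2) (2 * x).
  apply: isd_eq (isd_add (isd_mul (isd_id x) (isd_id x)) (isd_cst x (y ^+ 2))) _.
  ring.
have dx2 : is_derive x 1 (fun t => t ^+ 2) (2 * x).
  by apply: isd_eq (isd_mul (isd_id x) (isd_id x)) _; ring.
have sN0 : x ^+ 2 + y ^+ 2 != 0 by rewrite gt_eqF.
have rN0 : dist_axis x y != 0 by rewrite gt_eqF.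
have dV := isd_mul (isd_add dp (isd_opp de)) (@isd_inv _ (fun t => t ^+ 2 + y ^+ 2) _ _ sN0 ds).
move: i j; apply: ord3P; apply: ord3P; rewrite /gform_at /dgform_at /gform /dgform /=;
  try exact: isd_cst; try exact: isd_eq dp _.
- apply: isd_eq (isd_add de (isd_mul dV dx2)) _; field.
  by rewrite sN0 rN0.
- apply: isd_eq (isd_mul dV (isd_mul (isd_id x) (isd_cst x y))) _; field.
  by rewrite sN0 rN0.
- apply: isd_eq (isd_mul dV (isd_mul (isd_id x) (isd_cst x y))) _; field.
  by rewrite sN0 rN0.
- apply: isd_eq (isd_add de (isd_mul dV (isd_cst x (y ^+ 2)))) _; field.
  by rewrite sN0 rN0.
- by apply: isd_eq dp _; rewrite mulrCA.
Qed.

Lemma is_derive_gform1 x y z i j : 0 < x ^+ 2 + y ^+ 2 ->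
  is_derive y 1 (fun t => gform_at x t z i j) (dgform_at o1 x y z i j).
Proof.
move=> s0; rewrite dgformC.
under eq_fun do rewrite gformC.
by apply: is_derive_gform0; rewrite addrC.
Qed.

Lemma is_derive_gform2 x y z i j : 0 < x ^+ 2 + y ^+ 2 ->
  is_derive z 1 (fun t => gform_at x y t i j) (dgform_at o2 x y z i j).
Proof.
move=> s0; have r0 : 0 < dist_axis x y by rewrite sqrtr_gt0.
have sN0 : x ^+ 2 + y ^+ 2 != 0 by rewrite gt_eqF.
have de := dEz z r0.
have dp := dPz z r0.
have dV := isd_mul (isd_add dp (isd_opp de)) (isd_cst z ((x ^+ 2 + y ^+ 2)^-1)).
move: i j; apply: ord3P; apply: ord3P; rewrite /gform_at /dgform_at /gform /dgform /=;
  try exact: isd_cst.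
- apply: isd_eq (isd_add de (isd_mul dV (isd_cst z (x ^+ 2)))) _; by field.
- apply: isd_eq (isd_mul dV (isd_cst z (x * y))) _; by field.
- apply: isd_eq (isd_mul dV (isd_cst z (x * y))) _; by field.
- apply: isd_eq (isd_add de (isd_mul dV (isd_cst z (y ^+ 2)))) _; by field.
- exact: dp.
Qed.

End RotationalForm.

Section ProfileC2.
Context {R : realType} (g : axisym_metric R).

Let sm i j : smooth_on setT (fun p => metric g p i j).
Proof. by have [s _ _] := metric_riemannian g. Qed.

(** The radial variable of [prof_E] is the second Cartesian coordinate and that of [prof_P] the
    first, so radial derivatives have index [o1] here and [o0] in [prof_dP]. *)
Definition prof_dE (I : seq 'I_3) (x z : R) :=
  pds I (fun p => metric g p o0 o0) (pt 0 x z).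
Definition prof_dP (I : seq 'I_3) (x z : R) :=
  pds I (fun p => metric g p o2 o2) (pt x 0 z).

Lemma plane_C2_prof_E : plane_C2 (prof_E g) (prof_dE [:: o1]) (prof_dE [:: o2])
  (prof_dE [:: o1; o1]) (prof_dE [:: o2; o2]).
Proof.
have cE I : continuous2 (prof_dE I).
  move=> q; apply: (@continuous_comp _ _ _ (fun p : R * R => pt 0 p.1 p.2)
    (pds I (fun p => metric g p o0 o0))).
    by apply: continuous_pt; [exact: ct_cst|exact: ct_fst|exact: ct_snd].
  exact: smooth_continuous (sm o0 o0) _.
split; try exact: cE.
- exact: cE [::].
- by move=> x z; have [_ d _] := smooth_line [::] (sm o0 o0); exact: d.
- by move=> x z; have [_ _ d] := smooth_line [::] (sm o0 o0); exact: d.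
- by move=> x z; have [_ d _] := smooth_line [:: o1] (sm o0 o0); exact: d.
- by move=> x z; have [_ _ d] := smooth_line [:: o2] (sm o0 o0); exact: d.
Qed.

Lemma plane_C2_prof_P : plane_C2 (prof_P g) (prof_dP [:: o0]) (prof_dP [:: o2])
  (prof_dP [:: o0; o0]) (prof_dP [:: o2; o2]).
Proof.
have cP I : continuous2 (prof_dP I).
  move=> q; apply: (@continuous_comp _ _ _ (fun p : R * R => pt p.1 0 p.2)
    (pds I (fun p => metric g p o2 o2))).
    by apply: continuous_pt; [exact: ct_fst|exact: ct_cst|exact: ct_snd].
  exact: smooth_continuous (sm o2 o2) _.
split; try exact: cP.
- exact: cP [::].
- by move=> x z; have [d _ _] := smooth_line [::] (sm o2 o2); exact: d.
- by move=> x z; have [_ _ d] := smooth_line [::] (sm o2 o2); exact: d.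
- by move=> x z; have [d _ _] := smooth_line [:: o0] (sm o2 o2); exact: d.
- by move=> x z; have [_ _ d] := smooth_line [:: o2] (sm o2 o2); exact: d.
Qed.

End ProfileC2.

Section ScalarCurvature.
Context {R : realType}.
Implicit Types (x y z t : R).

Lemma vderiveM (V : normedModType R) (f h : V -> R) (p v : V) (df dh : R) :
  is_derive p v f df -> is_derive p v h dh ->
  is_derive p v (fun q => f q * h q) (df * h p + f p * dh).
Proof.
move=> hf hg; apply: is_derive_eq (is_deriveM hf hg) _.
by rewrite /GRing.scale /= addrC [h p * _]mulrC.
Qed.

Lemma vderiveD (V : normedModType R) (f h : V -> R) (p v : V) (df dh : R) :
  is_derive p v f df -> is_derive p v h dh ->
  is_derive p v (fun q => f q + h q) (df + dh).
Proof. by move=> hf hg; exact: is_deriveD. Qed.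

Lemma vderiveB (V : normedModType R) (f h : V -> R) (p v : V) (df dh : R) :
  is_derive p v f df -> is_derive p v h dh ->
  is_derive p v (fun q => f q - h q) (df - dh).
Proof. by move=> hf hg; exact: is_deriveB. Qed.

Context (gm : 'rV[R]_3 -> 'M[R]_3).
Context (sm : forall i j, smooth_on setT (fun p => gm p i j)).

Lemma pd_christoffel p (m k i j : 'I_3) (dG : 'I_3 -> R) :
  (forall l, is_derive p (delta_mx 0 m) (fun q => invmx (gm q) k l) (dG l)) ->
  pd m (christoffel gm k i j) p = 2^-1 * \sum_l
    (dG l * (pd i (fun q => gm q j l) p + pd j (fun q => gm q i l) p
             - pd l (fun q => gm q i j) p)
     + invmx (gm p) k l *
       (pds [:: m; i] (fun q => gm q j l) p + pds [:: m; j] (fun q => gm q i l) p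
        - pds [:: m; l] (fun q => gm q i j) p)).
Proof.
move=> dGP.
have dd a b c : is_derive p (delta_mx 0 m) (pd a (fun q => gm q b c)) (pds [:: m; a] (fun q => gm q b c) p).
  by have [_ d] := @sm b c [:: a] p Logic.I; apply: DeriveDef => //; exact: d.
have dT l := vderiveM (dGP l) (vderiveB (vderiveD (dd i j l) (dd j i l)) (dd l i j)).
have dS := vderiveM (is_derive_cst (2^-1 : R) p (delta_mx 0 m)) (vderiveD (vderiveD (dT o0) (dT o1)) (dT o2)).
rewrite sum3; case: dS => _; rewrite mul0r add0r /= => <-.
rewrite /pd; apply: (congr1 (fun F => 'D_(delta_mx 0 m) F p)).
by apply/funext => q; rewrite /christoffel sum3.
Qed.

Context (E Ex Ez Exx Ezz P Px Pz Pxx Pzz : R -> R -> R).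
Context (C2E : plane_C2 E Ex Ez Exx Ezz) (C2P : plane_C2 P Px Pz Pxx Pzz).
Context (E0 : forall x z : R, 0 < E x z) (P0 : forall x z : R, 0 < P x z).
Context (gmE : forall x y z i j, 0 < x ^+ 2 + y ^+ 2 -> gm (pt x y z) i j = gform_at E P x y z i j).

Let iE x z := (E x z)^-1.
Let iP x z := (P x z)^-1.

(** The radial, angular and axial directions diagonalise the form with eigenvalues [P], [E], [P];
    the inverse has the same shape with the reciprocals. *)
Lemma invmx_gform x y z i j : 0 < x ^+ 2 + y ^+ 2 ->
  invmx (gm (pt x y z)) i j = gform_at iE iP x y z i j.
Proof.
move=> s0; set r := dist_axis x y.
have eN : E r z != 0 by rewrite gt_eqF.
have pN : P r z != 0 by rewrite gt_eqF.
have sN : x ^+ 2 + y ^+ 2 != 0 by rewrite gt_eqF.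
pose G := \matrix_(i, j) gform_at iE iP x y z i j : 'M[R]_3.
suff h : gm (pt x y z) *m G = 1%:M.
  have [u _] := mulmx1_unit h.
  by rewrite -[invmx _]mulmx1 -h mulmxA mulVmx // mul1mx mxE.
apply/matrixP => a b; rewrite !mxE sum3 !mxE !gmE //.
move: a b; apply: ord3P; apply: ord3P; rewrite /gform_at /iE /iP -/r /gform /=; field;
  by rewrite ?eN ?pN ?sN.
Qed.

(** On the half-plane [y = 0] the matrix is diagonal. Moving along the circle turns its
    eigenvectors, which to first order produces only the off-diagonal entry [(p - e) / a]. *)
Definition dflat (k : 'I_3) (e ex ez p px pz a : R) (i j : 'I_3) : R :=
  match nat_of_ord k, nat_of_ord i, nat_of_ord j with
  | 0%N, 0%N, 0%N => px
  | 0%N, 1%N, 1%N => ex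
  | 0%N, 2%N, 2%N => px
  | 1%N, 0%N, 1%N | 1%N, 1%N, 0%N => (p - e) / a
  | 2%N, 0%N, 0%N => pz
  | 2%N, 1%N, 1%N => ez
  | 2%N, 2%N, 2%N => pz
  | _, _, _ => 0
  end.

Lemma dgform_flat k e ex ez p px pz a i j : 0 < a ->
  dgform k e ex ez p px pz a a 0 i j = dflat k e ex ez p px pz a i j.
Proof.
move=> a0; have aN : a != 0 by rewrite gt_eqF.
move: k i j; do 3!apply: ord3P; rewrite /dgform /dflat /= //; field; by rewrite ?aN.
Qed.

End ScalarCurvature.

Section ScalarCurvatureFormula.
Context {R : realType}.
Implicit Types (x y z t : R).
Context (gm : 'rV[R]_3 -> 'M[R]_3).
Context (sm : forall i j, smooth_on setT (fun p => gm p i j)).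
Context (E Ex Ez Exx Ezz P Px Pz Pxx Pzz : R -> R -> R).
Context (C2E : plane_C2 E Ex Ez Exx Ezz) (C2P : plane_C2 P Px Pz Pxx Pzz).
Context (E0 : forall x z : R, 0 < E x z) (P0 : forall x z : R, 0 < P x z).
Context (gmE : forall x y z i j, 0 < x ^+ 2 + y ^+ 2 -> gm (pt x y z) i j = gform_at E P x y z i j).

Lemma near_sqr_sum x y : 0 < x ^+ 2 + y ^+ 2 -> \near x, 0 < x ^+ 2 + y ^+ 2.
Proof.
move=> s0; have c : continuous (fun t : R => t ^+ 2 + y ^+ 2) by cts.
exact: (c x _ (lt_nbhsr s0)).
Qed.

Lemma pd_gform k x y z i j : 0 < x ^+ 2 + y ^+ 2 ->
  pd k (fun q => gm q i j) (pt x y z) = dgform_at E Ex Ez P Px Pz k x y z i j.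
Proof.
move=> s0; case: C2E => _ _ _ _ _ ex ez _ _; case: C2P => _ _ _ _ _ px pz _ _.
move: k; apply: ord3P.
- apply: pd0E; apply: isd_ext; last first.
    by apply: is_derive_gform0 => // u v _.
  near=> t; rewrite gmE //; near: t; exact: near_sqr_sum.
- apply: pd1E; apply: isd_ext; last first.
    by apply: is_derive_gform1 => // u v _.
  near=> t; rewrite gmE // addrC; near: t; apply: near_sqr_sum; by rewrite addrC.
- apply: pd2E; apply: isd_ext; last first.
    by apply: is_derive_gform2 => // u v _.
  by near=> t; rewrite gmE.
Unshelve. all: by end_near. Qed.

Context (a c : R) (a0 : 0 < a).

Let s0 : 0 < a ^+ 2 + 0 ^+ 2. Proof. by rewrite expr0n addr0 exprn_gt0. Qed.

Lemma dist_axis0 x : 0 < x -> dist_axis x 0 = x.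
Proof. by move=> x0; rewrite /dist_axis expr0n addr0 sqrtr_sqr gtr0_norm. Qed.

Lemma dgform_at_flat k x z i j : 0 < x -> dgform_at E Ex Ez P Px Pz k x 0 z i j =
  dflat k (E x z) (Ex x z) (Ez x z) (P x z) (Px x z) (Pz x z) x i j.
Proof. by move=> x0; rewrite /dgform_at dist_axis0 // dgform_flat. Qed.

Lemma pd_flat k x z i j : 0 < x -> pd k (fun q => gm q i j) (pt x 0 z) =
  dflat k (E x z) (Ex x z) (Ez x z) (P x z) (Px x z) (Pz x z) x i j.
Proof.
by move=> x0; rewrite pd_gform ?dgform_at_flat // expr0n addr0 exprn_gt0.
Qed.

Definition jet2 (m i j l : 'I_3) := pds [:: m; i] (fun q => gm q j l) (pt a 0 c).

Lemma jet2_0 i j l d :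
  is_derive a 1 (fun x => dflat i (E x c) (Ex x c) (Ez x c) (P x c) (Px x c) (Pz x c) x j l) d ->
  jet2 o0 i j l = d.
Proof.
move=> hd; apply: pd0E; apply: isd_ext hd.
near=> t; rewrite [RHS]pd_flat //; near: t; exact: lt_nbhsr.
Unshelve. all: by end_near. Qed.

Lemma jet2_2 i j l d :
  is_derive c 1 (fun z => dflat i (E a z) (Ex a z) (Ez a z) (P a z) (Px a z) (Pz a z) a j l) d ->
  jet2 o2 i j l = d.
Proof.
move=> hd; apply: pd2E; apply: isd_ext hd.
by near=> t; rewrite [RHS]pd_flat.
Unshelve. all: by end_near. Qed.

(** The difference quotient of [t * k t] at 0 is [k t] itself, so continuity of [k] is enough. *)
Lemma isd_mul_id (k : R -> R) d : continuous k -> k 0 = d -> is_derive (0 : R) 1 (fun t => t * k t) d.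
Proof.
move=> ck <-.
have E1 : (fun h : R => h^-1 *: (((fun t => t * k t) \o shift 0) (h *: 1) - 0 * k 0)) @ 0^' --> k 0.
  have h2 : k @ 0^' --> k 0 by exact: cvg_within_filter (ck 0).
  apply: cvg_trans h2; apply: near_eq_cvg; near=> h; rewrite /= /GRing.scale /= mulr1 addr0 mul0r subr0.
  rewrite mulKf //; near: h; exact: nbhs_dnbhs_neq.
apply: DeriveDef; last exact: cvg_lim E1.
by apply/cvg_ex; exists (k 0).
Unshelve. all: by end_near. Qed.

(* Along the circle direction every first derivative needed is [t] times a
   continuous function. *)
Lemma jet2_1 i j l (k : R -> R) d : continuous k -> k 0 = d ->
  (forall t : R, dgform_at E Ex Ez P Px Pz i a t c j l = t * k t) ->
  jet2 o1 i j l = d.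
Proof.
move=> ck k0 hk; apply: pd1E; apply: isd_ext (isd_mul_id ck k0).
near=> t; rewrite -hk [RHS]pd_gform // ltr_wpDr ?sqr_ge0 // exprn_gt0 //.
Unshelve. all: by end_near. Qed.

Let aN : a != 0. Proof. by rewrite gt_eqF. Qed.
Let c_r : continuous (fun t : R => dist_axis a t). Proof. by rewrite /dist_axis; cts. Qed.
Let rN t : dist_axis a t != 0.
Proof. by rewrite gt_eqF // sqrtr_gt0 ltr_wpDr ?sqr_ge0 // exprn_gt0. Qed.
Let sN t : a ^+ 2 + t ^+ 2 != 0.
Proof. by rewrite gt_eqF // ltr_wpDr ?sqr_ge0 // exprn_gt0. Qed.
Let c_rV : continuous (fun t : R => (dist_axis a t)^-1).
Proof. by apply: ctV. Qed.
Let c_sV : continuous (fun t : R => (a ^+ 2 + t ^+ 2)^-1).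
Proof. by apply: ctV => //; cts. Qed.

Let Vr t := (Px (dist_axis a t) c - Ex (dist_axis a t) c) / dist_axis a t / (a ^+ 2 + t ^+ 2)
  - 2 * (P (dist_axis a t) c - E (dist_axis a t) c) / (a ^+ 2 + t ^+ 2) ^+ 2.
Let V t := (P (dist_axis a t) c - E (dist_axis a t) c) / (a ^+ 2 + t ^+ 2).

Let c_E : continuous (fun t => E (dist_axis a t) c).
Proof. by case: C2E => ce *; apply: (ct_comp2 ce); [exact: c_r|exact: ct_cst]. Qed.
Let c_Ex : continuous (fun t => Ex (dist_axis a t) c).
Proof. by case: C2E => _ ce *; apply: (ct_comp2 ce); [exact: c_r|exact: ct_cst]. Qed.
Let c_P : continuous (fun t => P (dist_axis a t) c).
Proof. by case: C2P => ce *; apply: (ct_comp2 ce); [exact: c_r|exact: ct_cst]. Qed.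
Let c_Px : continuous (fun t => Px (dist_axis a t) c).
Proof. by case: C2P => _ ce *; apply: (ct_comp2 ce); [exact: c_r|exact: ct_cst]. Qed.

Let c_V : continuous V.
Proof. apply: ctM => //; apply: ctD => //; exact: ctN. Qed.

Let c_Vr : continuous Vr.
Proof.
rewrite /Vr; apply: ctD.
  by apply: ctM => //; apply: ctM => //; apply: ctD => //; exact: ctN.
apply: ctN; apply: ctM.
  by apply: ctM; [exact: ct_cst|apply: ctD => //; exact: ctN].
rewrite (_ : (fun _ => _) = (fun t => (a ^+ 2 + t ^+ 2)^-1 ^+ 2)); first exact: ctX.
by apply/funext => t; rewrite exprVn.
Qed.

Local Notation e := (E a c). Local Notation ex := (Ex a c). Local Notation ez := (Ez a c).
Local Notation p := (P a c). Local Notation px := (Px a c). Local Notation pz := (Pz a c).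
Local Notation exx := (Exx a c). Local Notation ezz := (Ezz a c).
Local Notation pxx := (Pxx a c). Local Notation pzz := (Pzz a c).

Let V0 : V 0 = (p - e) / a ^+ 2.
Proof. by rewrite /V dist_axis0 // expr0n addr0. Qed.
Let Vr0 : Vr 0 = (px - ex) / a / a ^+ 2 - 2 * (p - e) / (a ^+ 2) ^+ 2.
Proof. by rewrite /Vr dist_axis0 // expr0n addr0. Qed.

Lemma jet2_zero m i j l : (nat_of_ord j == 2%N) != (nat_of_ord l == 2%N) ->
  jet2 m i j l = 0.
Proof.
move=> jl.
have z0 k' x' : dflat k' (E x' c) (Ex x' c) (Ez x' c) (P x' c) (Px x' c) (Pz x' c) x' j l = 0.
  by move: k' j l jl; do 3!apply: ord3P.
have z2 k' z' : dflat k' (E a z') (Ex a z') (Ez a z') (P a z') (Px a z') (Pz a z') a j l = 0.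
  by move: k' j l jl {z0}; do 3!apply: ord3P.
have z1 k' t : dgform_at E Ex Ez P Px Pz k' a t c j l = 0.
  by move: k' j l jl {z0 z2}; do 3!apply: ord3P.
move: m; apply: ord3P.
- by apply: jet2_0; under eq_fun do rewrite z0; exact: isd_cst.
- by apply: (@jet2_1 _ _ _ (fun=> 0)) => //; [exact: ct_cst|move=> t; rewrite z1 mulr0].
- by apply: jet2_2; under eq_fun do rewrite z2; exact: isd_cst.
Qed.

Lemma jet2_values :
  [/\ [/\ jet2 o0 o0 o0 o0 = pxx, jet2 o0 o0 o1 o1 = exx & jet2 o0 o0 o2 o2 = pxx],
      [/\ jet2 o2 o2 o0 o0 = pzz, jet2 o2 o2 o1 o1 = ezz & jet2 o2 o2 o2 o2 = pzz],
      [/\ jet2 o1 o1 o0 o0 = px / a - 2 * (p - e) / a ^+ 2,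
          jet2 o1 o1 o1 o1 = ex / a + 2 * (p - e) / a ^+ 2 &
          jet2 o1 o1 o2 o2 = px / a] &
      [/\ jet2 o0 o1 o0 o1 = (px - ex) / a - (p - e) / a ^+ 2,
          jet2 o1 o0 o0 o1 = (px - ex) / a - (p - e) / a ^+ 2,
          jet2 o0 o1 o1 o0 = (px - ex) / a - (p - e) / a ^+ 2 &
          jet2 o1 o0 o1 o0 = (px - ex) / a - (p - e) / a ^+ 2]].
Proof.
case: (C2E) => _ _ _ _ _ dex dez dexx dezz; case: (C2P) => _ _ _ _ _ dpx dpz dpxx dpzz.
have quot : is_derive a 1 (fun x => (P x c - E x c) / x) ((px - ex) / a - (p - e) / a ^+ 2).
  apply: isd_eq (isd_mul (isd_add (dpx a c) (isd_opp (dex a c))) (isd_inv aN (isd_id a))) _.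
  by field.
have k1 : continuous (fun t => Vr t * a ^+ 2 + V t).
  by apply: ctD => //; apply: ctM => //; exact: ct_cst.
have k10 : Vr 0 * a ^+ 2 + V 0 = (px - ex) / a - (p - e) / a ^+ 2 by rewrite V0 Vr0; field.
split; split.
- exact: jet2_0.
- exact: jet2_0.
- exact: jet2_0.
- by apply: jet2_2; exact: (dpzz a c).
- by apply: jet2_2; exact: (dezz a c).
- by apply: jet2_2; exact: (dpzz a c).
- apply: (@jet2_1 _ _ _ (fun t => Ex (dist_axis a t) c / dist_axis a t + Vr t * a ^+ 2)) => //.
    by apply: ctD; [exact: ctM|apply: ctM => //; exact: ct_cst].
  by rewrite Vr0 dist_axis0 //; field.
- apply: (@jet2_1 _ _ _ (fun t => Ex (dist_axis a t) c / dist_axis a t + Vr t * t ^+ 2 + 2 * V t)) => //.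
    apply: ctD; last by apply: ctM => //; exact: ct_cst.
    by apply: ctD; [exact: ctM|apply: ctM => //; cts].
  by rewrite V0 Vr0 dist_axis0 //; field.
- apply: (@jet2_1 _ _ _ (fun t => Px (dist_axis a t) c / dist_axis a t)) => //.
    exact: ctM.
  by rewrite dist_axis0.
- exact: jet2_0.
- exact: jet2_1 k1 k10 _.
- exact: jet2_0.
- exact: jet2_1 k1 k10 _.
Qed.

End ScalarCurvatureFormula.

Section ScalarCurvatureValue.
Context {R : realType}.
Implicit Types (x y z t : R).
Context (gm : 'rV[R]_3 -> 'M[R]_3).
Context (sm : forall i j, smooth_on setT (fun p => gm p i j)).
Context (E Ex Ez Exx Ezz P Px Pz Pxx Pzz : R -> R -> R).
Context (C2E : plane_C2 E Ex Ez Exx Ezz) (C2P : plane_C2 P Px Pz Pxx Pzz).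
Context (E0 : forall x z : R, 0 < E x z) (P0 : forall x z : R, 0 < P x z).
Context (gmE : forall x y z i j, 0 < x ^+ 2 + y ^+ 2 -> gm (pt x y z) i j = gform_at E P x y z i j).
Context (a c : R) (a0 : 0 < a).

Let iE x z := (E x z)^-1.
Let iP x z := (P x z)^-1.
Let iEx x z := - Ex x z / E x z ^+ 2.
Let iEz x z := - Ez x z / E x z ^+ 2.
Let iPx x z := - Px x z / P x z ^+ 2.
Let iPz x z := - Pz x z / P x z ^+ 2.

Let aN : a != 0. Proof. by rewrite gt_eqF. Qed.
Let eN : E a c != 0. Proof. by rewrite gt_eqF. Qed.
Let pN : P a c != 0. Proof. by rewrite gt_eqF. Qed.
Let s0 : 0 < a ^+ 2 + 0 ^+ 2. Proof. by rewrite expr0n addr0 exprn_gt0. Qed.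

(** The inverse is again a [gform], with profiles [iE] and [iP], so the derivative formulas of the
    metric apply to it. *)
Lemma is_derive_invmx m k l :
  is_derive (pt a 0 c) (delta_mx 0 m) (fun q => invmx (gm q) k l)
    (dflat m (iE a c) (iEx a c) (iEz a c) (iP a c) (iPx a c) (iPz a c) a k l).
Proof.
case: (C2E) => _ _ _ _ _ dex dez _ _; case: (C2P) => _ _ _ _ _ dpx dpz _ _.
have dEx x z : 0 < x -> is_derive x 1 (iE ^~ z) (iEx x z).
  by move=> _; apply: isd_inv; rewrite gt_eqF.
have dEz x z : 0 < x -> is_derive z 1 (iE x) (iEz x z).
  by move=> _; apply: isd_inv; rewrite gt_eqF.
have dPx x z : 0 < x -> is_derive x 1 (iP ^~ z) (iPx x z).
  by move=> _; apply: isd_inv; rewrite gt_eqF.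
have dPz x z : 0 < x -> is_derive z 1 (iP x) (iPz x z).
  by move=> _; apply: isd_inv; rewrite gt_eqF.
have fl := @dgform_at_flat R iE iEx iEz iP iPx iPz m a c k l a0.
rewrite -fl; move: m {fl}; apply: ord3P.
- apply/is_derive_line0; apply: isd_ext (is_derive_gform0 iEz iPz dEx dPx c k l s0).
  near=> t; rewrite (invmx_gform E0 P0 gmE) //; near: t; exact: near_sqr_sum.
- apply/is_derive_line1; apply: isd_ext (is_derive_gform1 iEz iPz dEx dPx c k l s0).
  near=> t; rewrite (invmx_gform E0 P0 gmE) // addrC; near: t; apply: near_sqr_sum; by rewrite addrC.
- apply/is_derive_line2; apply: isd_ext (is_derive_gform2 iEx iPx dEz dPz c k l s0).
  by near=> t; rewrite (invmx_gform E0 P0 gmE).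
Unshelve. all: by end_near. Qed.

Definition inv_diag (k : 'I_3) : R := if nat_of_ord k == 1%N then (E a c)^-1 else (P a c)^-1.

Lemma invmx_diag k l : invmx (gm (pt a 0 c)) k l = if k == l then inv_diag k else 0.
Proof.
rewrite (invmx_gform E0 P0 gmE) // /gform_at dist_axis0 // /inv_diag.
by move: k l; apply: ord3P; apply: ord3P; rewrite /gform /= //; field; rewrite ?aN ?eN ?pN.
Qed.

Lemma christoffel_diag k i j : christoffel gm k i j (pt a 0 c) =
  let d m i j := dflat m (E a c) (Ex a c) (Ez a c) (P a c) (Px a c) (Pz a c) a i j in
  2^-1 * (inv_diag k * (d i j k + d j i k - d k i j)).
Proof.
rewrite /christoffel sum3 !invmx_diag !(pd_flat C2E C2P gmE) //.
by congr (_ * _); move: k; apply: ord3P; rewrite /= !mul0r ?addr0 ?add0r.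
Qed.

(** With [E = e^(-2 u)] and [P = e^(2 l)] the right-hand side is
    [2 (2 u_x / a - |grad u|^2 - lap (l - u))] with the flat Laplacian of the plane; multiplying by
    [P] removes the conformal factor. *)
Lemma scalar_curvature_gform : P a c * scalar_curvature gm (pt a 0 c) =
  (Px a c ^+ 2 + Pz a c ^+ 2) / P a c ^+ 2 - (Pxx a c + Pzz a c) / P a c
  + (Ex a c ^+ 2 + Ez a c ^+ 2) / (2 * E a c ^+ 2) - (Exx a c + Ezz a c) / E a c
  - 2 * Ex a c / (a * E a c).
Proof.
have [[v1 v2 v3] [v4 v5 v6] [v7 v8 v9] [w1 w2 w3 w4]] := jet2_values C2E C2P gmE c a0.
have dch m k i j : pd m (christoffel gm k i j) (pt a 0 c) =
    2^-1 * \sum_l (dflat m (iE a c) (iEx a c) (iEz a c) (iP a c) (iPx a c) (iPz a c) a k l *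
      (dflat i (E a c) (Ex a c) (Ez a c) (P a c) (Px a c) (Pz a c) a j l +
       dflat j (E a c) (Ex a c) (Ez a c) (P a c) (Px a c) (Pz a c) a i l -
       dflat l (E a c) (Ex a c) (Ez a c) (P a c) (Px a c) (Pz a c) a i j) +
      (if k == l then inv_diag k else 0) * (jet2 gm a c m i j l + jet2 gm a c m j i l - jet2 gm a c m l i j)).
  rewrite (pd_christoffel sm i j (is_derive_invmx m k)).
  congr (_ * _); apply: eq_bigr => l _.
  by rewrite invmx_diag !(pd_flat C2E C2P gmE).
have vz := jet2_zero C2E C2P gmE c a0.
have diag (ric : 'I_3 -> 'I_3 -> R) :
    \sum_j \sum_k (if j == k then inv_diag j else 0) * ric j k =
    inv_diag o0 * ric o0 o0 + inv_diag o1 * ric o1 o1 + inv_diag o2 * ric o2 o2.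
  by rewrite !sum3 /= !mul0r !addr0 !add0r.
transitivity (P a c * (\sum_j \sum_k (if j == k then inv_diag j else 0) * ricci gm j k (pt a 0 c))).
  by congr (_ * _); apply: eq_bigr => j _; apply: eq_bigr => k _; rewrite invmx_diag.
rewrite diag.
pose e := E a c; pose ex := Ex a c; pose ez := Ez a c.
pose p := P a c; pose px := Px a c; pose pz := Pz a c.
pose d := fun m i j => dflat m e ex ez p px pz a i j.
pose dG := fun m i j => dflat m (iE a c) (iEx a c) (iEz a c) (iP a c) (iPx a c) (iPz a c) a i j.
pose J := jet2 gm a c.
pose Gam k i j := 2^-1 * (inv_diag k * (d i j k + d j i k - d k i j)).
pose dGam m k i j := 2^-1 * \sum_l (dG m k l * (d i j l + d j i l - d l i j) +
      (if k == l then inv_diag k else 0) * (J m i j l + J m j i l - J m l i j)).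
have ricE j k : ricci gm j k (pt a 0 c) = \sum_i (dGam i i j k - dGam k i i j
    + \sum_l (Gam i i l * Gam l j k - Gam i k l * Gam l i j)).
  rewrite /ricci; apply: eq_bigr => i _; rewrite !dch; congr (_ + _).
  by apply: eq_bigr => l _; rewrite !christoffel_diag.
rewrite !ricE; move: vz v1 v2 v3 v4 v5 v6 v7 v8 v9 w1 w2 w3 w4; rewrite -/J.
(* [J] becomes a variable, so that [field] meets only atoms once the second derivatives are replaced
   by their values. *)
move: J @dGam @Gam {ricE dch} => J dGam Gam vz v1 v2 v3 v4 v5 v6 v7 v8 v9 w1 w2 w3 w4.
rewrite !sum3 /dGam !sum3 /Gam /dG /d /dflat /=.
have [z1 z2 z3 z4] : [/\ J o0 o2 o0 o2 = 0, J o0 o2 o2 o0 = 0, J o2 o0 o0 o2 = 0 & J o2 o0 o2 o0 = 0].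
  by split; apply: vz.
have [z5 z6 z7 z8] : [/\ J o1 o2 o1 o2 = 0, J o1 o2 o2 o1 = 0, J o2 o1 o1 o2 = 0 & J o2 o1 o2 o1 = 0].
  by split; apply: vz.
rewrite ?v1 ?v2 ?v3 ?v4 ?v5 ?v6 ?v7 ?v8 ?v9 ?w1 ?w2 ?w3 ?w4 ?z1 ?z2 ?z3 ?z4 ?z5 ?z6 ?z7 ?z8.
rewrite /inv_diag /= /iEx /iEz /iPx /iPz /iE /iP -/e -/ex -/ez -/p -/px -/pz.
have eN' : e != 0 := eN; have pN' : p != 0 := pN.
field.
by rewrite aN eN' pN'.
Qed.

End ScalarCurvatureValue.

(** * Profiles of a metric: axis condition, differential inequality, monotonicity and decay *)

Lemma continuous_le_at0 (R : realType) (f h : R -> R) : continuous f -> continuous h ->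
  (forall x, 0 < x -> f x <= h x) -> f 0 <= h 0.
Proof.
move=> cf ch fh; rewrite leNgt; apply/negP => hf.
have cd : continuous (fun x => f x - h x) by cts.
have d0 : 0 < f 0 - h 0 by rewrite subr_gt0.
have /nbhs_ballP[e /= e0 be] := cd 0 _ (lt_nbhsr d0).
have := be (e / 2); rewrite /ball /= sub0r normrN gtr0_norm ?divr_gt0 //.
have e2 : e / 2 < e by lra.
by move=> /(_ e2); rewrite subr_gt0 ltNge fh // divr_gt0.
Qed.

Section PlaneLines.
Context {R : realType}.
Implicit Types (x z : R) (f : 'rV[R]_2 -> R).

Lemma rzq_shift0 x z t : t *: delta_mx 0 0 + rzq x z = rzq (t *: 1 + x) z.
Proof.
by apply/rowP => i; rewrite !mxE; case: (unliftP 0 i) => [j|] ->;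
  rewrite ?(ord1 j) /= ?mulr0 ?add0r.
Qed.

Lemma rzq_shift1 x z t : t *: delta_mx 0 1 + rzq x z = rzq x (t *: 1 + z).
Proof.
by apply/rowP => i; rewrite !mxE; case: (unliftP 0 i) => [j|] ->;
  rewrite ?(ord1 j) /= ?mulr0 ?add0r.
Qed.

Lemma pd_rzq0 f x z d : is_derive x 1 (fun t => f (rzq t z)) d -> pd 0 f (rzq x z) = d.
Proof.
have E : (fun h : R => h^-1 *: ((f \o shift (rzq x z)) (h *: delta_mx 0 0) - f (rzq x z))) =
    (fun h => h^-1 *: (((fun t => f (rzq t z)) \o shift x) (h *: 1) - f (rzq x z))).
  by apply/funext => h; rewrite /= rzq_shift0.
by move=> [_ <-]; rewrite /pd /derive E.
Qed.

Lemma pd_rzq1 f x z d : is_derive z 1 (fun t => f (rzq x t)) d -> pd 1 f (rzq x z) = d.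
Proof.
have E : (fun h : R => h^-1 *: ((f \o shift (rzq x z)) (h *: delta_mx 0 1) - f (rzq x z))) =
    (fun h => h^-1 *: (((fun t => f (rzq x t)) \o shift z) (h *: 1) - f (rzq x z))).
  by apply/funext => h; rewrite /= rzq_shift1.
by move=> [_ <-]; rewrite /pd /derive E.
Qed.

Lemma enorm_rzq x z : enorm (rzq x z) = Num.sqrt (x ^+ 2 + z ^+ 2).
Proof. by rewrite /enorm !big_ord_recl big_ord0 !mxE /= addr0. Qed.

Lemma half_plane_rzq x z : 0 < x -> half_plane (rzq x z).
Proof. by rewrite /half_plane /= mxE. Qed.

End PlaneLines.

Section AxisymmetricData.
Context {R : realType}.
Implicit Types (x y z t : R).

Section OneMetric.
Context (g : axisym_metric R).

(* [pu] is [u] and [pl] is [alpha - u], extended smoothly across the axis. *)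
Definition pu x z := - 2^-1 * ln (prof_E g x z).
Definition pux x z := - 2^-1 * (prof_dE g [:: o1] x z / prof_E g x z).
Definition puz x z := - 2^-1 * (prof_dE g [:: o2] x z / prof_E g x z).
Definition puxx x z := - 2^-1 * (prof_dE g [:: o1; o1] x z / prof_E g x z
  - (prof_dE g [:: o1] x z / prof_E g x z) ^+ 2).
Definition puzz x z := - 2^-1 * (prof_dE g [:: o2; o2] x z / prof_E g x z
  - (prof_dE g [:: o2] x z / prof_E g x z) ^+ 2).

Definition pl x z := 2^-1 * ln (prof_P g x z).
Definition plx x z := 2^-1 * (prof_dP g [:: o0] x z / prof_P g x z).
Definition plz x z := 2^-1 * (prof_dP g [:: o2] x z / prof_P g x z).
Definition plxx x z := 2^-1 * (prof_dP g [:: o0; o0] x z / prof_P g x z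
  - (prof_dP g [:: o0] x z / prof_P g x z) ^+ 2).
Definition plzz x z := 2^-1 * (prof_dP g [:: o2; o2] x z / prof_P g x z
  - (prof_dP g [:: o2] x z / prof_P g x z) ^+ 2).

Lemma plane_C2_pu : plane_C2 pu pux puz puxx puzz.
Proof. by apply: plane_C2_ln (plane_C2_prof_E g) => x z; exact: prof_E_gt0. Qed.

Lemma plane_C2_pl : plane_C2 pl plx plz plxx plzz.
Proof. by apply: plane_C2_ln (plane_C2_prof_P g) => x z; exact: prof_P_gt0. Qed.

Lemma prof_E_exp x z : prof_E g x z = expR (- 2 * pu x z).
Proof.
have k : - 2 * - 2^-1 = 1 :> R by field.
by rewrite /pu mulrA k mul1r lnK // posrE prof_E_gt0.
Qed.

Lemma prof_P_exp x z : prof_P g x z = expR (2 * pl x z).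
Proof.
by rewrite /pl mulrA mulfV ?pnatr_eq0 // mul1r lnK // posrE prof_P_gt0.
Qed.

Context (AB : forall q, half_plane q -> coef_A g q = 0 /\ coef_B g q = 0).

Lemma coef_u_pu x z : 0 < x -> coef_u g (rzq x z) = pu x z.
Proof.
move=> x0; have := prof_E_coef AB z x0; rewrite prof_E_exp => /expR_inj; lra.
Qed.

Lemma coef_alpha_pl x z : 0 < x -> coef_alpha g (rzq x z) = pl x z + pu x z.
Proof.
move=> x0; have := prof_P_coef AB z x0; rewrite prof_P_exp => /expR_inj.
by rewrite coef_u_pu //; lra.
Qed.

(** There is no conical singularity: on the axis the [dx dx] component is [prof_E] by definition,
    and it is also the limit of [prof_P], being the radial component at [(x, 0, z)]. So [alpha]
    vanishes there, which removes the axis term from the flux identity. *)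
Lemma prof_axis z : pl 0 z + pu 0 z = 0.
Proof.
have eq0 : prof_P g 0 z = prof_E g 0 z.
  have [sm _ _] := metric_riemannian g.
  have cm : continuous (fun x => metric g (pt x 0 z) o0 o0).
    move=> x; apply: (@continuous_comp _ _ _ (fun x => pt x 0 z) (pds [::] (fun p => metric g p o0 o0))).
      by apply: continuous_pt; [exact: ct_id|exact: ct_cst|exact: ct_cst].
    exact: smooth_continuous (sm o0 o0) _.
  have cP : continuous (prof_P g ^~ z) by apply: continuous2_l; case: (plane_C2_prof_P g).
  have h x : 0 < x -> prof_P g x z = metric g (pt x 0 z) o0 o0.
    move=> x0; have s0 : 0 < x ^+ 2 + 0 ^+ 2 by rewrite expr0n addr0 exprn_gt0.
    rewrite (metric_prof AB) // /gform /= expr0n /= addr0 sqrtr_sqr gtr0_norm //.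
    by field; rewrite gt_eqF.
  apply/eqP; rewrite eq_le; apply/andP; split.
    by apply: (continuous_le_at0 cP cm) => x x0; rewrite h.
  by apply: (continuous_le_at0 cm cP) => x x0; rewrite h.
have := prof_E_exp 0 z; rewrite -eq0 prof_P_exp => /expR_inj; lra.
Qed.

Lemma metric_gform_at x y z i j : 0 < x ^+ 2 + y ^+ 2 ->
  metric g (pt x y z) i j = gform_at (prof_E g) (prof_P g) x y z i j.
Proof. by move=> s0; rewrite (metric_prof AB). Qed.

(** This is half of [P] times the scalar curvature, rewritten in [u] and [l]. *)
Lemma pde_of_scalar_curvature (scal : forall p, 0 <= scalar_curvature g p) x z : 0 < x ->
  (plxx x z - puxx x z) + (plzz x z - puzz x z) <=
  2 * pux x z / x - (pux x z ^+ 2 + puz x z ^+ 2).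
Proof.
move=> x0; have [sm _ _] := metric_riemannian g.
have := scalar_curvature_gform sm (plane_C2_prof_E g) (plane_C2_prof_P g)
  (@prof_E_gt0 R g) (@prof_P_gt0 R g) metric_gform_at z x0.
have R0 : 0 <= prof_P g x z * scalar_curvature g (pt x 0 z).
  by rewrite mulr_ge0 // ltW // prof_P_gt0.
move=> hR; move: R0; rewrite hR.
have eN : prof_E g x z != 0 by rewrite gt_eqF // prof_E_gt0.
have pN : prof_P g x z != 0 by rewrite gt_eqF // prof_P_gt0.
have xN : x != 0 by rewrite gt_eqF.
rewrite -subr_ge0 => h; rewrite -subr_ge0.
rewrite [X in 0 <= X](_ : _ = 2^-1 * ((prof_dP g [:: o0] x z ^+ 2 + prof_dP g [:: o2] x z ^+ 2) / prof_P g x z ^+ 2 -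
  (prof_dP g [:: o0; o0] x z + prof_dP g [:: o2; o2] x z) / prof_P g x z +
  (prof_dE g [:: o1] x z ^+ 2 + prof_dE g [:: o2] x z ^+ 2) / (2 * prof_E g x z ^+ 2) -
  (prof_dE g [:: o1; o1] x z + prof_dE g [:: o2; o2] x z) / prof_E g x z -
  2 * prof_dE g [:: o1] x z / (x * prof_E g x z))).
  by rewrite mulr_ge0 // -[X in 0 <= X]subr0.
rewrite /plxx /puxx /plzz /puzz /pux /puz.
move: (prof_E g x z) (prof_P g x z) (prof_dE g [:: o1] x z) (prof_dE g [:: o2] x z)
  (prof_dP g [:: o0] x z) (prof_dP g [:: o2] x z) (prof_dE g [:: o1; o1] x z)
  (prof_dE g [:: o2; o2] x z) (prof_dP g [:: o0; o0] x z) (prof_dP g [:: o2; o2] x z)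
  eN pN {hR h} => e p ex ez px pz exx ezz pxx pzz eN pN.
by field; rewrite xN eN pN.
Qed.

End OneMetric.
End AxisymmetricData.

(** The uniform condition for a single metric; [C] stays outside, since [delta] may depend on it but
    not on the metric. *)
Definition coef_decay {R : realType} (g : axisym_metric R) (R0 C : R) : Prop :=
  forall (q : 'rV[R]_2) (I : seq 'I_2),
    half_plane q -> R0 <= enorm q -> (size I <= 2)%N ->
    [/\ `|pds I (coef_u g) q| <= C / enorm q ^+ (1 + size I),
        `|pds I (coef_alpha g) q| <= C / enorm q ^+ (1 + size I),
        `|pds I (coef_A g) q| <= C / enorm q ^+ (1 + size I) &
        `|pds I (coef_B g) q| <= C / enorm q ^+ (1 + size I)].

Section MonotoneAndDecay.
Context {R : realType} (g : axisym_metric R).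
Implicit Types (x y z t : R).
Context (AB : forall q, half_plane q -> coef_A g q = 0 /\ coef_B g q = 0).

Lemma sqrt_expR (s : R) : Num.sqrt (expR (2 * s)) = expR s.
Proof.
rewrite -[2]/(2%:R) expRM_natl -[RHS]ger0_norm ?expR_ge0 //.
by rewrite -sqrtr_sqr.
Qed.

Let gE x y z i j : 0 < x ^+ 2 + y ^+ 2 ->
  metric g (pt x y z) i j = gform_at (prof_E g) (prof_P g) x y z i j.
Proof. exact: metric_gform_at. Qed.

Lemma metric_flat x z i j : 0 < x -> metric g (pt x 0 z) i j =
  if i == j then (if nat_of_ord i == 1%N then prof_E g x z else prof_P g x z) else 0.
Proof.
move=> x0; rewrite gE ?expr0n ?addr0 ?exprn_gt0 // /gform_at dist_axis0 //.
have xN : x != 0 by rewrite gt_eqF.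
by move: i j; apply: ord3P; apply: ord3P; rewrite /gform /= //; field; rewrite ?xN.
Qed.

Lemma gnorm_flat x z (v : 'rV[R]_3) : 0 < x -> Defs.gnorm g (pt x 0 z) v =
  Num.sqrt (prof_P g x z * v 0 o0 ^+ 2 + prof_E g x z * v 0 o1 ^+ 2 + prof_P g x z * v 0 o2 ^+ 2).
Proof.
move=> x0; rewrite /Defs.gnorm; congr Num.sqrt.
rewrite !mxE sum3 !mxE !sum3 !metric_flat //=; ring.
Qed.

Lemma gnorm_eta x z : 0 < x -> Defs.gnorm g (pt x 0 z) (eta (pt x 0 z)) = x * expR (- pu g x z).
Proof.
move=> x0; rewrite gnorm_flat // /eta !mxE xco_pt yco_pt /= prof_E_exp.
rewrite oppr0 expr0n /= !mulr0 addr0 add0r mulrC sqrtrM ?sqr_ge0 // sqrtr_sqr gtr0_norm //.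
by rewrite mulNr -mulrN sqrt_expR.
Qed.

Lemma gnorm_gradient_rho x z : 0 < x ->
  Defs.gnorm g (pt x 0 z) (gradient g rho (pt x 0 z)) = expR (- pl g x z).
Proof.
move=> x0; have s0 : 0 < x ^+ 2 + 0 ^+ 2 by rewrite expr0n addr0 exprn_gt0.
have s0' : 0 < (0 : R) ^+ 2 + x ^+ 2 by rewrite addrC.
have r0 : pd o0 rho (pt x 0 z) = 1.
  apply: pd0E; under eq_fun do rewrite rho_pt.
  apply: isd_eq (is_derive_dist_axis s0) _.
  by rewrite dist_axis0 // divff // gt_eqF.
have r1 : pd o1 rho (pt x 0 z) = 0.
  apply: pd1E; under eq_fun do rewrite rho_pt addrC.
  by apply: isd_eq (is_derive_dist_axis s0') _; rewrite mul0r.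
have r2 : pd o2 rho (pt x 0 z) = 0.
  by apply: pd2E; under eq_fun do rewrite rho_pt; exact: isd_cst.
have [sm _ _] := metric_riemannian g.
have inv k l : invmx (g (pt x 0 z)) k l = if k == l then inv_diag (prof_E g) (prof_P g) x z k else 0.
  by apply: invmx_diag => //; [exact: prof_E_gt0|exact: prof_P_gt0].
rewrite gnorm_flat // /gradient /differential !mxE !sum3 !mxE r0 r1 r2 !inv /= /inv_diag /=.
rewrite !(mul0r, mulr0, mul1r, addr0) expr0n /= !mulr0 !addr0.
have pN : prof_P g x z != 0 by rewrite gt_eqF // prof_P_gt0.
rewrite (_ : _ * _ = (prof_P g x z)^-1); last by field.
by rewrite prof_P_exp -expRN -mulrN sqrt_expR.
Qed.

(** [|eta| = x e^(-u)] and [|grad rho| = e^(-l)], so the differentiated quantity is [e^(l - u)] and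
    its derivative has the sign of [w_x]. *)
Lemma radial_monotone_profile r0 z : 0 < r0 ->
  (forall p, rho p = r0 -> 'D_(partial_rho p) (fun q => (rho q)^-1 *
     (Defs.gnorm g q (eta q) / Defs.gnorm g q (gradient g rho q))) p <= 0) ->
  plx g r0 z - pux g r0 z <= 0.
Proof.
move=> r00 /(_ (pt r0 0 z)).
have hr : rho (pt r0 0 z) = r0 by rewrite rho_pt expr0n addr0 sqrtr_sqr gtr0_norm.
move=> /(_ hr).
have -> : partial_rho (pt r0 0 z) = delta_mx 0 o0.
  apply/rowP; apply: ord3P; rewrite !mxE /= ?hr ?xco_pt ?yco_pt ?mul0r //.
  by rewrite divff // gt_eqF.
set F := (fun q => _).
have [_ _ _ _ _ du _ _ _] := plane_C2_pu g; have [_ _ _ _ _ dl _ _ _] := plane_C2_pl g.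
have d : is_derive (pt r0 0 z) (delta_mx 0 o0) F
    (expR (pl g r0 z - pu g r0 z) * (plx g r0 z - pux g r0 z)).
  apply/is_derive_line0.
  have dw := isd_add (dl r0 z) (isd_opp (du r0 z)).
  have de := is_derive_expR (pl g r0 z - pu g r0 z).
  apply: isd_ext (@isd_comp _ expR (fun t => pl g t z - pu g t z) _ _ _ de dw).
  near=> t.
  have t0 : 0 < t by near: t; exact: lt_nbhsr.
  rewrite /F gnorm_eta // gnorm_gradient_rho // rho_pt expr0n addr0 sqrtr_sqr gtr0_norm //.
  by rewrite [expR (- pl g t z)]expRN invrK -[t * _ * _]mulrA mulKf ?gt_eqF // -expRD addrC.
case: d => _ ->; rewrite pmulr_rle0 //; exact: expR_gt0.
Unshelve. all: by end_near. Qed.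

Context (R0 C : R).
Context (af : coef_decay g R0 C).

(** Off the axis the bounds are those of the coefficients ([pos]); continuity of the profiles
    extends them to the axis. Here [dist_axis x z] is the distance to the origin in the
    half-plane. *)
Lemma profile_decay x z : 0 <= x -> 0 < dist_axis x z -> R0 <= dist_axis x z ->
  let n := dist_axis x z in
  [/\ `|pu g x z| <= C / n, `|pl g x z + pu g x z| <= C / n,
      `|pux g x z| <= C / n ^+ 2, `|plx g x z + pux g x z| <= C / n ^+ 2 &
      `|puz g x z| <= C / n ^+ 2 /\ `|plz g x z + puz g x z| <= C / n ^+ 2].
Proof.
have [cu cux cuz _ _ du ez _ _] := plane_C2_pu g.
have [cl clx clz _ _ dl fz _ _] := plane_C2_pl g.
have pos t : 0 < t -> R0 <= dist_axis t z ->
  let n := dist_axis t z in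
  [/\ `|pu g t z| <= C / n, `|pl g t z + pu g t z| <= C / n,
      `|pux g t z| <= C / n ^+ 2, `|plx g t z + pux g t z| <= C / n ^+ 2 &
      `|puz g t z| <= C / n ^+ 2 /\ `|plz g t z + puz g t z| <= C / n ^+ 2].
  move=> t0 rt n; have hp := half_plane_rzq z t0.
  have en : enorm (rzq t z) = n by rewrite enorm_rzq.
  have ru : R0 <= enorm (rzq t z) by rewrite en.
  have [] := af (I := [::]) hp ru isT; have [] := af (I := [:: 0]) hp ru isT.
  have [] := af (I := [:: 1]) hp ru isT; rewrite en /= !addn0 expr1.
  have lin0 (f : R -> R) (F : 'rV[R]_2 -> R) d : (forall x, 0 < x -> F (rzq x z) = f x) ->
    is_derive t 1 f d -> pd 0 F (rzq t z) = d.
    move=> Ff fd; apply: pd_rzq0; apply: isd_ext fd; near=> s; rewrite Ff //.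
    near: s; exact: lt_nbhsr.
  have lin1 (f : R -> R) (F : 'rV[R]_2 -> R) d : (forall z, F (rzq t z) = f z) ->
    is_derive z 1 f d -> pd 1 F (rzq t z) = d.
    by move=> Ff fd; apply: pd_rzq1; apply: isd_ext fd; near=> s; rewrite Ff.
  rewrite (lin1 (pu g t) _ _ _ (ez t z)); last by move=> s; exact: coef_u_pu.
  rewrite (lin1 (fun s => pl g t s + pu g t s) _ _ _ (isd_add (fz t z) (ez t z))); last by move=> s; exact: coef_alpha_pl.
  rewrite (lin0 (pu g ^~ z) _ _ _ (du t z)); last by move=> s; exact: coef_u_pu.
  rewrite (lin0 (fun s => pl g s z + pu g s z) _ _ _ (isd_add (dl t z) (du t z))); last by move=> s; exact: coef_alpha_pl.
  rewrite (coef_u_pu AB z t0) (coef_alpha_pl AB z t0).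
  move=> z1 z2 _ _ x1 x2 _ _ u1 u2 _ _.
  split; [exact: u1|exact: u2|exact: x1|exact: x2|split; [exact: z1|exact: z2]].
rewrite le_eqVlt => /predU1P[<-|x0]; last by move=> _; exact: pos.
move=> n0 Rn n.
have z2 : 0 < z ^+ 2 by move: n0; rewrite sqrtr_gt0 expr0n add0r.
have nN t : dist_axis t z != 0 by rewrite gt_eqF // sqrtr_gt0 ltr_wpDl ?sqr_ge0.
have cn : continuous (dist_axis ^~ z) by rewrite /dist_axis; cts.
have cV : continuous (fun t => (dist_axis t z)^-1) by exact: ctV.
have cV2 : continuous (fun t => (dist_axis t z ^+ 2)^-1).
  by apply: ctV; [move=> t; rewrite expf_neq0|exact: ctX].
(* Leaving the axis at fixed [z] does not decrease the distance to the origin, so the approximating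
   points are in the decay region. *)
have Rt t : R0 <= dist_axis t z.
  apply: le_trans Rn _; rewrite ler_wsqrtr // expr0n add0r lerDr; exact: sqr_ge0.
have cs h : continuous2 h -> continuous (fun t => `|h t z|).
  by move=> ch; apply: ct_norm; exact: continuous2_l.
have csD h k : continuous2 h -> continuous2 k -> continuous (fun t => `|h t z + k t z|).
  by move=> ch ck; apply: ct_norm; apply: ctD; exact: continuous2_l.
have l1 f : continuous f -> (forall t, 0 < t -> f t <= C / dist_axis t z) -> f 0 <= C / n.
  move=> cf ff; apply: (@continuous_le_at0 _ f (fun t => C / dist_axis t z) cf _ ff).
  by apply: ctM => //; exact: ct_cst.
have l2 f : continuous f -> (forall t, 0 < t -> f t <= C / dist_axis t z ^+ 2) -> f 0 <= C / n ^+ 2.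
  move=> cf ff; apply: (@continuous_le_at0 _ f (fun t => C / dist_axis t z ^+ 2) cf _ ff).
  by apply: ctM => //; exact: ct_cst.
split; last split.
- by apply: (l1 _ (cs _ cu)) => t t0; have [] := pos t t0 (Rt t).
- by apply: (l1 _ (csD _ _ cl cu)) => t t0; have [] := pos t t0 (Rt t).
- by apply: (l2 _ (cs _ cux)) => t t0; have [] := pos t t0 (Rt t).
- by apply: (l2 _ (csD _ _ clx cux)) => t t0; have [] := pos t t0 (Rt t).
- by apply: (l2 _ (cs _ cuz)) => t t0; have [_ _ _ _ []] := pos t t0 (Rt t).
- by apply: (l2 _ (csD _ _ clz cuz)) => t t0; have [_ _ _ _ []] := pos t t0 (Rt t).
Unshelve. all: by end_near. Qed.

End MonotoneAndDecay.

(** * The ADM mass as a limit of fluxes *)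

Section ADMFlux.
Context {R : realType} (g : axisym_metric R).
Implicit Types (x y z t r : R).
Context (AB : forall q, half_plane q -> coef_A g q = 0 /\ coef_B g q = 0).

Let E := prof_E g. Let P := prof_P g.
Let Ex := prof_dE g [:: o1]. Let Ez := prof_dE g [:: o2].
Let Px := prof_dP g [:: o0]. Let Pz := prof_dP g [:: o2].

(** The integrand of the ADM flux at polar angle [t]; by rotational symmetry it does not depend on
    [phi]. *)
Definition flux_density r t : R :=
  let x := r * sin t in let z := r * cos t in
  (P x z - E x z) * (r * sin t)
  - ((Ex x z + Px x z) * sin t + (Ez x z + Pz x z) * cos t) * (r ^+ 2 * sin t).

Lemma flux_integrand r t phi : 0 < r -> 0 <= sin t ->
  (\sum_i \sum_j
    (pd j (fun q => metric g q i j) (r *: sphere_normal t phi)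
     - pd i (fun q => metric g q j j) (r *: sphere_normal t phi))
    * sphere_normal t phi 0 i) * (r ^+ 2 * sin t) = flux_density r t.
Proof.
move=> r0; rewrite le_eqVlt => /predU1P[st0|st].
  by rewrite /flux_density -st0 !mulr0 subr0.
have [sm _ _] := metric_riemannian g.
pose X := r * (sin t * cos phi); pose Y := r * (sin t * sin phi); pose z := r * cos t.
have nE : sphere_normal t phi = pt (sin t * cos phi) (sin t * sin phi) (cos t) by [].
have rn : r *: sphere_normal t phi = pt X Y z.
  by apply/rowP; apply: ord3P; rewrite !mxE.
have cs := cos2Dsin2 phi.
have sE : X ^+ 2 + Y ^+ 2 = (r * sin t) ^+ 2.
  rewrite -[RHS]mulr1 -cs /X /Y; ring.
have x0 : 0 < r * sin t by rewrite mulr_gt0.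
have s0 : 0 < X ^+ 2 + Y ^+ 2 by rewrite sE exprn_gt0.
have dE : dist_axis X Y = r * sin t by rewrite /dist_axis sE sqrtr_sqr gtr0_norm.
have pdE k i j : pd k (fun q => metric g q i j) (pt X Y z) =
    dgform k (E (r * sin t) z) (Ex (r * sin t) z) (Ez (r * sin t) z)
      (P (r * sin t) z) (Px (r * sin t) z) (Pz (r * sin t) z) (r * sin t) X Y i j.
  rewrite (pd_gform (plane_C2_prof_E g) (plane_C2_prof_P g) (metric_gform_at AB)) //.
  by rewrite /dgform_at dE.
rewrite nE in rn *; rewrite rn !sum3 !pdE !mxE /= /flux_density -/z.
move: (E _ _) (Ex _ _) (Ez _ _) (P _ _) (Px _ _) (Pz _ _) => e ex ez p px pz.
rewrite /dgform /= sE.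
have rN : r != 0 by rewrite gt_eqF.
have sN : sin t != 0 by rewrite gt_eqF.
set V := (p - e) / (r * sin t) ^+ 2.
(* The last summand contains the factor [X^2 + Y^2 - (r sin t)^2], which is 0; it is written out
   because [field] does not know this relation. *)
rewrite [LHS](_ : _ = (V - (ex + px) / (r * sin t)) * (X * (sin t * cos phi) + Y * (sin t * sin phi)) * (r ^+ 2 * sin t)
   - (ez + pz) * cos t * (r ^+ 2 * sin t) - (pz - ez) / (r * sin t) ^+ 2 * (X ^+ 2 + Y ^+ 2 - (r * sin t) ^+ 2) * cos t * (r ^+ 2 * sin t)).
  rewrite sE subrr mulr0 !mul0r subr0.
  rewrite (_ : X * _ + Y * _ = r * sin t * sin t); last first.
    rewrite -[RHS]mulr1 -cs /X /Y; ring.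
  by rewrite /V; field; rewrite rN sN.
by rewrite /V; field; rewrite rN sN.
Qed.

Lemma adm_fluxE r : 0 < r -> adm_flux g r = 2 * pi * int1 0 pi (flux_density r).
Proof.
move=> r0; rewrite /adm_flux.
have cW : continuous (flux_density r).
  have [cE cEx cEz _ _ _ _ _ _] := plane_C2_prof_E g.
  have [cP cPx cPz _ _ _ _ _ _] := plane_C2_prof_P g.
  rewrite /flux_density /E /P /Ex /Ez /Px /Pz; cts.
rewrite -int1Zl //; apply: eq_Rintegral => t; rewrite inE /= in_itv /= => t0.
transitivity (int1 0 (pi *+ 2) (fun=> flux_density r t)).
  apply: eq_Rintegral => phi _; apply: flux_integrand => //; exact: sin_ge0_pi.
rewrite int1_cst; first by rewrite subr0 mulrC mulr_natl.
by rewrite mulrn_wge0 // pi_ge0.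
Qed.

End ADMFlux.

Section ExpBounds.
Context {R : realType}.
Implicit Types t : R.

(** Only [1 + t <= e^t] is used, at [t] and at [-t]; the latter gives [e^t (1 - t) <= 1]. *)
Lemma expR_taylor1 t : `|t| <= 2^-1 -> `|expR t - 1 - t| <= 2 * t ^+ 2.
Proof.
rewrite ler_norml => /andP[t1 t2].
have h1 := expR_ge1Dx t; have h2 := expR_ge1Dx (- t).
have e0 := expR_gt0 t.
have h3 : expR t * expR (- t) = 1 by rewrite expRN mulfV // gt_eqF.
have h4 : expR t * (1 - t) <= 1 by rewrite -[leRHS]h3 ler_pM2l.
have h5 : 1 <= (1 + t + 2 * t ^+ 2) * (1 - t).
  by have := sqr_ge0 t; rewrite !expr2; nra.
have h6 : expR t <= 1 + t + 2 * t ^+ 2.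
  by rewrite -(ler_pM2r (_ : 0 < 1 - t)); [exact: le_trans h4 h5|lra].
by rewrite ler_norml; apply/andP; split; have := sqr_ge0 t; lra.
Qed.

Lemma expR_taylor0 t : `|t| <= 2^-1 -> `|expR t - 1| <= 2 * `|t|.
Proof.
move=> t1; have := expR_taylor1 t1; rewrite -(real_normK (num_real t)).
have := ler_normD (expR t - 1 - t) t; rewrite subrK.
have := normr_ge0 t; move: t1; set a := `|t| => a1 a0; nra.
Qed.

End ExpBounds.

Section MassFlux.
Context {R : realType}.
Implicit Types (x z t r : R).
Context (u ux uz uxx uzz l lx lz lxx lzz : R -> R -> R).
Context (C2u : plane_C2 u ux uz uxx uzz) (C2l : plane_C2 l lx lz lxx lzz).
Context (axis : forall z : R, l 0 z + u 0 z = 0).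
Context (pde : forall x z : R, 0 < x -> (lxx x z - uxx x z) + (lzz x z - uzz x z) <=
  2 * ux x z / x - (ux x z ^+ 2 + uz x z ^+ 2)).

(* With [alpha = l + u] and [w = l - u] (the paper's [alpha - 2 u]), the
   divergence of [(mass_x, mass_z)] dominates [2 x |grad u|^2], and its flux
   through large circles is asymptotic to that defining the ADM mass. *)
Definition mass_x x z := 2 * (l x z + u x z) - 2 * (x * (lx x z - ux x z)).
Definition mass_z x z := - (2 * (x * (lz x z - uz x z))).
Definition mass_xx x z := 4 * ux x z - 2 * (x * (lxx x z - uxx x z)).
Definition mass_zz x z := - (2 * (x * (lzz x z - uzz x z))).
Definition mass_div x z := mass_xx x z + mass_zz x z.
Definition mass_flux_density r t :=
  (mass_x (r * sin t) (r * cos t) * sin t + mass_z (r * sin t) (r * cos t) * cos t) * r.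
Definition mass_flux r := int1 0 pi (mass_flux_density r).

Let cu : continuous2 u. Proof. exact: (c2_0 C2u). Qed.
Let cux : continuous2 ux. Proof. exact: (c2_x C2u). Qed.
Let cuz : continuous2 uz. Proof. exact: (c2_z C2u). Qed.
Let cuxx : continuous2 uxx. Proof. exact: (c2_xx C2u). Qed.
Let cuzz : continuous2 uzz. Proof. exact: (c2_zz C2u). Qed.
Let cl : continuous2 l. Proof. exact: (c2_0 C2l). Qed.
Let clx : continuous2 lx. Proof. exact: (c2_x C2l). Qed.
Let clz : continuous2 lz. Proof. exact: (c2_z C2l). Qed.
Let clxx : continuous2 lxx. Proof. exact: (c2_xx C2l). Qed.
Let clzz : continuous2 lzz. Proof. exact: (c2_zz C2l). Qed.

Let cmx : continuous2 mass_x. Proof. rewrite /mass_x; cts. Qed.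
Let cmz : continuous2 mass_z. Proof. rewrite /mass_z; cts. Qed.
Let cmxx : continuous2 mass_xx. Proof. rewrite /mass_xx; cts. Qed.
Let cmzz : continuous2 mass_zz. Proof. rewrite /mass_zz; cts. Qed.
Let cdiv : continuous2 mass_div. Proof. rewrite /mass_div; cts. Qed.

Lemma mass_flux_half_disc r : 0 <= r -> mass_flux r = half_disc_integral mass_div r.
Proof.
move=> r0; have [_ _ _ _ _ du eu dux euz] := C2u.
have [_ _ _ _ _ dl el dlx elz] := C2l.
have dx (x z : R) : is_derive x 1 (mass_x ^~ z) (mass_xx x z).
  have d1 := isd_add (dl x z) (du x z).
  have d2 := isd_mul (isd_id x) (isd_add (dlx x z) (isd_opp (dux x z))).
  apply: isd_eq (isd_add (isd_mul (isd_cst x 2) d1) (isd_opp (isd_mul (isd_cst x 2) d2))) _.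
  rewrite /mass_xx; ring.
have dz (x z : R) : is_derive z 1 (mass_z x) (mass_zz x z).
  have d2 := isd_mul (isd_cst z x) (isd_add (elz x z) (isd_opp (euz x z))).
  apply: isd_eq (isd_opp (isd_mul (isd_cst z 2) d2)) _.
  rewrite /mass_zz; ring.
have x0 z : mass_x 0 z = 0 by rewrite /mass_x axis mulr0 mul0r mulr0 subr0.
exact: half_disc_divergence cmx cmz cmxx cmzz dx dz x0 r0.
Qed.

(** [2 x] times the differential inequality; on the axis by continuity. *)
Lemma mass_div_ge x z : 0 <= x -> 2 * (x * (ux x z ^+ 2 + uz x z ^+ 2)) <= mass_div x z.
Proof.
have pos t : 0 < t -> 2 * (t * (ux t z ^+ 2 + uz t z ^+ 2)) <= mass_div t z.
  move=> t0; have := pde z t0.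
  rewrite -(ler_pM2l (_ : 0 < 2 * t)) ?mulr_gt0 // /mass_div /mass_xx /mass_zz.
  have -> : 2 * t * (2 * ux t z / t - (ux t z ^+ 2 + uz t z ^+ 2)) =
      4 * ux t z - 2 * (t * (ux t z ^+ 2 + uz t z ^+ 2)).
    by field; rewrite gt_eqF.
  move: (ux t z) (uz t z) (lxx t z) (lzz t z) (uxx t z) (uzz t z) => a b c d e f.
  move=> h; rewrite -subr_ge0; rewrite -subr_ge0 in h.
  by apply: le_trans h _; rewrite le_eqVlt; apply/orP; left; apply/eqP; ring.
rewrite le_eqVlt => /predU1P[<-|/pos //].
have c1 : continuous (fun t => 2 * (t * (ux t z ^+ 2 + uz t z ^+ 2))) by cts.
exact: continuous_le_at0 c1 (@continuous2_l _ _ z cdiv) pos.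
Qed.

Let div_ge0 x z : 0 <= x -> 0 <= mass_div x z.
Proof.
move=> x0; apply: le_trans (mass_div_ge z x0).
by rewrite !mulr_ge0 // addr_ge0 // sqr_ge0.
Qed.

Lemma mass_flux_mono r r' : 0 <= r -> r <= r' -> mass_flux r <= mass_flux r'.
Proof.
move=> r0 rr; rewrite (mass_flux_half_disc r0) (mass_flux_half_disc (le_trans r0 rr)).
exact: half_disc_integral_mono cdiv div_ge0 r0 rr.
Qed.

Lemma energy_le_flux a L r : 0 < a -> a <= L -> L ^+ 2 + L ^+ 2 <= r ^+ 2 -> 0 <= r ->
  int2 a L (- L) L (fun x z => ux x z ^+ 2 + uz x z ^+ 2) <= mass_flux r / (2 * a).
Proof.
move=> a0 aL Lr r0; have L0 : 0 <= L by lra.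
have ce : continuous2 (fun x z => ux x z ^+ 2 + uz x z ^+ 2).
  cts.
rewrite ler_pdivlMr ?mulr_gt0 // mulrC -(int2Zl _ _ _ _ _ ce).
rewrite (mass_flux_half_disc r0).
apply: le_trans (box_le_half_disc cdiv div_ge0 r0 (ltW a0) L0 Lr).
apply: le_int2; [by cts|exact: cdiv|].
move=> x z /andP[ax _] _; apply: le_trans (mass_div_ge z (le_trans (ltW a0) ax)).
by rewrite -mulrA ler_pM2l // ler_wpM2r // addr_ge0 // sqr_ge0.
Qed.

End MassFlux.

Section FluxAlgebra.
Context {R : realType}.

(** To first order [p = 1 + 2 l] and [e = 1 - 2 u], and the two densities then agree. The error is
    quadratic in [c], so it is [O(1 / r)] for [c = C / r]; [c <= 1/8] keeps both exponents within
    [1/2]. *)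
Lemma flux_density_algebra (r s co c u l ux lx uz lz : R) :
  0 < r -> `|s| <= 1 -> `|co| <= 1 -> 0 <= c -> c <= 8^-1 ->
  `|u| <= c -> `|l + u| <= c -> `|ux| <= c / r -> `|lx + ux| <= c / r ->
  `|uz| <= c / r -> `|lz + uz| <= c / r ->
  let p := expR (2 * l) in let e := expR (- 2 * u) in
  `|(p - e) * (r * s) - ((- 2 * ux * e + 2 * lx * p) * s
      + (- 2 * uz * e + 2 * lz * p) * co) * (r ^+ 2 * s)
    - ((2 * (l + u) - 2 * (r * s * (lx - ux))) * s
       + - (2 * (r * s * (lz - uz))) * co) * r| <= 120 * c ^+ 2 * r.
Proof.
move=> r0 s1 c1 c0 cr bu ba bux bax buz baz.
have tri (p q k : R) : `|q| <= k -> `|p + q| <= k -> `|p| <= 2 * k.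
  by rewrite !ler_norml => /andP[? ?] /andP[? ?]; apply/andP; split; lra.
have bl := tri _ _ _ bu ba.
have blx := tri _ _ _ bux bax.
have blz := tri _ _ _ buz baz.
have sq (p k : R) : `|p| <= k -> p ^+ 2 <= k ^+ 2.
  by move=> pk; rewrite -(real_normK (num_real p)) ler_sqr ?nnegrE // (le_trans _ pk).
have n2 (p k : R) : `|p| <= k -> `|2 * p| <= 2 * k.
  by move=> pk; rewrite normrM gtr0_norm // ler_pM2l.
have bl2 := n2 _ _ bl.
have bu2 : `|- 2 * u| <= 2 * c by rewrite mulNr normrN; exact: n2.
have hl : `|2 * l| <= 2^-1 by apply: le_trans bl2 _; lra.
have hu : `|- 2 * u| <= 2^-1 by apply: le_trans bu2 _; lra.
have e1 := expR_taylor1 hl; have e2 := expR_taylor1 hu.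
have f1 := expR_taylor0 hl; have f2 := expR_taylor0 hu.
cbv zeta; set p := expR (2 * l) in e1 f1 *; set e := expR (- 2 * u) in e2 f2 *.
(* [T1] and [T] collect the second-order parts of the undifferentiated and of the differentiated
   terms; the three pieces contribute 40 each to the constant. *)
pose T1 := (p - 1 - 2 * l) - (e - 1 - - 2 * u).
pose T v k := 2 * (v * (p - 1)) - 2 * (k * (e - 1)) : R.
rewrite [X in `|X|](_ : _ = r * (T1 * s) + r ^+ 2 * ((- T lx ux * s - T lz uz * co) * s)); last first.
  rewrite /T1 /T; ring.
have bT1 : `|T1| <= 40 * c ^+ 2.
  apply: le_trans (ler_normB _ _) _; apply: le_trans (lerD e1 e2) _.
  have q1 := sq _ _ bl2; have q2 := sq _ _ bu2.
  apply: (@le_trans _ _ (2 * (2 * (2 * c)) ^+ 2 + 2 * (2 * c) ^+ 2)).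
    by apply: lerD; rewrite ler_pM2l.
  by rewrite le_eqVlt; apply/orP; left; apply/eqP; ring.
have p1 : `|p - 1| <= 8 * c by rewrite (_ : 8 * c = 2 * (2 * (2 * c))) ?(le_trans f1) ?ler_pM2l //; ring.
have e1' : `|e - 1| <= 4 * c by rewrite (_ : 4 * c = 2 * (2 * c)) ?(le_trans f2) ?ler_pM2l //; ring.
have bT v k' : `|v| <= 2 * (c / r) -> `|k'| <= c / r -> `|T v k'| <= 40 * c ^+ 2 / r.
  move=> bv bk; apply: le_trans (ler_normB _ _) _; rewrite !normrM !(gtr0_norm (_ : 0 < 2)) //.
  have h1 : `|v| * `|p - 1| <= 2 * (c / r) * (8 * c) by apply: ler_pM.
  have h2 : `|k'| * `|e - 1| <= c / r * (4 * c) by apply: ler_pM.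
  have -> : 40 * c ^+ 2 / r = 2 * (2 * (c / r) * (8 * c)) + 2 * (c / r * (4 * c)) by field; rewrite gt_eqF.
  by apply: lerD; rewrite ler_pM2l.
have m1 (p' k' q : R) : `|p'| <= k' -> `|q| <= 1 -> `|p' * q| <= k'.
  by move=> pk q1; rewrite normrM -[k']mulr1; apply: ler_pM.
have -> : 120 * c ^+ 2 * r = r * (40 * c ^+ 2) + r ^+ 2 * (40 * c ^+ 2 / r + 40 * c ^+ 2 / r).
  by field; rewrite gt_eqF.
apply: le_trans (ler_normD _ _) (lerD _ _); rewrite normrM.
  by rewrite (gtr0_norm r0) ler_pM2l //; exact: m1.
rewrite (ger0_norm (sqr_ge0 r)) ler_wpM2l ?sqr_ge0 //; apply: (m1 _ _ _ _ s1).
apply: le_trans (ler_normB _ _) (lerD _ _); apply: (m1 _ _ _ _ _) => //; rewrite ?normrN; exact: bT.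
Qed.

End FluxAlgebra.

Section FluxComparison.
Context {R : realType} (g : axisym_metric R).
Implicit Types (x y z t r : R).
Context (AB : forall q, half_plane q -> coef_A g q = 0 /\ coef_B g q = 0).
Context (R0 C : R).
Context (af : coef_decay g R0 C).

Local Notation u := (pu g).
Local Notation ux := (pux g).
Local Notation uz := (puz g).
Local Notation l := (pl g).
Local Notation lx := (plx g).
Local Notation lz := (plz g).

Lemma flux_density_close r t : 0 < r -> R0 <= r -> 8 * C <= r -> 0 <= C ->
  0 <= sin t ->
  `|flux_density g r t - mass_flux_density u ux uz l lx lz r t| <= 120 * C ^+ 2 / r.
Proof.
move=> r0 Rr Cr C0 st; pose x := r * sin t; pose z := r * cos t.
have x0 : 0 <= x by rewrite mulr_ge0 // ltW.
have nE : dist_axis x z = r.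
  rewrite /dist_axis -[RHS]gtr0_norm // -sqrtr_sqr; congr Num.sqrt.
  by rewrite /x /z -[RHS]mulr1 -(cos2Dsin2 t); ring.
have := profile_decay AB af (z := z) x0; rewrite nE => /(_ r0 Rr); cbv zeta.
set c := C / r; have -> : C / r ^+ 2 = c / r by rewrite /c; field; rewrite gt_eqF.
move=> [bu ba bux bax [buz baz]].
have cr : c <= 8^-1 by rewrite ler_pdivrMr // mulrC ler_pdivlMr // mulrC.
have c0 : 0 <= c by rewrite divr_ge0 // ltW.
have dEx : prof_dE g [:: o1] x z = - 2 * ux x z * expR (- 2 * u x z).
  rewrite -prof_E_exp /pux; have := prof_E_gt0 g x z.
  move: (prof_E _ _ _) (prof_dE _ _ _ _) => e' d e0; by field; rewrite gt_eqF.
have dEz : prof_dE g [:: o2] x z = - 2 * uz x z * expR (- 2 * u x z).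
  rewrite -prof_E_exp /puz; have := prof_E_gt0 g x z.
  move: (prof_E _ _ _) (prof_dE _ _ _ _) => e' d e0; by field; rewrite gt_eqF.
have dPx : prof_dP g [:: o0] x z = 2 * lx x z * expR (2 * l x z).
  rewrite -prof_P_exp /plx; have := prof_P_gt0 g x z.
  move: (prof_P _ _ _) (prof_dP _ _ _ _) => e' d e0; by field; rewrite gt_eqF.
have dPz : prof_dP g [:: o2] x z = 2 * lz x z * expR (2 * l x z).
  rewrite -prof_P_exp /plz; have := prof_P_gt0 g x z.
  move: (prof_P _ _ _) (prof_dP _ _ _ _) => e' d e0; by field; rewrite gt_eqF.
have s1 : `|sin t| <= 1 by rewrite ler_norml sin_geN1 sin_le1.
have c1 : `|cos t| <= 1 by rewrite ler_norml cos_geN1 cos_le1.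
have -> : 120 * C ^+ 2 / r = 120 * c ^+ 2 * r by rewrite /c; field; rewrite gt_eqF.
have := flux_density_algebra r0 s1 c1 c0 cr bu ba bux bax buz baz.
rewrite /flux_density /mass_flux_density -/x -/z dEx dEz dPx dPz prof_E_exp prof_P_exp.
by rewrite /mass_x /mass_z.
Qed.

End FluxComparison.

Section MassBound.
Context {R : realType} (g : axisym_metric R).
Implicit Types (x y z t r : R).
Context (AB : forall q, half_plane q -> coef_A g q = 0 /\ coef_B g q = 0).
Context (scal : forall p, 0 <= scalar_curvature g p).
Context (R0 C : R).
Context (af : coef_decay g R0 C).

Let A := mass_flux (pu g) (pux g) (puz g) (pl g) (plx g) (plz g).
Let dA := mass_flux_density (pu g) (pux g) (puz g) (pl g) (plx g) (plz g).

Lemma decay_const_ge0 : 0 <= C.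
Proof.
pose x := `|R0| + 1; have x0 : 0 < x by rewrite ltr_wpDl.
have d : dist_axis x 0 = x by rewrite dist_axis0.
have := profile_decay AB af (z := 0) (ltW x0); rewrite d => /(_ x0) []; last first.
  move=> h _ _ _ _; have := le_trans (normr_ge0 _) h.
  by rewrite pmulr_lge0 // invr_gt0.
by apply: le_trans (ler_norm R0) _; rewrite lerDl.
Qed.

Let C0 := decay_const_ge0.

Let A_mono r r' : 0 <= r -> r <= r' -> A r <= A r'.
Proof.
apply: (mass_flux_mono (plane_C2_pu g) (plane_C2_pl g) (prof_axis AB)).
exact: pde_of_scalar_curvature.
Qed.

Let cdA r : continuous (dA r).
Proof.
have [cu cux cuz _ _ _ _ _ _] := plane_C2_pu g.
have [cl clx clz _ _ _ _ _ _] := plane_C2_pl g.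
rewrite /dA /mass_flux_density /mass_x /mass_z.
move: (pu g) (pux g) (puz g) (pl g) (plx g) (plz g) cu cux cuz cl clx clz
  => a b c d e f c1 c2 c3 c4 c5 c6; cts.
Qed.

(** Together with monotonicity this makes the flux converge. The constant is [2 + 6 + 6]: one term
    from [alpha], two from the derivatives of [w], which are at most [3 C / r^2]. *)
Lemma mass_flux_bounded r : 0 < r -> R0 <= r -> A r <= 14 * C * pi.
Proof.
move=> r0 Rr; rewrite -[pi]subr0 -int1_cst ?pi_ge0 // /A /mass_flux.
apply: le_int1; [exact: cdA|exact: ct_cst|move=> t t0].
have st : 0 <= sin t by exact: sin_ge0_pi.
pose x := r * sin t; pose z := r * cos t.
have x0 : 0 <= x by rewrite mulr_ge0 // ltW.
have nE : dist_axis x z = r.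
  rewrite /dist_axis -[RHS]gtr0_norm // -sqrtr_sqr; congr Num.sqrt.
  by rewrite /x /z -[RHS]mulr1 -(cos2Dsin2 t); ring.
have := profile_decay AB af (z := z) x0; rewrite nE => /(_ r0 Rr); cbv zeta.
rewrite /mass_flux_density /mass_x /mass_z -/x -/z.
move: (pu g x z) (pux g x z) (puz g x z) (pl g x z) (plx g x z) (plz g x z).
move=> u ux uz l lx lz [_ ba bux bax [buz baz]].
have s1 : `|sin t| <= 1 by rewrite ler_norml sin_geN1 sin_le1.
have c1 : `|cos t| <= 1 by rewrite ler_norml cos_geN1 cos_le1.
have xr : `|x| <= r by rewrite /x normrM gtr0_norm // ler_piMr // ltW.
have dif (p q k : R) : `|q| <= k -> `|p + q| <= k -> `|p - q| <= 3 * k.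
  by rewrite !ler_norml => /andP[? ?] /andP[? ?]; apply/andP; split; lra.
have b2 := dif _ _ _ bux bax; have b3 := dif _ _ _ buz baz.
have m1 (p q k m : R) : `|p| <= k -> `|q| <= m -> `|p * q| <= k * m.
  by move=> pk qm; rewrite normrM; apply: ler_pM.
have n2 (p k : R) : `|p| <= k -> `|2 * p| <= 2 * k.
  by move=> pk; rewrite normrM gtr0_norm // ler_pM2l.
have e1 : r * (3 * (C / r ^+ 2)) = 3 * C / r by field; rewrite gt_eqF.
have h1 : `|x * (lx - ux)| <= 3 * C / r by rewrite -e1; exact: m1.
have h2 : `|x * (lz - uz)| <= 3 * C / r by rewrite -e1; exact: m1.
have h3 : `|2 * (l + u) - 2 * (x * (lx - ux))| <= 2 * (C / r) + 2 * (3 * C / r).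
  by apply: le_trans (ler_normB _ _) (lerD _ _); exact: n2.
have h4 : `|- (2 * (x * (lz - uz)))| <= 2 * (3 * C / r) by rewrite normrN; exact: n2.
have -> : 14 * C = ((2 * (C / r) + 2 * (3 * C / r)) * 1 + 2 * (3 * C / r) * 1) * r.
  by field; rewrite gt_eqF.
rewrite ler_pM2r //; apply: le_trans (ler_norm _) _.
by apply: le_trans (ler_normD _ _) (lerD _ _); exact: m1.
Qed.

(* The flux is nondecreasing and bounded, so the limit defining the ADM mass
   exists, and every flux is below it. *)
Lemma mass_flux_le_adm_mass r : 0 <= r -> A r <= 8 * adm_mass g.
Proof.
move=> r0.
(* [Num.max 0 s] makes [phi] monotone on the whole line; [1 / 8 = 2 pi / (16 pi)] is the ADM
   normalisation after integrating over the circle. *)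
pose phi s := A (Num.max 0 s) / 8.
have phi_mono : {homo phi : s t / s <= t}.
  move=> s t st; rewrite ler_pM2r ?invr_gt0 //; apply: A_mono.
    by rewrite le_max lexx.
  by rewrite ge_max !le_max lexx st !orbT.
pose r1 := Num.max 1 R0; have r10 : 0 < r1 by rewrite lt_max ltr01.
have phi_bnd : has_ubound (range phi).
  exists (14 * C * pi / 8) => _ [s _ <-].
  rewrite ler_pM2r ?invr_gt0 //.
  apply: le_trans (_ : A (Num.max r1 s) <= _).
    apply: A_mono; first by rewrite le_max lexx.
    by rewrite ge_max le_max (ltW r10) le_max lexx orbT.
  have Rr1 : R0 <= r1 by rewrite /r1 le_max lexx orbT.
  by apply: mass_flux_bounded; [rewrite lt_max r10|rewrite le_max Rr1].
have cphi := nondecreasing_cvgr phi_mono phi_bnd.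
set S := sup (range phi) in cphi.
(* [adm_mass] is a [lim], informative only once convergence is known; the densities differ by
   [O(1 / s)], so the ADM flux inherits the limit of [phi]. *)
have cf : ((16 * pi)^-1 * adm_flux g s) @[s --> +oo] --> S.
  apply/cvgrPdist_le => e e0; have e2 : 0 < e / 2 by rewrite divr_gt0.
  move/cvgrPdist_le : cphi => /(_ _ e2) cphi; near=> s.
  have s0 : 0 < s by near: s; apply: nbhs_pinfty_gt; exact: num_real.
  have sR : R0 <= s by near: s; apply: nbhs_pinfty_ge; exact: num_real.
  have sC : 8 * C <= s by near: s; apply: nbhs_pinfty_ge; exact: num_real.
  have sK : 120 * C ^+ 2 * pi / (8 * (e / 2)) <= s by near: s; apply: nbhs_pinfty_ge; exact: num_real.
  have pi0 : pi != 0 :> R by rewrite gt_eqF // pi_gt0.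
  have E1 : (16 * pi)^-1 * adm_flux g s = int1 0 pi (flux_density g s) / 8.
    rewrite (adm_fluxE AB s0); move: (int1 _ _ _) => I; move: (pi : R) pi0 => p p0.
    by field; rewrite p0.
  have E2 : phi s = A s / 8 by rewrite /phi max_r // ltW.
  have cW : continuous (flux_density g s).
    have [cE cEx cEz _ _ _ _ _ _] := plane_C2_prof_E g.
    have [cP cPx cPz _ _ _ _ _ _] := plane_C2_prof_P g.
    by rewrite /flux_density; cts.
  have cd := @cdA s.
  have close : `|A s - int1 0 pi (flux_density g s)| <= 120 * C ^+ 2 / s * pi.
    have cl t : 0 <= t <= pi -> `|flux_density g s t - dA s t| <= 120 * C ^+ 2 / s.
      by move=> t0; apply: (flux_density_close AB af) => //; exact: sin_ge0_pi.
    rewrite /A /mass_flux -/(dA s) -[X in _ * X]subr0 -int1_cst ?pi_ge0 // ler_norml.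
    rewrite -int1B // -[leLHS]mulN1r -int1Zl; last exact: ct_cst.
    have cB : continuous (fun x => dA s x - flux_density g s x) by cts.
    apply/andP; split; apply: le_int1 => //; try exact: ct_cst.
      by move=> t /cl; rewrite ler_norml mulN1r => /andP[? ?]; lra.
    by move=> t /cl; rewrite ler_norml => /andP[? ?]; lra.
  rewrite E1; apply: le_trans (_ : `|S - phi s| + `|phi s - int1 0 pi (flux_density g s) / 8| <= _).
    by rewrite -[X in `|X| <= _](subrKA (phi s)) ler_normD.
  rewrite [e]splitr; apply: lerD; first by near: s.
  rewrite E2 -mulrBl normrM [X in _ * X]gtr0_norm ?invr_gt0 // ler_pdivrMr //.
  apply: le_trans close _.
  have := sK; rewrite ler_pdivrMr ?mulr_gt0 // => h.
  by rewrite mulrAC ler_pdivrMr // [leRHS]mulrC [e / 2 * 8]mulrC.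
have -> : adm_mass g = S by exact: cvg_lim cf.
have : phi r <= S by apply: ub_le_sup => //; exists r.
by rewrite /phi max_r // ler_pdivrMr // mulrC.
Unshelve. all: by end_near. Qed.

(** The half-disc of radius [2 L] contains the box, and [8 m / (2 a) = 4 m / a]. *)
Lemma energy_le_adm_mass a L : 0 < a -> a <= L ->
  int2 a L (- L) L (fun x z => pux g x z ^+ 2 + puz g x z ^+ 2) <= 4 * adm_mass g / a.
Proof.
move=> a0 aL; have L0 : 0 < L by exact: lt_le_trans aL.
have r0 : 0 <= 2 * L by rewrite mulr_ge0 // ltW.
have Lr : L ^+ 2 + L ^+ 2 <= (2 * L) ^+ 2 by have := sqr_ge0 L; rewrite exprMn; lra.
have := energy_le_flux (plane_C2_pu g) (plane_C2_pl g) (prof_axis AB)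
  (pde_of_scalar_curvature AB scal) a0 aL Lr r0.
move=> /le_trans; apply.
rewrite ler_pdivrMr ?mulr_gt0 //; apply: le_trans (mass_flux_le_adm_mass r0) _.
by rewrite le_eqVlt; apply/orP; left; apply/eqP; field; rewrite gt_eqF.
Qed.

End MassBound.

(** * Lengths of broken lines *)

Section BentSegment.
Context {R : realType}.
Implicit Types (x y v : 'rV[R]_3) (t : R).

(* The corner makes [z] strictly monotone on both halves, even when the segment
   from [x] to [y] is horizontal. *)
Definition bent_segment x y (h : R) t : 'rV[R]_3 :=
  (1 - t) *: x + t *: y + (h * (1 - `|2 * t - 1|)) *: delta_mx 0 o2.

Lemma continuous_bent_segment x y h : continuous (bent_segment x y h).
Proof.
move=> t; apply: cvgD; first apply: cvgD.
- apply: cvgZr_tmp; have c : continuous (fun t : R => 1 - t) by cts.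
  exact: c.
- by apply: cvgZr_tmp; exact: cvg_id.
- apply: cvgZr_tmp; have c : continuous (fun t : R => h * (1 - `|2 * t - 1|)).
    apply: ctM; first exact: ct_cst.
    apply: ctD; first exact: ct_cst.
    apply: ctN; apply: ct_norm; apply: ctD; last exact: ct_cst.
    apply: ctM; [exact: ct_cst|exact: ct_id].
  exact: c.
Qed.

Lemma bent_segment0 x y h : bent_segment x y h 0 = x.
Proof.
by rewrite /bent_segment subr0 scale1r scale0r addr0 mulr0 sub0r normrN normr1 subrr mulr0 scale0r addr0.
Qed.

Lemma bent_segment1 x y h : bent_segment x y h 1 = y.
Proof.
rewrite /bent_segment subrr scale0r scale1r add0r mulr1.
have -> : 2 - 1 = 1 :> R by ring.
by rewrite normr1 subrr mulr0 scale0r addr0.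
Qed.

Definition bent_velocity x y (h : R) : 'rV[R]_3 := y - x + (2 * h) *: delta_mx 0 o2.

Lemma bent_segmentE x y h t : t <= 2^-1 ->
  bent_segment x y h t = x + t *: bent_velocity x y h.
Proof.
move=> t2; rewrite /bent_segment ler0_norm; last by lra.
apply/rowP => i; rewrite !mxE; ring.
Qed.

Lemma bent_segmentE' x y h t : 2^-1 <= t ->
  bent_segment x y h t = x + (2 * h) *: delta_mx 0 o2 + t *: bent_velocity x y (- h).
Proof.
move=> t2; rewrite /bent_segment ger0_norm; last by lra.
apply/rowP => i; rewrite !mxE; ring.
Qed.

Lemma is_derive_affine (a v : 'rV[R]_3) t : is_derive t 1 (fun s : R => a + s *: v) v.
Proof.
have E : (fun h : R => h^-1 *: (((fun s => a + s *: v) \o shift t) (h *: 1) - (a + t *: v))) @ 0^' --> v.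
  apply: cvg_near_cst; near=> h; rewrite /=.
  have -> : h *: (1 : R) + t = h + t by congr (_ + _); exact: mulr1.
  rewrite opprD addrACA subrr add0r -scalerBl addrK scalerA mulVf ?scale1r //.
  near: h; exact: nbhs_dnbhs_neq.
apply: DeriveDef; last exact: cvg_lim E.
by apply/cvg_ex; exists v.
Unshelve. all: by end_near. Qed.

Lemma is_derive_bent_left x y h t : t < 2^-1 ->
  is_derive t 1 (bent_segment x y h) (bent_velocity x y h).
Proof.
move=> t2; apply: near_eq_is_derive (is_derive_affine x (bent_velocity x y h) t).
near=> s; rewrite bent_segmentE // ltW //; near: s; exact: lt_nbhsl.
Unshelve. all: by end_near. Qed.

Lemma is_derive_bent_right x y h t : 2^-1 < t ->
  is_derive t 1 (bent_segment x y h) (bent_velocity x y (- h)).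
Proof.
move=> t2; apply: near_eq_is_derive (is_derive_affine (x + (2 * h) *: delta_mx 0 o2) (bent_velocity x y (- h)) t).
near=> s; rewrite bent_segmentE' // ltW //; near: s; exact: lt_nbhsr.
Unshelve. all: by end_near. Qed.

Lemma piecewise_C1_bent x y h : piecewise_C1 (bent_segment x y h).
Proof.
have cw a b : {within `[a, b], continuous (bent_segment x y h)}.
  by apply: continuous_subspaceT; exact: continuous_bent_segment.
have cc a b v : {within `[a, b], continuous (fun _ : R => v : 'rV[R]_3)}.
  by apply: continuous_subspaceT => s; exact: cst_continuous.
have h2 : 2^-1 < 1 :> R by lra.
exists [:: 2^-1; 1]; split => //.
  by rewrite /= invr_gt0 ltr0n h2.
case=> [_|[_|//]]; split => //=.
- by exists (fun=> bent_velocity x y h) => // t /andP[_ t2]; exact: is_derive_bent_left.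
- by exists (fun=> bent_velocity x y (- h)) => // t /andP[t2 _]; exact: is_derive_bent_right.
Qed.

End BentSegment.

Section CurveLength.
Context {R : realType} (g : 'rV[R]_3 -> 'M[R]_3).
Context (gsm : forall i j, smooth_on setT (fun p => g p i j)).
Implicit Types (x y v : 'rV[R]_3) (t : R).

Lemma gnormE p v : Defs.gnorm g p v = Num.sqrt (
  (v 0 o0 * g p o0 o0 + v 0 o1 * g p o1 o0 + v 0 o2 * g p o2 o0) * v 0 o0 +
  (v 0 o0 * g p o0 o1 + v 0 o1 * g p o1 o1 + v 0 o2 * g p o2 o1) * v 0 o1 +
  (v 0 o0 * g p o0 o2 + v 0 o1 * g p o1 o2 + v 0 o2 * g p o2 o2) * v 0 o2).
Proof. by rewrite /Defs.gnorm !mxE sum3 !mxE !sum3. Qed.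

Lemma continuous_gnorm (c : R -> 'rV[R]_3) v : continuous c ->
  continuous (fun t => Defs.gnorm g (c t) v).
Proof.
move=> cc; have cg i j : continuous (fun t => g (c t) i j).
  move=> t; apply: (@continuous_comp _ _ _ c (pds [::] (fun p => g p i j))); first exact: cc.
  exact: smooth_continuous (gsm i j) _.
have -> : (fun t => Defs.gnorm g (c t) v) = (fun t => Num.sqrt (
  (v 0 o0 * g (c t) o0 o0 + v 0 o1 * g (c t) o1 o0 + v 0 o2 * g (c t) o2 o0) * v 0 o0 +
  (v 0 o0 * g (c t) o0 o1 + v 0 o1 * g (c t) o1 o1 + v 0 o2 * g (c t) o2 o1) * v 0 o1 +
  (v 0 o0 * g (c t) o0 o2 + v 0 o1 * g (c t) o1 o2 + v 0 o2 * g (c t) o2 o2) * v 0 o2)).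
  by apply/funext => t; exact: gnormE.
have cr j : continuous (fun t =>
    v 0 o0 * g (c t) o0 j + v 0 o1 * g (c t) o1 j + v 0 o2 * g (c t) o2 j).
  have cm i : continuous (fun t => v 0 i * g (c t) i j).
    by apply: ctM; [exact: ct_cst|exact: cg].
  by apply: ctD (cm o2); apply: ctD; exact: cm.
have cs j : continuous (fun t =>
    (v 0 o0 * g (c t) o0 j + v 0 o1 * g (c t) o1 j + v 0 o2 * g (c t) o2 j) * v 0 j).
  by apply: ctM; [exact: cr|exact: ct_cst].
by apply: (ct_comp ct_sqrt); apply: ctD (cs o2); apply: ctD; exact: cs.
Qed.

(* At [t = 1/2] the curve has a corner, where [derive1] is a junk value. *)
Lemma curve_length_bent x y h : curve_length g (bent_segment x y h) =
  int1 0 2^-1 (fun t => Defs.gnorm g (bent_segment x y h t) (bent_velocity x y h)) +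
  int1 2^-1 1 (fun t => Defs.gnorm g (bent_segment x y h t) (bent_velocity x y (- h))).
Proof.
set c := bent_segment x y h.
pose f1 t := Defs.gnorm g (c t) (bent_velocity x y h).
pose f2 t := Defs.gnorm g (c t) (bent_velocity x y (- h)).
pose f t := Defs.gnorm g (c t) (derive1 c t).
have cf1 : continuous f1 by apply: continuous_gnorm; exact: continuous_bent_segment.
have cf2 : continuous f2 by apply: continuous_gnorm; exact: continuous_bent_segment.
have fl t : t < 2^-1 -> f t = f1 t.
  by move=> t2; rewrite /f derive1E; have [_ ->] := is_derive_bent_left x y h t2.
have fr t : 2^-1 < t -> f t = f2 t.
  by move=> t2; rewrite /f derive1E; have [_ ->] := is_derive_bent_right x y h t2.
have fE : f = fun t => if t == 2^-1 then f 2^-1 else if t < 2^-1 then f1 t else f2 t.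
  apply/funext => t; case: eqP => [-> //|/eqP tn]; case: ltP => [/fl //|t2].
  by apply: fr; rewrite lt_neqAle eq_sym tn.
have mf : measurable_fun setT f.
  rewrite fE; apply: measurable_fun_ifT => //.
  - apply: measurable_fun_eqr => //; exact: measurable_cst.
  - apply: measurable_fun_ifT; [exact: measurable_fun_ltr|exact: continuous_measurable_fun|exact: continuous_measurable_fun].
(* [f] is dominated by [|f1| + |f2|] plus the constant [|f (1/2)|], which pays for the corner. *)
have fi : lebesgue_measure.-integrable `[0, 1] (EFin \o f).
  have i1 := integrable_norm (int1_integrable 0 1 cf1).
  have i2 := integrable_norm (int1_integrable 0 1 cf2).
  have i3 := int1_integrable 0 1 (@ct_cst _ R `|f 2^-1|).
  apply: le_integrable (integrableD _ (integrableD _ i1 i2) i3) => //.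
    by apply/measurable_EFinP; exact: measurable_funTS.
  move=> t _; change (`|f t|%:E <= `|(`|f1 t| + `|f2 t| + `|f 2^-1|)|%:E)%E.
  rewrite lee_fin [X in _ <= X]ger0_norm ?addr_ge0 // {1}fE.
  have := normr_ge0 (f1 t); have := normr_ge0 (f2 t); have := normr_ge0 (f 2^-1).
  case: eqP => _; last case: ltP => _.
  + by move: `|f2 t| `|f 2^-1| `|f1 t| => *; lra.
  + by move: `|f2 t| `|f 2^-1| `|f1 t| => *; lra.
  + by move: `|f2 t| `|f 2^-1| `|f1 t| => *; lra.
have b1 : (BLeft 0 <= BRight 2^-1 :> itv_bound R)%O by rewrite bnd_simp invr_ge0.
have b2 : (BRight 2^-1 <= BRight 1 :> itv_bound R)%O by rewrite bnd_simp; lra.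
have := Rintegral_itvB fi b1 b2.
rewrite /curve_length -/c => /(canRL (subrK _)) ->.
rewrite addrC; apply: (f_equal2 +%R).
- have i1 : lebesgue_measure.-integrable `[0, 2^-1[ (EFin \o f1).
    by apply: integrableS (int1_integrable 0 2^-1 cf1) => //; exact: subset_itv_co_cc.
  have i0 : lebesgue_measure.-integrable `[0, 2^-1[ (EFin \o f).
    by apply: integrableS fi => //; apply: subset_itv; rewrite // bnd_simp; lra.
  rewrite /int1 -(Rintegral_itv_bndo_bndc i0) -(Rintegral_itv_bndo_bndc i1).
  by apply: eq_Rintegral => t; rewrite inE /= in_itv /= => /andP[_]; exact: fl.
- have i2 : lebesgue_measure.-integrable `]2^-1, 1] (EFin \o f2).
    by apply: integrableS (int1_integrable 2^-1 1 cf2) => //; exact: subset_itv_oc_cc.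
  rewrite /int1 -(Rintegral_itv_obnd_cbnd i2).
  by apply: eq_Rintegral => t; rewrite inE /= in_itv /= => /andP[+ _]; exact: fr.
Qed.

End CurveLength.

(** * Trace bounds for one metric of small mass *)

Section BoxDecay.
Context {R : realType} (g : axisym_metric R).
Implicit Types (x z t : R).
Context (AB : forall q, half_plane q -> coef_A g q = 0 /\ coef_B g q = 0).
Context (R0 C : R).
Context (af : coef_decay g R0 C).

(** Such points are at distance at least [l] from the origin. The factor 3 comes from
    [pl - pu = (pl + pu) - 2 pu]. *)
Lemma box_decay (l : R) x z : 0 < l -> R0 <= l -> 0 <= x -> l <= x \/ l <= `|z| ->
  [/\ `|pu g x z| <= C / l, `|pl g x z - pu g x z| <= 3 * C / l,
      `|plx g x z - pux g x z| <= 3 * C / l ^+ 2 &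
      `|plz g x z - puz g x z| <= 3 * C / l ^+ 2].
Proof.
move=> l0 Rl x0 lxz; have ln : l <= dist_axis x z.
  rewrite /dist_axis -[l]ger0_norm ?(ltW l0) // -sqrtr_sqr ler_wsqrtr //.
  have := sqr_ge0 x; have := sqr_ge0 z; rewrite -(real_normK (num_real z)).
  have := normr_ge0 z; case: lxz => h *; nra.
have n0 : 0 < dist_axis x z by exact: lt_le_trans ln.
have C0 := decay_const_ge0 AB af.
have := profile_decay AB af x0 n0 (le_trans Rl ln); cbv zeta.
have d1 : C / dist_axis x z <= C / l by rewrite ler_wpM2l // lef_pV2 // posrE.
have d2 : C / dist_axis x z ^+ 2 <= C / l ^+ 2.
  by rewrite ler_wpM2l // lef_pV2 ?posrE ?exprn_gt0 // ler_sqr ?nnegrE // ltW.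
rewrite -!mulrA; move: d1 d2.
move: (C / l) (C / l ^+ 2) (C / dist_axis x z) (C / dist_axis x z ^+ 2) => k1 k2 m1 m2.
move: (pu g x z) (pl g x z) (pux g x z) (plx g x z) (puz g x z) (plz g x z).
move=> u v ux vx uz vz d1 d2 [+ + + + []].
rewrite !ler_norml => /andP[? ?] /andP[? ?] /andP[? ?] /andP[? ?] /andP[? ?] /andP[? ?].
by split; apply/andP; split; lra.
Qed.

End BoxDecay.

Section ProfileTraces.
Context {R : realType} (g : axisym_metric R).
Implicit Types (x z t : R).
Context (AB : forall q, half_plane q -> coef_A g q = 0 /\ coef_B g q = 0).
Context (scal : forall p, 0 <= scalar_curvature g p).
Context (R0 C : R).
Context (af : coef_decay g R0 C).
Context (a L L' e kappa delta : R).
Context (a0 : 0 < a) (aL : a <= L) (LL : L <= L') (RL : R0 <= L).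
Context (e0 : 0 < e) (kappa0 : 0 < kappa).
Context (monotone : forall z, plx g a z - pux g a z <= 0).
Context (CL : 3 * C / L <= e) (CL' : 36 * C / kappa <= L').
Context (mass_le : adm_mass g <= delta).
Let s := kappa * a / (12 * L' ^+ 2).
Context (delta1 : delta <= kappa * a ^+ 2 * s / 24).
Context (delta2 : delta <= kappa * e * a / 8).

Let w x z := pl g x z - pu g x z.
Let wx x z := plx g x z - pux g x z.
Let wz x z := plz g x z - puz g x z.
Let wxx x z := plxx g x z - puxx g x z.
Let wzz x z := plzz g x z - puzz g x z.

Let c2w : plane_C2 w wx wz wxx wzz.
Proof. exact: plane_C2B (plane_C2_pl g) (plane_C2_pu g). Qed.

Let L0 : 0 < L. Proof. exact: lt_le_trans a0 aL. Qed.
Let L'0 : 0 < L'. Proof. exact: lt_le_trans L0 LL. Qed.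
Let C0 : 0 <= C. Proof. exact (decay_const_ge0 AB af). Qed.

Let energy (l : R) : a <= l ->
  int2 a l (- l) l (fun x z => pux g x z ^+ 2 + puz g x z ^+ 2) <= 4 * delta / a.
Proof.
move=> al; apply: le_trans (energy_le_adm_mass AB scal af a0 al) _.
by rewrite ler_pM2r ?invr_gt0 // ler_pM2l.
Qed.

(** Three terms of size at most [kappa / 3]: the area term by the choice of [s], the energy term by
    [delta1], the outer flux by [CL']. *)
Lemma layer_energy_difference_le j : layer_energy w wx wz a L e j.+1 <= kappa.
Proof.
have [c cx cz cxx czz d dz dxx dzz] := c2w.
have [_ ux uz _ _ _ _ _ _] := plane_C2_pu g.
have s0 : 0 < s by rewrite divr_gt0 ?mulr_gt0 ?exprn_gt0.
have aL' : a <= L' := le_trans aL LL.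
have x0 x : a <= x -> 0 < x := lt_le_trans a0.
have RL' : R0 <= L' := le_trans RL LL.
have nL (l : R) : 0 < l -> l <= `|l| by move=> _; exact: ler_norm.
have nLN (l : R) : 0 < l -> l <= `|- l| by rewrite normrN => _; exact: ler_norm.
have C3 : 0 <= 3 * C by rewrite mulr_ge0.
have pde x z : a <= x -> wxx x z + wzz x z <= 2 * pux g x z / x - (pux g x z ^+ 2 + puz g x z ^+ 2).
  by move=> /x0; exact: pde_of_scalar_curvature AB scal _ _.
have w_le x z : a <= x -> L <= x \/ L <= `|z| -> w x z <= e.
  move=> /x0/ltW xp /(box_decay AB af L0 RL xp)[_ h _ _].
  exact: le_trans (ler_norm _) (le_trans h CL).
have out_x z : - L' <= z <= L' -> `|wx L' z| <= 3 * C / L' ^+ 2.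
  by move=> _; have [_ _ h _] := box_decay (z := z) AB af L'0 RL' (ltW L'0) (or_introl (lexx L')); exact: h.
have out_z x : a <= x <= L' -> `|wz x L'| <= 3 * C / L' ^+ 2.
  by move=> /andP[/x0/ltW xp _]; have [_ _ _ h] := box_decay AB af L'0 RL' xp (or_intror (nL _ L'0)); exact: h.
have out_zN x : a <= x <= L' -> `|wz x (- L')| <= 3 * C / L' ^+ 2.
  by move=> /andP[/x0/ltW xp _]; have [_ _ _ h] := box_decay AB af L'0 RL' xp (or_intror (nLN _ L'0)); exact: h.
have := @superharmonic_layer_energy R w wx wz wxx wzz (pux g) (puz g).
move=> /(_ c cx cz cxx czz ux uz d dz dxx dzz a a0 pde monotone L' (3 * C) (4 * delta / a) s).
move=> /(_ aL' s0 C3 out_x out_z out_zN (energy aL') L e aL LL e0).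
move=> /(_ _ _ _ j) /le_trans; apply.
- by move=> z _; apply: w_le => //; left.
- by move=> x /andP[ax _]; apply: w_le => //; right; exact: nL.
- by move=> x /andP[ax _]; apply: w_le => //; right; exact: nLN.
have b1 : 2 * (2 * s * L' ^+ 2 / a) = kappa / 3.
  by rewrite /s; field; rewrite !gt_eqF.
have b2 : 2 * (4 * delta / a / s / a) <= kappa / 3.
  have -> : 2 * (4 * delta / a / s / a) = 8 * delta / (a ^+ 2 * s).
    by field; rewrite !gt_eqF.
  rewrite ler_pdivrMr; last exact: mulr_gt0 (exprn_gt0 2 a0) s0.
  have -> : kappa / 3 * (a ^+ 2 * s) = 8 * (kappa * a ^+ 2 * s / 24) by field.
  by rewrite ler_pM2l.
have b3 : 4 * (3 * C) / L' <= kappa / 3.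
  rewrite ler_pdivrMr //; move: CL'; rewrite ler_pdivrMr //; lra.
rewrite (mulrDl (2 * s * L' ^+ 2)) (mulrDr 2) b1 -[leRHS](_ : kappa / 3 + kappa / 3 + kappa / 3 = _); last by field.
by rewrite !lerD.
Qed.

(** For [u] the mass controls the full energy, and [delta2] makes [2 / e] times it at most
    [kappa]. *)
Lemma layer_energy_multiple_le (k : R) (f : R -> R -> R) j : k ^+ 2 = 1 -> continuous2 f ->
  layer_energy f (fun x z => k * pux g x z) (fun x z => k * puz g x z) a L e j.+1 <= kappa.
Proof.
move=> k1 cf; have [_ cx cz _ _ _ _ _ _] := plane_C2_pu g.
apply: le_trans (layer_energy_le_energy a L j.+1 e0 k1 cf cx cz) _.
apply: (@le_trans _ _ (2 / e * (4 * delta / a))).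
  by apply: ler_wpM2l (energy aL); rewrite divr_ge0 // ltW.
have -> : 2 / e * (4 * delta / a) = 8 * delta / (e * a) by field; rewrite !gt_eqF.
by rewrite ler_pdivrMr ?mulr_gt0 //; move: delta2; lra.
Qed.

Context (tau : R) (tau01 : 0 < tau <= 2^-1).
Context (kappaE : kappa = e / 2 * (tau * expR (- (2 * e))) ^+ 2).

Definition exp_excess e t : R := Num.max 0 (expR (2 * t) - expR (4 * e)).

(** The conclusion of [exp_trace_le] with [B = 2 L], whose square bounds the area of the box. *)
Definition trace_bound (f : R -> R -> R) := forall (r : R -> R) z1 z2, continuous r ->
  - L <= z1 -> z2 <= L -> (forall z, z1 <= z <= z2 -> a <= r z <= L) ->
  int1 z1 z2 (fun z => exp_excess e (f (r z) z)) <= expR (4 * e) * (2 * (2 * L) * tau).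

Let area : (L - a) * (L - - L) <= (2 * L) ^+ 2.
Proof. by move: a0 L0 => ? ?; nra. Qed.

Let q0 : 0 < tau * expR (- (2 * e)).
Proof. by move: tau01 => /andP[? _]; rewrite mulr_gt0 ?expR_gt0. Qed.

Let kappa_le : kappa <= e / 2 * (tau * expR (- (2 * e))) ^+ 2.
Proof. by rewrite kappaE. Qed.

Let B0 : 0 < 2 * L. Proof. by rewrite mulr_gt0. Qed.

Lemma trace_bound_difference : trace_bound w.
Proof.
have [c cx cz _ _ d dz _ _] := c2w => r z1 z2 cr z1L z2L rL.
have w_le x z : a <= x -> L <= x \/ L <= `|z| -> w x z <= e.
  move=> ax /(box_decay AB af L0 RL (le_trans (ltW a0) ax))[_ h _ _].
  exact: le_trans (ler_norm _) (le_trans h CL).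
have w_right z : - L <= z <= L -> w L z <= e by move=> _; apply: w_le => //; left.
have w_top x : a <= x <= L -> w x L <= e.
  by move=> /andP[ax _]; apply: w_le => //; right; exact: ler_norm.
exact: (exp_trace_le c cx cz d dz aL (ltW L0) e0 w_right w_top q0 B0 area kappa_le
  layer_energy_difference_le cr (erefl _) tau01 z1L z2L rL).
Qed.

Lemma trace_bound_multiple (k : R) : k ^+ 2 = 1 -> trace_bound (fun x z => k * pu g x z).
Proof.
move=> k1; have [c cx cz _ _ d dz _ _] := plane_C2_pu g => r z1 z2 cr z1L z2L rL.
have kd (F : R -> R) t df : is_derive t 1 F df -> is_derive t 1 (fun t => k * F t) (k * df).
  by move=> dF; apply: isd_eq (isd_mul (isd_cst t k) dF) _; rewrite mul0r add0r.
have kn : `|k| = 1 by apply/eqP; rewrite -(eqrXn2 (n := 2)) // expr1n real_normK ?num_real ?k1.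
have u_le x z : a <= x -> L <= x \/ L <= `|z| -> k * pu g x z <= e.
  move=> ax /(box_decay AB af L0 RL (le_trans (ltW a0) ax))[h _ _ _].
  apply: le_trans (ler_norm _) _; rewrite normrM kn mul1r; apply: le_trans h (le_trans _ CL).
  by rewrite ler_pM2r ?invr_gt0 //; move: C0; lra.
have u_right z : - L <= z <= L -> k * pu g L z <= e by move=> _; apply: u_le => //; left.
have u_top x : a <= x <= L -> k * pu g x L <= e.
  by move=> /andP[ax _]; apply: u_le => //; right; exact: ler_norm.
have ck : continuous2 (fun x z => k * pu g x z) by cts.
have ckx : continuous2 (fun x z => k * pux g x z) by cts.
have ckz : continuous2 (fun x z => k * puz g x z) by cts.
exact: (exp_trace_le ck ckx ckz (fun x z => kd _ _ _ (d x z)) (fun x z => kd _ _ _ (dz x z))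
  aL (ltW L0) e0 u_right u_top q0 B0 area kappa_le
  (fun j => layer_energy_multiple_le j k1 ck) cr (erefl _) tau01 z1L z2L rL).
Qed.

End ProfileTraces.

(** * From trace bounds to lengths and distances *)

Lemma riemannian_dist_le {R : realType} (g : 'rV[R]_3 -> 'M[R]_3) (c : R -> 'rV[R]_3) :
  piecewise_C1 c -> riemannian_dist g (c 0) (c 1) <= curve_length g c.
Proof.
move=> pc; apply: ge_inf; last by exists c.
exists 0 => _ [c' _ <-]; apply: Rintegral_ge0 => t _; exact: sqrtr_ge0.
Qed.

Section LineTrace.
Context {R : realType} (a L e tau : R).
Implicit Types (t z : R).

(** A line with vertical speed [k] is a graph over the z axis; the substitution [z = z0 + k t] costs
    the factor [1 / |k|]. *)
Lemma trace_bound_line (f : R -> R -> R) (r : R -> R) (z0 k t1 t2 : R) :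
  trace_bound a L e tau f -> continuous2 f -> continuous r -> k != 0 -> t1 <= t2 ->
  (forall t, t1 <= t <= t2 -> a <= r t <= L) ->
  (forall t, t1 <= t <= t2 -> - L <= z0 + k * t <= L) ->
  int1 t1 t2 (fun t => exp_excess e (f (r t) (z0 + k * t))) <=
  expR (4 * e) * (2 * (2 * L) * tau) / `|k|.
Proof.
move=> tr cf cr k0 t12 rL zL.
pose phi (t : R) := z0 + k * t; pose psi (s : R) := (s - z0) / k.
have psiK t : psi (phi t) = t by rewrite /psi /phi; field.
have phiK s : phi (psi s) = s by rewrite /psi /phi; field.
have dphi t : is_derive t 1 phi k.
  have d := isd_add (isd_cst t z0) (isd_mul (isd_cst t k) (isd_id t)).
  by apply: isd_eq d _; ring.
have ck : continuous (fun _ : R => k) by exact: ct_cst.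
have cpsi : continuous psi by rewrite /psi; cts.
have cphi : continuous phi by apply: ctD; [exact: ct_cst|apply: ctM; [exact: ct_cst|exact: ct_id]].
have crp : continuous (r \o psi) by move=> s; apply: continuous_comp; [exact: cpsi|exact: cr].
pose G s := exp_excess e (f ((r \o psi) s) s).
have cG : continuous G by rewrite /G /exp_excess; cts.
have cGp : continuous (G \o phi) by move=> s; apply: continuous_comp; [exact: cphi|exact: cG].
have t1I : t1 <= t1 <= t2 by rewrite lexx.
have t2I : t1 <= t2 <= t2 by rewrite lexx andbT.
have /andP[a1 b1] := zL _ t1I; have /andP[a2 b2] := zL _ t2I.
have -> : int1 t1 t2 (fun t => exp_excess e (f (r t) (z0 + k * t))) =
    k^-1 * int1 t1 t2 (fun t => G (phi t) * k).
  rewrite -int1Zl; last by move=> s; apply: cvgM; [exact: cGp|exact: ck].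
  by apply: eq_int1 => t _; rewrite mulrCA mulVf // mulr1 /G /= psiK.
have [kp|kn] : 0 < k \/ k < 0 by move: k0; rewrite neq_lt => /orP[]; [right|left].
- have p12 : phi t1 <= phi t2 by rewrite /phi lerD2l ler_pM2l.
  rewrite (int1_subst t12 p12 cG ck dphi) gtr0_norm // mulrC ler_pM2r ?invr_gt0 //.
  apply: tr => // s /andP[s1 s2]; apply: rL.
  by rewrite -(ler_pM2l kp) -(ler_pM2l kp (psi s)) -(lerD2l z0) -(lerD2l z0 (k * psi s)) -/(phi (psi s)) phiK s1.
- have p12 : phi t2 <= phi t1 by rewrite /phi lerD2l ler_nM2l.
  rewrite (int1_substN t12 p12 cG ck dphi) ltr0_norm // mulrN -mulNr -invrN mulrC.
  rewrite ler_pM2r ?invr_gt0 ?oppr_gt0 //.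
  apply: tr => // s /andP[s1 s2]; apply: rL.
  by rewrite -(ler_nM2l kn) -(ler_nM2l kn t2) -(lerD2l z0) -(lerD2l z0 (k * t2)) -/(phi (psi s)) phiK s2.
Qed.

End LineTrace.

(** With [c] and [d] the squared radial and angular components of the vector, the form is
    [P c + E d + P v2^2]. *)
Lemma gform_le {R : realType} (P E K x y v0 v1 v2 : R) : 0 < x ^+ 2 + y ^+ 2 ->
  P <= K -> E <= K ->
  (v0 * gform P E x y o0 o0 + v1 * gform P E x y o1 o0 + v2 * gform P E x y o2 o0) * v0 +
  (v0 * gform P E x y o0 o1 + v1 * gform P E x y o1 o1 + v2 * gform P E x y o2 o1) * v1 +
  (v0 * gform P E x y o0 o2 + v1 * gform P E x y o1 o2 + v2 * gform P E x y o2 o2) * v2 <=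
  K * (v0 ^+ 2 + v1 ^+ 2 + v2 ^+ 2).
Proof.
move=> s0 PK EK; have sN : x ^+ 2 + y ^+ 2 != 0 by rewrite gt_eqF.
pose c := (x * v0 + y * v1) ^+ 2 / (x ^+ 2 + y ^+ 2).
pose d := (y * v0 - x * v1) ^+ 2 / (x ^+ 2 + y ^+ 2).
have c0 : 0 <= c by rewrite divr_ge0 ?sqr_ge0 // ltW.
have d0 : 0 <= d by rewrite divr_ge0 ?sqr_ge0 // ltW.
have vE : v0 ^+ 2 + v1 ^+ 2 = c + d by rewrite /c /d; field.
rewrite [leLHS](_ : _ = E * d + P * c + P * v2 ^+ 2); last first.
  by rewrite /gform /= /c /d; field.
by rewrite vE; have := sqr_ge0 v2; nra.
Qed.

Section NormBound.
Context {R : realType} (g : axisym_metric R).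
Context (AB : forall q, half_plane q -> coef_A g q = 0 /\ coef_B g q = 0).

Lemma gnorm_le (p v : 'rV[R]_3) (K : R) : 0 < rho p ->
  expR (pl g (rho p) (zco p)) <= K -> expR (- pu g (rho p) (zco p)) <= K ->
  Defs.gnorm g p v <= K * enorm v.
Proof.
rewrite /rho /xco /yco /zco inord_o0 inord_o1 inord_o2.
move: (p 0 o0) (p 0 o1) (p 0 o2) (ptE p) => x y z ->; rewrite sqrtr_gt0 => s0 lK uK.
have K0 : 0 <= K := le_trans (expR_ge0 _) lK.
rewrite gnormE !(metric_prof AB _ s0) /enorm sum3.
rewrite -[K]ger0_norm // -sqrtr_sqr -sqrtrM ?sqr_ge0 // ler_wsqrtr //.
apply: gform_le => //.
- rewrite prof_P_exp expRM_natl; move: (expR_ge0 (pl g (Num.sqrt (x ^+ 2 + y ^+ 2)) z)).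
  by move: lK K0; move: (expR _) => t *; nra.
- rewrite prof_E_exp mulNr -mulrN expRM_natl; move: (expR_ge0 (- pu g (Num.sqrt (x ^+ 2 + y ^+ 2)) z)).
  by move: uK K0; move: (expR _) => t *; nra.
Qed.

Context (e : R) (e0 : 0 < e).

Lemma expR_le_excess (s : R) : expR (2 * s) <= expR (4 * e) + exp_excess e s.
Proof. by rewrite -lerBlDl /exp_excess le_max lexx orbT. Qed.

Lemma exp_excess_ge0 (s : R) : 0 <= exp_excess e s.
Proof. by rewrite /exp_excess le_max lexx. Qed.

(** [e^l = e^(l - u) e^u] is at most half the sum of the squares, and [e^(-u)] at most half of
    [1 + e^(-2 u)]. A sum of excesses, unlike a maximum, can be integrated term by term. *)
Lemma exp_difference_bound (u l : R) :
  let K := expR (4 * e) + exp_excess e (l - u) + exp_excess e u + exp_excess e (- u) in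
  expR l <= K /\ expR (- u) <= K.
Proof.
have w := expR_le_excess (l - u); have u1 := expR_le_excess u; have u2 := expR_le_excess (- u).
have w0 := exp_excess_ge0 (l - u); have u10 := exp_excess_ge0 u; have u20 := exp_excess_ge0 (- u).
have e1 : 1 <= expR (4 * e) by rewrite -expR0 ler_expR mulr_ge0 // ltW.
have sq (t : R) : expR (2 * t) = expR t ^+ 2 by rewrite expRM_natl.
have lE : expR l = expR (l - u) * expR u by rewrite -expRD subrK.
rewrite lE; move: w u1 u2; rewrite !sq.
move: (expR (l - u)) (expR u) (expR (- u)) (expR (4 * e)) e1 => W U V E e1.
by split; have := sqr_ge0 (W - U); have := sqr_ge0 (V - 1); nra.
Qed.

Context (a L tau : R) (a0 : 0 < a).
Context (tr_w : trace_bound a L e tau (fun x z => pl g x z - pu g x z)).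
Context (tr_u : trace_bound a L e tau (pu g)).
Context (tr_v : trace_bound a L e tau (fun x z => - pu g x z)).

Lemma int1_gnorm_line_le (b v : 'rV[R]_3) (t1 t2 : R) : t1 <= t2 -> v 0 o2 != 0 ->
  (forall t, t1 <= t <= t2 -> a <= rho (b + t *: v) <= L /\ - L <= zco (b + t *: v) <= L) ->
  int1 t1 t2 (fun t => Defs.gnorm g (b + t *: v) v) <=
  enorm v * (expR (4 * e) * (t2 - t1) + 3 * (expR (4 * e) * (2 * (2 * L) * tau) / `|v 0 o2|)).
Proof.
move=> t12 k0 box; have m3 (T : R) : 3 * T = T + T + T by ring.
have zE t : zco (b + t *: v) = b 0 o2 + v 0 o2 * t by rewrite /zco inord_o2 !mxE mulrC.
pose r t := rho (b + t *: v).
have cr : continuous r.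
  have -> : r = fun t => Num.sqrt ((b 0 o0 + t * v 0 o0) ^+ 2 + (b 0 o1 + t * v 0 o1) ^+ 2).
    by apply/funext => t; rewrite /r /rho /xco /yco inord_o0 inord_o1 !mxE.
  by cts.
have rL t : t1 <= t <= t2 -> a <= r t <= L by move=> /box[].
have zL t : t1 <= t <= t2 -> - L <= b 0 o2 + v 0 o2 * t <= L by move=> /box[_]; rewrite zE.
have [cu _ _ _ _ _ _ _ _] := plane_C2_pu g; have [cl _ _ _ _ _ _ _ _] := plane_C2_pl g.
have cN : continuous2 (fun x z => - pu g x z) by move=> q; apply: cvgN; exact: cu.
have cw : continuous2 (fun x z => pl g x z - pu g x z) by move=> q; apply: cvgB; [exact: cl|exact: cu].
have i1 := trace_bound_line tr_w cw cr k0 t12 rL zL.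
have i2 := trace_bound_line tr_u cu cr k0 t12 rL zL.
have i3 := trace_bound_line tr_v cN cr k0 t12 rL zL.
have cz : continuous (fun t : R => b 0 o2 + v 0 o2 * t).
  by apply: ctD; [exact: ct_cst|apply: ctM; [exact: ct_cst|exact: ct_id]].
have cE (f : R -> R -> R) : continuous2 f ->
    continuous (fun t => exp_excess e (f (r t) (b 0 o2 + v 0 o2 * t))).
  move=> cf; have h := ct_comp2 cf cr cz; rewrite /exp_excess.
  apply: ct_max; first exact: ct_cst.
  apply: ctD; last exact: ct_cst.
  by apply: (ct_comp ct_exp); apply: ctM; [exact: ct_cst|exact: h].
have c1 := cE _ cw; have c2 := cE _ cu; have c3 := cE _ cN.
have cg : continuous (fun t : R => Defs.gnorm g (b + t *: v) v).
  have [sm _ _] := metric_riemannian g; apply: (continuous_gnorm sm) => t.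
  by apply: cvgD; [exact: cst_continuous|apply: cvgZr_tmp; exact: cvg_id].
move: i1 i2 i3 c1 c2 c3.
pose z t := b 0 o2 + v 0 o2 * t.
pose f1 t := exp_excess e (pl g (r t) (z t) - pu g (r t) (z t)).
pose f2 t := exp_excess e (pu g (r t) (z t)); pose f3 t := exp_excess e (- pu g (r t) (z t)).
rewrite -/(z _) -/f1 -/f2 -/f3.
move=> i1 i2 i3 c1 c2 c3.
pose F t := expR (4 * e) + f1 t + f2 t + f3 t.
have c12 : continuous (fun t => expR (4 * e) + f1 t) by apply: ctD => //; exact: ct_cst.
have c123 : continuous (fun t => expR (4 * e) + f1 t + f2 t) by exact: ctD.
have cF : continuous F by exact: ctD.
apply: (@le_trans _ _ (int1 t1 t2 (fun t => enorm v * F t))).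
  apply: le_int1 => //; first by apply: ctM => //; exact: ct_cst.
  move=> t tI; have /andP[ar _] := rL t tI.
  have [h1 h2] := exp_difference_bound (pu g (r t) (zco (b + t *: v))) (pl g (r t) (zco (b + t *: v))).
  rewrite mulrC; apply: gnorm_le; first exact: lt_le_trans ar.
  - by move: h1; rewrite zE.
  - by move: h2; rewrite zE.
rewrite int1Zl // ler_wpM2l ?sqrtr_ge0 //.
rewrite /F (int1D _ _ c123 c3) (int1D _ _ c12 c2) (int1D _ _ (@ct_cst _ R (expR (4 * e))) c1) int1_cst //.
move: i1 i2 i3; set T := _ / `|v 0 o2| => i1 i2 i3.
rewrite m3 !addrA; exact: lerD (lerD (lerD (lexx _) i1) i2) i3.
Qed.

End NormBound.

Section BentDistance.
Context {R : realType}.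
Implicit Types (x y v : 'rV[R]_3) (t h : R).

Lemma enorm_add_z v (k : R) : enorm (v + k *: delta_mx 0 o2) <= enorm v + `|k|.
Proof.
rewrite /enorm !sum3 !mxE /= mulr0 mulr1 !addr0.
move: (v 0 o0) (v 0 o1) (v 0 o2) => a b c.
set N := Num.sqrt (a ^+ 2 + b ^+ 2 + c ^+ 2).
have s0 : 0 <= a ^+ 2 + b ^+ 2 + c ^+ 2 by rewrite !addr_ge0 ?sqr_ge0.
have N0 : 0 <= N by exact: sqrtr_ge0.
have N2 : N ^+ 2 = a ^+ 2 + b ^+ 2 + c ^+ 2 by exact: sqr_sqrtr.
have cN : `|c| <= N by rewrite -sqrtr_sqr ler_wsqrtr // lerDr addr_ge0 ?sqr_ge0.
have ck : c * k <= N * `|k|.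
  by apply: le_trans (ler_norm _) _; rewrite normrM ler_wpM2r.
rewrite -[leRHS]ger0_norm ?addr_ge0 // -sqrtr_sqr ler_wsqrtr //.
rewrite [leRHS]sqrrD N2 real_normK ?num_real // mulr2n; lra.
Qed.

Lemma enorm_bent_velocity x y h : enorm (bent_velocity x y h) <= enorm (x - y) + `|2 * h|.
Proof.
apply: le_trans (enorm_add_z _ _) _; rewrite lerD2r -[y - x]opprB /enorm.
by rewrite (eq_bigr (fun i => (x - y) 0 i ^+ 2)) // => i _; rewrite mxE sqrrN.
Qed.

(** The reason to bend vertically: the curve keeps its distance to the axis, so it does not leave
    [rho >= rho0]. *)
Lemma rho_bent_segment x y h t : rho (bent_segment x y h t) = rho ((1 - t) *: x + t *: y).
Proof.
by rewrite /rho /xco /yco inord_o0 inord_o1 /bent_segment !mxE /= !mulr0 !addr0.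
Qed.

Lemma zco_bent_segment x y h t :
  zco (bent_segment x y h t) = zco ((1 - t) *: x + t *: y) + h * (1 - `|2 * t - 1|).
Proof. by rewrite /zco inord_o2 /bent_segment !mxE /= !mulr1. Qed.

Lemma bent_velocity_z x y h : bent_velocity x y h 0 o2 = y 0 o2 - x 0 o2 + 2 * h.
Proof. by rewrite /bent_velocity !mxE /= mulr1. Qed.

Context (g : axisym_metric R).
Context (AB : forall q, half_plane q -> coef_A g q = 0 /\ coef_B g q = 0).
Context (a L e tau : R) (a0 : 0 < a) (L0 : 0 < L) (e0 : 0 < e) (tau0 : 0 < tau).
Context (tr_w : trace_bound a L e tau (fun r z : R => pl g r z - pu g r z)).
Context (tr_u : trace_bound a L e tau (pu g)).
Context (tr_v : trace_bound a L e tau (fun r z : R => - pu g r z)).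

(** Up to the factor [D * expR (4 * e)], each half contributes [1/2] and three excess integrals
    [4 L tau / |k|], whence [12 L]. *)
Lemma riemannian_dist_bent_le x y h (D : R) :
  (forall t, 0 <= t <= 1 -> a <= rho ((1 - t) *: x + t *: y) <= L) ->
  (forall t, 0 <= t <= 1 -> `|zco ((1 - t) *: x + t *: y)| + `|h| <= L) ->
  enorm (x - y) + `|2 * h| <= D ->
  let k1 := bent_velocity x y h 0 o2 in let k2 := bent_velocity x y (- h) 0 o2 in
  k1 != 0 -> k2 != 0 ->
  riemannian_dist g x y <=
  D * (expR (4 * e) * (1 + tau * (12 * L * (`|k1|^-1 + `|k2|^-1)))).
Proof.
move=> rL zL hD k1 k2 k10 k20.
have [sm _ _] := metric_riemannian g.
have box t : 0 <= t <= 1 ->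
    a <= rho (bent_segment x y h t) <= L /\ - L <= zco (bent_segment x y h t) <= L.
  move=> t01; rewrite rho_bent_segment zco_bent_segment rL //; split=> //.
  rewrite -ler_norml; apply: le_trans (ler_normD _ _) (le_trans _ (zL t t01)).
  rewrite lerD2l normrM ler_piMr //.
  by rewrite ler_norml; case: (ger0P (2 * t - 1)) => ?; apply/andP; split; lra.
have := riemannian_dist_le g (piecewise_C1_bent x y h).
rewrite bent_segment0 bent_segment1 => /le_trans; apply.
rewrite (curve_length_bent sm).
have h2 : 2^-1 <= 1 :> R by lra.
have h0 : 0 <= 2^-1 :> R by rewrite invr_ge0.
set T := expR (4 * e) * (2 * (2 * L) * tau).
have T0 : 0 <= T by rewrite !mulr_ge0 ?expR_ge0 // ltW.
have half v (b : 'rV[R]_3) (t1 t2 : R) : 0 <= t1 -> t2 <= 1 -> t1 <= t2 -> t2 - t1 = 2^-1 ->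
    enorm v <= D -> v 0 o2 != 0 ->
    (forall t, t1 <= t <= t2 -> bent_segment x y h t = b + t *: v) ->
    int1 t1 t2 (fun t => Defs.gnorm g (bent_segment x y h t) v) <=
    D * (expR (4 * e) * 2^-1 + 3 * (T / `|v 0 o2|)).
  move=> t10 t21 t12 dt vD v0 E.
  rewrite (@eq_int1 _ _ _ _ (fun t => Defs.gnorm g (b + t *: v) v)); last first.
    by move=> t tI; rewrite E.
  have bx t : t1 <= t <= t2 -> a <= rho (b + t *: v) <= L /\ - L <= zco (b + t *: v) <= L.
    move=> tI; rewrite -E //; apply: box; move: tI => /andP[p q].
    by rewrite (le_trans t10 p) (le_trans q t21).
  apply: le_trans (int1_gnorm_line_le AB e0 a0 tr_w tr_u tr_v t12 v0 bx) _.
  rewrite dt; apply: ler_wpM2r vD.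
  apply: addr_ge0; first exact: mulr_ge0 (expR_ge0 _) h0.
  by apply: mulr_ge0 => //; apply: divr_ge0 T0 (normr_ge0 _).
have i1 := half (bent_velocity x y h) x 0 2^-1 (lexx 0) h2 h0 (subr0 2^-1).
have i2 := half (bent_velocity x y (- h)) (x + (2 * h) *: delta_mx 0 o2) 2^-1 1 h0 (lexx 1) h2.
have {}i1 := i1 (le_trans (enorm_bent_velocity _ _ _) hD) k10.
have {}i1 := i1 (fun t tI => bent_segmentE x y h (proj2 (andP tI))).
have d2 : 1 - 2^-1 = 2^-1 :> R by field.
have hD' : enorm (x - y) + `|2 * - h| <= D by rewrite mulrN normrN.
have {}i2 := i2 d2 (le_trans (enorm_bent_velocity _ _ _) hD') k20.
have {}i2 := i2 (fun t tI => bent_segmentE' x y h (proj1 (andP tI))).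
apply: le_trans (lerD i1 i2) _.
rewrite -/k1 -/k2 /T; move: (expR (4 * e)) (`|k1|^-1) (`|k2|^-1) => E K1 K2.
by rewrite le_eqVlt; apply/orP; left; apply/eqP; field.
Qed.

End BentDistance.

(** * Choice of the constants *)

Unset Implicit Arguments.

Theorem theorem1p8 (R : realType) (M : set (axisym_metric R)) (R0 rho0 : R)
    (M_scal : nonneg_scalar_curvature M)
    (M_af : uniformly_asymptotically_flat M R0)
    (rho0_gt0 : 0 < rho0)
    (M_mono : radially_monotone M rho0)
    (M_AB : vanishing_AB M)
    (rho1 eps sigma : R)
    (rho1_gt : Num.max rho0 R0 < rho1)
    (eps_gt0 : 0 < eps) (sigma_gt0 : 0 < sigma)
    (x y : 'rV[R]_3)
    (xy_seg : segment_in x y (tube rho0 rho1 sigma)) :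
  exists2 delta : R, 0 < delta &
    forall g : axisym_metric R, M g -> adm_mass g <= delta ->
      riemannian_dist g x y <= enorm (x - y) + eps.
Proof.
(* The sign of [C] is read off from a member of the family, so the empty family is treated apart. *)
have [[g0 Mg0]|noM] := pselect (exists g, M g); last first.
  by exists 1 => // g Mg; case: noM; exists g.
have [C af] := M_af.
have C0 : 0 <= C by exact (decay_const_ge0 (M_AB g0 Mg0) (af g0 Mg0)).
move: rho1_gt; rewrite gt_max => /andP[rho01 R01].
have rho1_gt0 : 0 < rho1 by exact: lt_trans rho01.
(* With [d] the height difference, the vertical speeds are [d + 2 h] and [d - 2 h]. The candidate
   [eps / 8] fails only if [|d| = eps / 4], and then [eps / 16] works. *)
have [h [h0 h8 k10 k20]] : exists h : R, [/\ 0 < h, h <= eps / 8,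
    bent_velocity x y h 0 o2 != 0 & bent_velocity x y (- h) 0 o2 != 0].
  under eq_exists do rewrite !bent_velocity_z.
  have [E|E] := eqVneq `|y 0 o2 - x 0 o2| (eps / 4).
    exists (eps / 16); move: E; case: (ger0P (y 0 o2 - x 0 o2)) => s E.
      by split; [lra|lra|rewrite gt_eqF //; lra|rewrite gt_eqF //; lra].
    by split; [lra|lra|rewrite lt_eqF //; lra|rewrite lt_eqF //; lra].
  exists (eps / 8); split; [lra|lra| |]; apply: contra_neq E => E.
    by rewrite (_ : y 0 o2 - x 0 o2 = - (eps / 4)) ?normrN ?gtr0_norm //; lra.
  by rewrite (_ : y 0 o2 - x 0 o2 = eps / 4) ?gtr0_norm //; lra.
set k1 := bent_velocity x y h 0 o2 in k10; set k2 := bent_velocity x y (- h) 0 o2 in k20.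
set N := enorm (x - y); have N0 : 0 <= N by exact: sqrtr_ge0.
pose D := N + eps / 4; have D0 : 0 < D by rewrite /D; lra.
(* [e <= 1/8] gives [e^(4 e) <= 1 + 8 e <= 2]; the second bound makes the loss [D * 8 e] at most
   [eps / 8]. *)
pose e := Num.min 8^-1 (eps / (64 * D)).
have e0 : 0 < e by rewrite lt_min invr_gt0 ltr0n divr_gt0 ?mulr_gt0.
have e8 : e <= 8^-1 by rewrite ge_min lexx.
have eD : D * (8 * e) <= eps / 8.
  have : e <= eps / (64 * D) by rewrite ge_min lexx orbT.
  rewrite ler_pdivlMr ?mulr_gt0 //; lra.
have E1 : expR (4 * e) <= 1 + 8 * e.
  have e2 : `|4 * e| <= 2^-1 by rewrite gtr0_norm ?mulr_gt0 //; lra.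
  have := expR_taylor0 e2; rewrite [`|4 * e|]gtr0_norm ?mulr_gt0 //.
  by rewrite ler_norml => /andP[_]; lra.
have E2 : expR (4 * e) <= 2 by lra.
(* The box contains the bent segment, and [3 C / L <= e] puts [w], [u] and [-u] below [e] on its
   outer sides. *)
pose L := rho1 + eps + 3 * C / e.
have Ce : 0 <= 3 * C / e by rewrite divr_ge0 ?mulr_ge0 // ltW.
have rhoL : rho1 + eps <= L by rewrite /L; lra.
have L0 : 0 < L by lra.
have aL : rho0 <= L by lra.
have RL : R0 <= L by lra.
have rho1L : rho1 <= L by lra.
have rho1h : rho1 / 2 + h <= L by lra.
have hD : enorm (x - y) + `|2 * h| <= D.
  by rewrite gtr0_norm ?mulr_gt0 // lerD2l; lra.
have DN : D + eps / 8 + eps / 8 <= N + eps by rewrite /D; lra.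
have CL : 3 * C / L <= e.
  by rewrite ler_pdivrMr // -ler_pdivrMl // mulrC /L; lra.
pose S := 12 * L * (`|k1|^-1 + `|k2|^-1).
have S0 : 0 < S by rewrite !mulr_gt0 // addr_gt0 // invr_gt0 normr_gt0.
have DS0 : 0 < 16 * D * S by apply: mulr_gt0 S0; rewrite mulr_gt0.
(* [1/2] is for the geometric sum; the other bound makes the trace excess cost at most [eps / 8]. It
   depends on [k1] and [k2], hence on [x] and [y]. *)
pose tau := Num.min 2^-1 (eps / (16 * D * S)).
have tau01 : 0 < tau <= 2^-1.
  by rewrite ge_min lexx lt_min invr_gt0 ltr0n divr_gt0.
have tauS : D * (2 * (tau * S)) <= eps / 8.
  have : tau <= eps / (16 * D * S) by rewrite ge_min lexx orbT.
  rewrite ler_pdivlMr // => tauDS.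
  rewrite [leLHS](_ : _ = tau * (16 * D * S) / 8); last by field.
  by rewrite ler_pM2r ?invr_gt0.
have tau0 : 0 < tau by case/andP: tau01.
pose kappa := e / 2 * (tau * expR (- (2 * e))) ^+ 2.
have kappa0 : 0 < kappa by rewrite mulr_gt0 ?divr_gt0 ?exprn_gt0 ?mulr_gt0 ?expR_gt0.
pose L' := L + 36 * C / kappa.
have Ck : 0 <= 36 * C / kappa by rewrite divr_ge0 ?mulr_ge0 // ltW.
have LL : L <= L' by rewrite /L' lerDl.
have L'0 : 0 < L' by exact: lt_le_trans LL.
have CL' : 36 * C / kappa <= L' by rewrite /L' lerDr ltW.
(* The thresholds for the layer energies of [w] ([delta1]) and of [u] and [-u] ([delta2]). *)
pose delta1 := kappa * rho0 ^+ 2 * (kappa * rho0 / (12 * L' ^+ 2)) / 24.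
pose delta2 := kappa * e * rho0 / 8.
have delta10 : 0 < delta1.
  have s0 : 0 < kappa * rho0 / (12 * L' ^+ 2).
    by apply: divr_gt0 (mulr_gt0 kappa0 rho0_gt0) _; apply: mulr_gt0 (exprn_gt0 2 L'0).
  by apply: divr_gt0 => //; apply: mulr_gt0 s0; apply: mulr_gt0 (exprn_gt0 2 rho0_gt0).
have delta20 : 0 < delta2.
  by apply: divr_gt0 => //; apply: mulr_gt0 rho0_gt0; apply: mulr_gt0 e0.
exists (Num.min delta1 delta2); first by rewrite lt_min delta10.
move=> g Mg mass_le.
have AB := M_AB g Mg; have scal := M_scal g Mg.
have mono z : plx g rho0 z - pux g rho0 z <= 0 by exact: radial_monotone_profile AB _ _ rho0_gt0 (M_mono g Mg).
have d1 : Num.min delta1 delta2 <= delta1 by rewrite ge_min lexx.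
have d2 : Num.min delta1 delta2 <= delta2 by rewrite ge_min lexx orbT.
have tw := trace_bound_difference AB scal (af g Mg) rho0_gt0 aL LL RL e0 kappa0 mono CL CL'
  mass_le d1 tau01 (erefl _).
have tm k := @trace_bound_multiple R g AB scal R0 C (af g Mg) rho0 L e kappa
  (Num.min delta1 delta2) rho0_gt0 aL RL e0 CL mass_le d2 tau tau01 (erefl _) k.
have tu : trace_bound rho0 L e tau (pu g).
  have -> : pu g = fun x z => 1 * pu g x z by apply/funext => r; apply/funext => z; rewrite mul1r.
  by apply: tm; rewrite expr1n.
have tv : trace_bound rho0 L e tau (fun x z => - pu g x z).
  have -> : (fun x z => - pu g x z) = fun x z => - 1 * pu g x z.
    by apply/funext => r; apply/funext => z; rewrite mulN1r.
  by apply: tm; rewrite sqrrN expr1n.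
have rL t : 0 <= t <= 1 -> rho0 <= rho ((1 - t) *: x + t *: y) <= L.
  move=> /xy_seg[/andP[r1 r2] _]; rewrite (le_trans r2 rho1L) andbT.
  by apply: le_trans r1; rewrite lerDl ltW.
have zL t : 0 <= t <= 1 -> `|zco ((1 - t) *: x + t *: y)| + `|h| <= L.
  by move=> /xy_seg[_ z1]; rewrite [`|h|]gtr0_norm // (le_trans _ rho1h) // lerD2r.
apply: le_trans (riemannian_dist_bent_le AB rho0_gt0 L0 e0 tau0 tw tu tv rL zL hD k10 k20) _.
rewrite -/k1 -/k2 -/S.
(* The budget: [eps / 4] for the bend inside [D], [eps / 8] for [e] and [eps / 8] for [tau]. *)
apply: (@le_trans _ _ (D * (1 + 8 * e) + D * (2 * (tau * S)))); last first.
  by rewrite mulrDr mulr1; apply: le_trans DN; rewrite !lerD.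
rewrite -mulrDr ler_pM2l // mulrDr mulr1 lerD //.
apply: ler_wpM2r E2; apply: ltW; exact: mulr_gt0 tau0 S0.
Qed.
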